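(* Let $\mathfrak{g}$ be a root-reductive Lie algebra and $\mathfrak{h}\subseteq\mathfrak{g}$ a Cartan subalgebra. Then $\mathfrak{h}$ is nilpotent of depth at most $2$, and $\mathfrak{h}=\mathfrak{g}^0(\mathfrak{h})$.
   Context: All Lie algebras are over $\mathbb{C}$. An inclusion of finite-dimensional reductive Lie algebras $\mathfrak{l}\subseteq\mathfrak{m}$ is a root inclusion if, for some Cartan subalgebra $\mathfrak{h}_{\mathfrak{m}}$ of $\mathfrak{m}$, the subalgebra $\mathfrak{l}\cap\mathfrak{h}_{\mathfrak{m}}$ is a Cartan subalgebra of $\mathfrak{l}$ and each $\mathfrak{l}\cap\mathfrak{h}_{\mathfrak{m}}$-root space $\mathfrak{l}^\alpha$ is also a root space of $\mathfrak{m}$. A Lie algebra $\mathfrak{g}$ is root-reductive if it is isomorphic to a union $\bigcup_{i\in\mathbb{Z}_{>0}}\mathfrak{g}_i$ of nested finite-dimensional reductive Lie algebras with respect to root inclusions for a fixed choice of nested Cartan subalgebras $\mathfrak{h}_i\subseteq\mathfrak{g}_i$ with $\mathfrak{h}_{i-1}=\mathfrak{h}_i\cap\mathfrak{g}_{i-1}$. Then $\mathfrak{g}_i$ is reductive in $\mathfrak{g}_{i+1}$. In a finite-dimensional reductive Lie algebra an element is semisimple if its adjoint endomorphism is semisimple, and nilpotent if it lies in the derived algebra and its adjoint endomorphism is nilpotent; these notions are preserved under $\mathfrak{g}_i\subseteq\mathfrak{g}_{i+1}$, so every $x\in\mathfrak{g}$ has a Jordan decomposition $x=x_{ss}+x_{nil}$.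 For a subalgebra $\mathfrak{h}\subseteq\mathfrak{g}$, $\mathfrak{h}_{ss}:=\{h_{ss}:h\in\mathfrak{h}\}$, and $\mathfrak{z}_{\mathfrak{g}}(\mathfrak{h}_{ss})$ is its centralizer in $\mathfrak{g}$. A Lie algebra is locally nilpotent if every finite subset is contained in a nilpotent subalgebra. $\mathfrak{h}$ is a Cartan subalgebra if it is locally nilpotent and $\mathfrak{h}=\mathfrak{z}_{\mathfrak{g}}(\mathfrak{h}_{ss})$. ''Nilpotent of depth at most $2$'' means $[[\mathfrak{h},\mathfrak{h}],\mathfrak{h}]=0$. Finally $\mathfrak{g}^0(\mathfrak{h}):=\{m\in\mathfrak{g}:\exists\, i\in\mathbb{Z}_{>0}\text{ such that }(\mathrm{ad}\,x)^i(m)=0\ \forall x\in\mathfrak{h}\}$. *)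

(* Defs.v *)
From HB Require Import structures.
From mathcomp Require Import all_boot all_order all_algebra.
From mathcomp Require Import boolp classical_sets cardinality reals.
From mathcomp Require Export complex.

Set Implicit Arguments.
Unset Strict Implicit.
Unset Printing Implicit Defensive.

Import GRing.Theory.
Local Open Scope classical_set_scope.
Local Open Scope ring_scope.

HB.mixin Record Lmodule_isLieAlgebra (K : fieldType) L of GRing.Lmodule K L := {
  lie : L -> L -> L ;
  lie_linearl : forall (a : K) (x y z : L),
    lie (a *: x + y) z = a *: lie x z + lie y z ;
  lie_linearr : forall (a : K) (x y z : L),
    lie x (a *: y + z) = a *: lie x y + lie x z ;
  liexx : forall x : L, lie x x = 0 ;
  lie_jacobi : forall x y z : L,
    lie x (lie y z) + lie y (lie z x) + lie z (lie x y) = 0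
}.

#[short(type="lieAlgType")]
HB.structure Definition LieAlgebra (K : fieldType) :=
  { L of GRing.Lmodule K L & Lmodule_isLieAlgebra K L }.

Notation "[ 'lie' x , y ]" := (lie x y) (format "[ 'lie'  x ,  y ]").

(* Subalgebras, ideals, etc. of a fixed Lie algebra g are sets of elements of
   g; all the notions below with a parameter A : set g are the intrinsic
   notions of the Lie algebra A, and do not see the elements of g outside A. *)
Section LieTheory.
Variables (K : fieldType) (g : lieAlgType K).
Implicit Types (A B U W h : set g) (x y s n : g).

Definition subspace U : Prop :=
  U 0 /\ forall (a : K) x y, U x -> U y -> U (a *: x + y).

Definition finite_dimensional U : Prop :=
  exists2 F : set g, finite_set F & U = smallest subspace F.

Definition direct_sum A U W : Prop :=
  U `&` W = [set 0] /\ A = [set u + w | u in U & w in W].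

Definition subalgebra A : Prop :=
  subspace A /\ forall x y, A x -> A y -> A [lie x, y].

Definition ideal A U : Prop :=
  [/\ subspace U, U `<=` A & forall x y, A x -> U y -> U [lie x, y]].

Definition lie_product A B : set g :=
  smallest subspace [set [lie x, y] | x in A & y in B].

Fixpoint lower_central A (k : nat) : set g :=
  if k is k'.+1 then lie_product (lower_central A k') A else A.

Definition nilpotent A : Prop := exists k, lower_central A k = [set 0].

Definition locally_nilpotent A : Prop :=
  forall F : set g, finite_set F -> F `<=` A ->
  exists N : set g, [/\ subalgebra N, N `<=` A, nilpotent N & F `<=` N].

Definition centralizer A : set g := [set x | forall y, A y -> [lie x, y] = 0].

Definition normalizer A U : set g :=
  [set x | A x /\ forall y, U y -> U [lie x, y]].

(* The adjoint representation of A is semisimple: every submodule has a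
   complementary submodule. *)
Definition reductive A : Prop :=
  forall U, ideal A U -> exists2 W, ideal A W & direct_sum A U W.

Definition ad_stable_subspace A x U : Prop :=
  [/\ subspace U, U `<=` A & forall y, U y -> U [lie x, y]].

(* The endomorphism ad x of A is semisimple. *)
Definition semisimple_in A x : Prop :=
  A x /\ forall U, ad_stable_subspace A x U ->
    exists2 W, ad_stable_subspace A x W & direct_sum A U W.

Definition nilpotent_in A x : Prop :=
  lie_product A A x /\
  exists k : nat, forall y, A y -> iter k (lie x) y = 0.

Definition jordan_decomposition_in A x s n : Prop :=
  [/\ semisimple_in A s, nilpotent_in A n, [lie s, n] = 0 & x = s + n].

Definition findim_cartan A h : Prop :=
  [/\ subalgebra h, h `<=` A, nilpotent h & normalizer A h = h].

Definition weight_space A h (alpha : g -> K) : set g :=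
  [set x | A x /\ forall t, h t -> [lie t, x] = alpha t *: x].

(* S is the root space of A for a root alpha with respect to h.  Only the
   restriction of alpha to h matters; it is automatically linear on h, since
   S contains a nonzero vector. *)
Definition is_root_space A h (S : set g) : Prop :=
  exists alpha : g -> K,
    [/\ exists2 t, h t & alpha t != 0,
        S = weight_space A h alpha
      & S <> [set 0]].

(* B `<=` A is a root inclusion with respect to the Cartan subalgebra h of A. *)
Definition root_inclusion B A h : Prop :=
  [/\ B `<=` A, findim_cartan A h, findim_cartan B (B `&` h)
    & forall S, is_root_space B (B `&` h) S -> is_root_space A h S].

(* (G_ i, H_ i) exhibits g as a root-reductive Lie algebra. *)
Record root_reductive (G_ H_ : nat -> set g) : Prop := RootReductive {
  rr_subalgebra : forall i, subalgebra (G_ i) ;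
  rr_findim : forall i, finite_dimensional (G_ i) ;
  rr_reductive : forall i, reductive (G_ i) ;
  rr_cartan : forall i, findim_cartan (G_ i) (H_ i) ;
  rr_compat : forall i, H_ i = H_ i.+1 `&` G_ i ;
  rr_root : forall i, root_inclusion (G_ i) (G_ i.+1) (H_ i.+1) ;
  rr_union : \bigcup_i G_ i = setT
}.

Section Exhaustion.
Variable G_ : nat -> set g.

Definition jordan_decomposition x s n : Prop :=
  exists i, jordan_decomposition_in (G_ i) x s n.

Definition semisimple_parts h : set g :=
  [set s | exists2 x, h x & exists n, jordan_decomposition x s n].

Definition cartan_subalgebra h : Prop :=
  [/\ subalgebra h, locally_nilpotent h & h = centralizer (semisimple_parts h)].

End Exhaustion.

Definition ad_nil_space h : set g :=
  [set m | exists2 i : nat, (0 < i)%N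
    & forall x, h x -> iter i (lie x) m = 0].

End LieTheory.

(* Main.v *)
(* Let [t] be the set of semisimple parts of [h].  Since [h = z(t)], the
   elements of [t] commute with [h] and lie in it; being ad-semisimple, they
   force [g^0(h)] into [z(t) = h].  Everything then rests on [[a, b], c] = 0,
   where [a], [b], [c] in [h] may be replaced by their nilpotent parts, say in
   [[g_k, g_k]].

   If [z = [a, [b, c]]] were nonzero, some root space [g^beta] would lie in
   every ideal of [g_k] containing [z].  There are a fixed [m] and, for each
   [j], two [g_j]-submodules [V], [V'] of some [g_l], put in duality by the
   Killing form [kappa] of [g_l], such that [g^beta] does not kill [V] and
   [[x u, y u'] in g_m + h_l] for all [x], [y] in [[g_k, g_k]].  Choose [j] so
   that [g_j] contains a finite [F] in [t] which cuts [h] out of [g_m], and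
   decompose [V], [V'] into weight spaces of [F].  For opposite weights,
   [kappa(a b c u, u') = - kappa(b, [c u, a u'])]; here [[c u, a u']] normalizes
   [N], the part of [h] in [g_m], and [b] is a nilpotent element of [N], so the
   trace vanishes by Engel's theorem.  Hence all products of [a], [b], [c] in any
   order kill [V], so [z] kills [V], and so does [g^beta]: a contradiction.

   As for [V]: if only finitely many roots [gamma] have [gamma(h_beta) < 0], then
   the component of [beta] in the root system is finite and [V = V'] is its
   ideal.  Otherwise take [V] to be the sum of the [g^(gamma + lambda)] and [V']
   that of the opposite root spaces, where [gamma] is generic for a nonprincipal
   ultrafilter on such roots and [lambda] runs through the root lattice of
   [g_j]; Gram matrix inequalities show that only finitely many [lambda] are
   seen by [g_k], independently of [j].

   The theorems of Weyl and Lie are avoided by detecting nilpotency of [w] through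
   [tr (t w) = 0], where [t] acts by the conjugates of the eigenvalues of [w]. *)

(* For finite-dimensional [g], a nilpotent element of [h] is Killing-orthogonal to all of [g], hence
   zero, and [h] is abelian. In the limit this argument breaks down: the set [F] that cuts [h] out
   of [G_ m] need not lie in [G_ m], so the part of [h] in [G_ m] need not be the centralizer of
   anything inside [G_ m]. One works instead with the Killing form of a large [G_ l], and brings
   brackets back to the fixed [G_ m] up to [H_ l], which normalizes [G_ m]. Since [F] is chosen
   after [m], and the modules after [F], the integer [m] must not depend on [j]; all finiteness
   statements on weights serve this. Only the root [ga] may be chosen after [j]. The depth is 2
   because three factors are needed: [c] on [u] and [a] on [u'] each move a vector to the finitely
   many weights seen by [G_ k], and [b] remains to be tested against the bracket of the results. The
   ultrafilter decides for all shifts at once whether a generic translate is a root, so that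
   finiteness can be proved before any particular [ga] is fixed. *)
Require Import Defs.
From HB Require Import structures.
From mathcomp Require Import all_boot all_order all_algebra.
From mathcomp Require Import zify ring.
From mathcomp Require Import boolp classical_sets cardinality functions filter.
From mathcomp Require Import reals complex.

Set Implicit Arguments.
Unset Strict Implicit.
Unset Printing Implicit Defensive.

Import Order.TTheory GRing.Theory Num.Theory.
Local Open Scope classical_set_scope.
Local Open Scope ring_scope.

(** * Linear algebra *)

Section Interpolation.
Variable F : fieldType.

Lemma coprimep_XsubC_exp_prod (n : nat) (a : F) (s : seq F) : a \notin s ->
  coprimep (('X - a%:P) ^+ n) (\prod_(b <- s) ('X - b%:P) ^+ n).
Proof.
elim: s => [|b s IHs]; first by rewrite big_nil coprimep1.
rewrite inE negb_or big_cons coprimepMr => /andP[ab /IHs ->]; rewrite andbT.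
rewrite coprimep_expl // coprimep_expr // coprimep_XsubC.
by rewrite root_XsubC eq_sym.
Qed.

Lemma dvdp_prod_XsubC_exp (n : nat) (s : seq F) (p : {poly F}) : uniq s ->
  (forall a, a \in s -> ('X - a%:P) ^+ n %| p) ->
  \prod_(b <- s) ('X - b%:P) ^+ n %| p.
Proof.
elim: s => [|b s IHs] /=; first by rewrite big_nil dvd1p.
move=> /andP[bs us] sp; rewrite big_cons Gauss_dvdp ?coprimep_XsubC_exp_prod //.
rewrite sp ?mem_head // IHs // => a as_; apply: sp.
by rewrite inE as_ orbT.
Qed.

(** Chinese remainder theorem: the correction factor [v * M] is 1 modulo the new modulus and 0
    modulo the earlier ones. *)
Lemma poly_interpolation (n : nat) (s : seq F) (c : F -> F) : uniq s ->
  exists p : {poly F}, forall a, a \in s -> ('X - a%:P) ^+ n %| p - (c a)%:P.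
Proof.
elim: s => [|a s IHs] /=; first by exists 0.
move=> /andP[as_ us]; have [p pP] := IHs us.
have /Bezout_eq1_coprimepP[[u v] /= uv1] := coprimep_XsubC_exp_prod n as_.
set M := \prod_(b <- s) _ in uv1.
exists (p + ((c a)%:P - p) * (v * M)) => b; rewrite inE => /orP[/eqP->|bs].
  have -> : p + ((c a)%:P - p) * (v * M) - (c a)%:P =
            (p - (c a)%:P) * (1 - v * M).
    by rewrite mulrBr mulr1 -addrA [_ - (c a)%:P]addrC addrA -[p - _]opprB mulNr opprK.
  by rewrite -uv1 addrK mulrA dvdp_mull.
rewrite addrAC dvdp_add ?pP // dvdp_mull // dvdp_mull // /M.
by rewrite (big_rem _ bs) /= dvdp_mulr.
Qed.

End Interpolation.

(** * Traces of polynomials in a matrix *)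

Section TraceHorner.
Variable C : numClosedFieldType.

Lemma trig_mulmx n (A B : 'M[C]_n) : is_trig_mx A -> is_trig_mx B ->
  is_trig_mx (A *m B) /\ forall i, (A *m B) i i = A i i * B i i.
Proof.
move=> /is_trig_mxP tA /is_trig_mxP tB; split=> [|i].
  apply/is_trig_mxP => i j ij; rewrite mxE big1 // => k _.
  have [ik|ki] := ltnP i k; first by rewrite tA // mul0r.
  by rewrite tB ?mulr0 // (leq_ltn_trans ki).
rewrite mxE (bigD1 i) //= big1 ?addr0 // => k ki.
have [ik|ki'] := ltnP i k; first by rewrite tA // mul0r.
by rewrite tB ?mulr0 // ltn_neqAle ki' andbT.
Qed.

Lemma horner_trig_mx n (A : 'M[C]_n.+1) (p : {poly C}) : is_trig_mx A ->
  is_trig_mx (horner_mx A p) /\ forall i, horner_mx A p i i = p.[A i i].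
Proof.
move=> tA; elim/poly_ind: p => [|p c [tp pE]].
  rewrite rmorph0; split=> [|i]; last by rewrite horner0 mxE.
  by apply/is_trig_mxP => i j _; rewrite mxE.
rewrite rmorphD rmorphM /= horner_mx_X horner_mx_C.
have [tpA pAE] := trig_mulmx tp tA; split=> [|i].
  apply/is_trig_mxP => i j ij; rewrite !mxE.
  move/is_trig_mxP: tpA => /(_ i j ij); rewrite mxE => ->.
  by rewrite -(inj_eq val_inj) ltn_eqF //= mulr0n addr0.
by rewrite hornerMXaddC -pE -pAE mxE [X in _ + X]mxE eqxx mulr1n.
Qed.

(** Schur triangularization: [d] is the diagonal of a triangular conjugate of [A], that is, the
    eigenvalues with multiplicity. *)
Lemma mxtrace_horner n (A : 'M[C]_n.+1) : exists d : 'I_n.+1 -> C,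
  (forall a, eigenvalue A a <-> exists i, a = d i) /\
  (forall p, \tr (horner_mx A p) = \sum_i p.[d i]).
Proof.
have [P Pu] := @Schur C n.+1 A isT.
have Punit := unitarymx_unit Pu; rewrite /similar_to conjumx // => tr.
have trE X : \tr (P *m X *m invmx P) = \tr X.
  by rewrite mxtrace_mulC mulmxA mulVmx // mul1mx.
set B := _ *m invmx P in tr.
have BA : invmx P *m B = A *m invmx P by rewrite /B -mulmxA mulKmx.
have AB : B *m P = P *m A by rewrite /B mulmxKV.
exists (fun i => B i i); split=> [a|p]; last first.
  rewrite -trE -horner_mx_uconj //; apply: eq_bigr => i _.
  by have [_ ->] := horner_trig_mx p tr.
have -> : eigenvalue A a = eigenvalue B a.
  apply/eigenvalueP/eigenvalueP => -[v vE v0].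
    exists (v *m invmx P); first by rewrite -mulmxA BA mulmxA vE scalemxAl.
    by apply: contraNneq v0 => vP0; rewrite -[v](mulmxKV Punit) vP0 mul0mx.
  exists (v *m P); first by rewrite -mulmxA -AB mulmxA vE scalemxAl.
  by apply: contraNneq v0 => vP0; rewrite -[v](mulmxK Punit) vP0 mul0mx.
rewrite eigenvalue_root_char char_poly_trig // /root horner_prod prodf_seq_eq0.
split=> [/hasP[i _]|[i ->]]; last first.
  by apply/hasP; exists i; rewrite ?mem_index_enum //= hornerXsubC subrr.
by rewrite /= hornerXsubC subr_eq0 => /eqP ->; exists i.
Qed.

End TraceHorner.

(** * The Jordan-Chevalley decomposition of a matrix *)

Section JordanChevalley.
Variable C : numClosedFieldType.
Implicit Types (a : C).

Definition gen_eigen n (A : 'M[C]_n) a (v : 'rV_n) :=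
  exists k, iter k (mulmxr (A - a%:M)) v = 0.

Lemma gen_eigen_horner n (A : 'M[C]_n.+1) a k (v : 'rV_n.+1) :
  iter k (mulmxr (A - a%:M)) v = v *m horner_mx A (('X - a%:P) ^+ k).
Proof.
elim: k => [|k IHk]; first by rewrite expr0 rmorph1 mulmx1.
rewrite iterS IHk exprSr rmorphM /= rmorphB /= horner_mx_X horner_mx_C.
by rewrite mulmxA.
Qed.

(* [S] and [T] are polynomials in [A] interpolating the identity and the
   conjugation at the eigenvalues, so that [\tr (T *m A)] is the sum of the
   squared moduli of the eigenvalues. *)
Lemma jordan_chevalley_mx n (A : 'M[C]_n) : exists S T : 'M[C]_n,
  [/\ forall B, comm_mx A B -> comm_mx S B /\ comm_mx T B,
      forall m (M : 'M_(m, n)), stablemx M A -> stablemx M S /\ stablemx M T,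
      forall a v, gen_eigen A a v -> v *m S = a *: v /\ v *m T = a^* *: v,
      \tr (T *m A) = 0 -> forall a, eigenvalue A a -> a = 0 &
      forall v, exists2 s : seq ('rV[C]_n),
        v = \sum_(u <- s) u & forall u, u \in s -> exists a, gen_eigen A a u].
Proof.
case: n A => [|n] A.
  exists 0, 0; split=> [B _|m M _|a v _|_ a|v].
  - by rewrite /comm_mx !thinmx0.
  - by rewrite !mulmx0 !sub0mx.
  - by rewrite !thinmx0.
  - by case/eigenvalueP=> v _; rewrite thinmx0 eqxx.
  - by exists [::] => //; rewrite thinmx0 big_nil.
have [s char_s] := closed_field_poly_normal (char_poly A).
rewrite (monicP (char_poly_monic A)) scale1r in char_s.
pose r := undup s; have ur : uniq r := undup_uniq s.
(* The exponent is the size of [A], which bounds every multiplicity, so that [char_poly A] divides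
   the product [Pi]. *)
pose Q a := ('X - a%:P) ^+ n.+1.
pose Pi := \prod_(a <- r) Q a.
have PiE : Pi = (\prod_(a <- r) ('X - a%:P)) ^+ n.+1.
  by rewrite /Pi prodrXl.
have size_s : size s = n.+1.
  by have := size_char_poly A; rewrite char_s size_prod_XsubC => -[].
have char_dvd : char_poly A %| Pi.
  rewrite PiE char_s -size_s.
  have: {subset s <= r} by move=> x; rewrite mem_undup.
  elim: (s) => [|x t IHt] st; first by rewrite big_nil dvd1p.
  rewrite big_cons /= exprS dvdp_mul //.
    rewrite dvdp_XsubCl root_prod_XsubC; apply: st; exact: mem_head.
  by apply: IHt => y yt; apply: st; rewrite inE yt orbT.
have PiA (p : {poly C}) : (forall a, a \in r -> Q a %| p) -> horner_mx A p = 0.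
  move=> rp; have /dvdpP[q ->] : char_poly A %| p.
    by apply: dvdp_trans char_dvd _; apply: dvdp_prod_XsubC_exp.
  by rewrite rmorphM /= Cayley_Hamilton mulr0.
have [p pP] := poly_interpolation n.+1 id ur.
have [q qP] := poly_interpolation n.+1 (@Num.conj C) ur.
have ev_r a : eigenvalue A a -> a \in r.
  by rewrite eigenvalue_root_char char_s root_prod_XsubC mem_undup.
have genP a v (f : {poly C}) c : gen_eigen A a v ->
    (a \in r -> Q a %| f - c%:P) -> v *m horner_mx A f = c *: v.
  case=> k; rewrite gen_eigen_horner => vk0 fP.
  suff: v *m horner_mx A (f - c%:P) = 0.
    rewrite rmorphB /= horner_mx_C mulmxBr mul_mx_scalar => /eqP.
    by rewrite subr_eq0 => /eqP.
  (* The exponent [k] is arbitrary, but [v] is also killed by [Pi]; a Bezout relation then gives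
     [Q a] as annihilator, or 1 if [a] is not an eigenvalue, and in that case [v] is zero. *)
  have [h hv hdvd] : exists2 h, v *m horner_mx A h = 0 & h %| f - c%:P.
    have vr : v *m horner_mx A (char_poly A) = 0 by rewrite Cayley_Hamilton mulmx0.
    have [ar|ar] := boolP (a \in r).
      exists (Q a); last exact: fP.
      pose P' := \prod_(b <- rem a r) Q b.
      have cop : coprimep (('X - a%:P) ^+ k) P'.
        apply: coprimep_expl.
        have := @coprimep_XsubC_exp_prod _ n.+1 a (rem a r).
        rewrite mem_rem_uniqF // => /(_ isT).
        by rewrite coprimep_pexpl.
      have /Bezout_eq1_coprimepP[[u w] /= uw1] := cop.
      have -> : Q a = ('X - a%:P) ^+ k * (u * Q a) + Pi * w.
        rewrite /Pi (big_rem _ ar) /= -/P'.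
        by rewrite -[LHS]mul1r -uw1; ring.
      have vPi : v *m horner_mx A Pi = 0.
        rewrite PiA ?mulmx0 // => b br; rewrite /Pi (big_rem _ br) /=.
        by rewrite dvdp_mulr.
      rewrite rmorphD !(rmorphM _ _ _) /= mulmxDr -!mulmxE !mulmxA vk0 vPi.
      by rewrite !mul0mx addr0.
    exists 1; last exact: dvd1p.
    have /Bezout_eq1_coprimepP[[u w] /= uw1] :
      coprimep (('X - a%:P) ^+ k) (\prod_(b <- r) Q b).
      apply: coprimep_expl; have := @coprimep_XsubC_exp_prod _ n.+1 a r ar.
      by rewrite coprimep_pexpl.
    rewrite -uw1 rmorphD !rmorphM /= mulmxDr -!mulmxE.
    rewrite [horner_mx A u *m _](comm_horner_mx2 A) !mulmxA vk0 mul0mx add0r.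
    rewrite -mulmxA [horner_mx A w *m _](comm_horner_mx2 A).
    by rewrite PiA ?mul0r ?mulmx0 // => b br; rewrite (big_rem _ br) /= dvdp_mulr.
  have /dvdpP[w ->] := hdvd.
  by rewrite mulrC rmorphM /= -mulmxE mulmxA hv mul0mx.
exists (horner_mx A p), (horner_mx A q); split=> [B AB|m M MA|a v va|trT a|v].
- by split; apply: comm_horner_mx.
- case: m M MA => [|m] M MA; first by rewrite !flatmx0 !sub0mx.
  have st f : stablemx M (horner_mx A f).
    elim/poly_ind: f => [|f c IHf]; first by rewrite rmorph0 stablemx0.
    rewrite rmorphD rmorphM /= horner_mx_X horner_mx_C.
    by rewrite stablemxD ?stablemxM ?stablemxC.
  by [].
- by rewrite (genP _ _ _ _ va (@pP a)) (genP _ _ _ _ va (@qP a)).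
- have [d [dev dtr]] := mxtrace_horner A.
  have ev_horner (f : {poly C}) b : eigenvalue A b -> forall c, Q b %| f - c%:P -> f.[b] = c.
    move=> _ c /dvdpP[w fE].
    have -> : f = w * Q b + c%:P by rewrite -fE subrK.
    by rewrite /Q !hornerE subrr expr0n mulr0 add0r.
  have qX : horner_mx A q *m A = horner_mx A (q * 'X).
    by rewrite rmorphM /= horner_mx_X.
  move: trT; rewrite qX dtr => sum0 ev_a.
  have ge0 i : 0 <= (q * 'X).[d i].
    have di : eigenvalue A (d i) by apply/dev; exists i.
    rewrite hornerMX (ev_horner _ _ di _ (qP _ (ev_r _ di))).
    by rewrite mulrC mul_conjC_ge0.
  have [i ->] := (dev a).1 ev_a.
  have /eqP := sum0; rewrite psumr_eq0 // => /allP/(_ i (mem_index_enum i)).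
  have di : eigenvalue A (d i) by apply/dev; exists i.
  rewrite hornerMX (ev_horner _ _ di _ (qP _ (ev_r _ di))).
  by rewrite mulrC mul_conjC_eq0 => /eqP.
(* At [A], the polynomials [e b] become the projections onto the generalized eigenspaces. *)
have ex_e b : exists e : {poly C}, all (fun a => Q a %| e - ((b == a)%:R)%:P) r.
  have [e eP] := poly_interpolation n.+1 (fun a => (b == a)%:R) ur.
  by exists e; apply/allP => a /eP.
pose e b := xchoose (ex_e b).
have eE b a : a \in r -> Q a %| e b - ((b == a)%:R)%:P.
  exact: (allP (xchooseP (ex_e b))).
exists [seq v *m horner_mx A (e b) | b <- r] => [|u /mapP[b br ->]].
  rewrite big_map -mulmx_sumr -rmorph_sum /=.
  have := @PiA (\sum_(b <- r) e b - 1); rewrite rmorphB rmorph1 => Pi0.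
  have -> : horner_mx A (\sum_(b <- r) e b) = 1.
    apply/eqP; rewrite -subr_eq0; apply/eqP/Pi0 => a ar.
    rewrite (big_rem a) //= addrAC dvdp_add //.
      by have := eE a a ar; rewrite eqxx.
    rewrite big_seq; apply: (big_ind (fun f => Q a %| f)) => //.
    - by move=> f h; apply: dvdp_add.
    - move=> b; rewrite mem_rem_uniq // inE => /andP[ba _].
      by have := eE b a ar; rewrite (negbTE ba) subr0.
  by rewrite mulmx1.
exists b, n.+1; rewrite gen_eigen_horner -/(Q b) -mulmxA mulmxE -rmorphM /=.
rewrite PiA ?mulmx0 // => a ar; have [<-|ba] := eqVneq b a.
  by rewrite dvdp_mull.
by rewrite dvdp_mulr //; have := eE b a ar; rewrite (negbTE ba) subr0.
Qed.

End JordanChevalley.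

(** * Subspaces of a Lie algebra and their operators *)

Section Subspaces.
Variables (K : fieldType) (g : lieAlgType K).
Implicit Types (U W : set g) (x y : g).

Lemma subspace0 U : subspace U -> U 0. Proof. by case. Qed.

Lemma subspaceZ U a x : subspace U -> U x -> U (a *: x).
Proof. by move=> [U0 UP] Ux; rewrite -[_ *: _]addr0; apply: UP. Qed.

Lemma subspaceD U x y : subspace U -> U x -> U y -> U (x + y).
Proof. by move=> [U0 UP] Ux Uy; rewrite -[x]scale1r; apply: UP. Qed.

Lemma subspaceN U x : subspace U -> U x -> U (- x).
Proof. by move=> sU Ux; rewrite -scaleN1r; apply: subspaceZ. Qed.

Lemma subspaceB U x y : subspace U -> U x -> U y -> U (x - y).
Proof. by move=> sU Ux Uy; apply: subspaceD => //; apply: subspaceN. Qed.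

Lemma subspace_sum U (I : Type) (r : seq I) (P : pred I) (F : I -> g) :
  subspace U -> (forall i, P i -> U (F i)) -> U (\sum_(i <- r | P i) F i).
Proof.
move=> sU UF; apply: (big_ind U) => //; first exact: subspace0.
by move=> x y; apply: subspaceD.
Qed.

Lemma subspace_sum_seq U (I : eqType) (r : seq I) (F : I -> g) :
  subspace U -> (forall i, i \in r -> U (F i)) -> U (\sum_(i <- r) F i).
Proof. by move=> sU UF; rewrite big_seq; apply: subspace_sum. Qed.

Lemma subspaceI U W : subspace U -> subspace W -> subspace (U `&` W).
Proof.
move=> [U0 UP] [W0 WP]; split=> // a x y [Ux Wx] [Uy Wy].
by split; [apply: UP|apply: WP].
Qed.

Lemma subspace_smallest (F : set g) : subspace (smallest (@subspace K g) F).
Proof.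
split=> [A [[]]//|a x y Fx Fy A [sA FA]].
by case: (sA) => _; apply; [apply: Fx|apply: Fy].
Qed.

Lemma subspace_set0 : subspace [set (0 : g)].
Proof. by split=> //= a x y -> ->; rewrite scaler0 addr0. Qed.

Definition lin_comb n (b : 'I_n -> g) (v : 'rV[K]_n) := \sum_i v 0 i *: b i.

Lemma lin_comb_is_linear n (b : 'I_n -> g) : linear (lin_comb b).
Proof.
move=> a u v; rewrite /lin_comb scaler_sumr -big_split /=.
by apply: eq_bigr => i _; rewrite !mxE scalerDl scalerA.
Qed.

HB.instance Definition _ n (b : 'I_n -> g) :=
  GRing.isLinear.Build K 'rV[K]_n g *:%R (lin_comb b) (lin_comb_is_linear b).

Definition is_basis U n (b : 'I_n -> g) :=
  (forall x, U x <-> exists v, x = lin_comb b v) /\ injective (lin_comb b).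

Lemma lin_comb_delta n (b : 'I_n -> g) i : lin_comb b (delta_mx 0 i) = b i.
Proof.
rewrite /lin_comb (bigD1 i) //= big1 => [|j ji].
  by rewrite mxE !eqxx scale1r addr0.
by rewrite mxE (negbTE ji) andbF scale0r.
Qed.

Lemma finite_dimensional_basis U : finite_dimensional U ->
  exists n (b : 'I_n -> g), is_basis U b.
Proof.
move=> [F /finite_seqP[s ->] UE].
pose spans n := `[< exists b : 'I_n -> g, forall x, U x <-> exists v, x = lin_comb b v >].
have ex : exists n, spans n.
  exists (size s); apply/asboolP; exists (fun i => s`_i) => x; split=> [Ux|[v ->]].
    rewrite UE in Ux; apply: (Ux [set x | exists v, x = lin_comb (fun i : 'I_(size s) => s`_i) v]).
    split=> [|y /= ys]; first split.
    - by exists 0; rewrite linear0.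
    - by move=> a _ _ [u ->] [v ->]; exists (a *: u + v); rewrite linearP.
    - have ylt : (index y s < size s)%N by rewrite index_mem.
      by exists (delta_mx 0 (Ordinal ylt)); rewrite lin_comb_delta /= nth_index.
  have sU : subspace U by rewrite UE; apply: subspace_smallest.
  apply: subspace_sum => // i _; apply: subspaceZ => //.
  by rewrite UE; apply: sub_gen_smallest => /=; rewrite mem_nth.
case: (ex_minnP ex) => n /asboolP[b bU] nmin; exists n, b; split=> //.
move=> u v /eqP; rewrite -subr_eq0 -linearB /= => /eqP uv0.
apply/eqP; rewrite -subr_eq0; apply/negPn/negP => uv.
have /existsP[j cj] : [exists j, (u - v) 0 j != 0].
  apply: contraR uv; rewrite negb_exists => /forallP uv; apply/eqP/rowP => j.
  by have := uv j; rewrite negbK [RHS]mxE => /eqP.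
set c := u - v in uv uv0 cj.
case: n b bU nmin u v c uv uv0 j cj => [|n] b bU nmin u v c uv uv0 j cj.
  by case: j cj.
have /nmin : spans n; last by rewrite ltnn.
apply/asboolP; exists (fun i => b (lift j i)) => x; rewrite bU.
have combE w : lin_comb b w =
  w 0 j *: b j + lin_comb (fun i => b (lift j i)) (\row_i w 0 (lift j i)).
  rewrite /lin_comb (bigD1_ord j) //=; congr (_ + _).
  by apply: eq_bigr => i _; rewrite mxE.
have bj : b j = lin_comb (fun i => b (lift j i)) (- (c 0 j)^-1 *: \row_i c 0 (lift j i)).
  apply: (scalerI cj); rewrite linearZ /= scalerA mulrN mulfV // scaleN1r.
  by apply/eqP; rewrite -subr_eq0 opprK -combE uv0.
split=> [[w ->]|[w ->]].
  by rewrite combE bj -linearZ -linearD; eexists.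
exists (\row_i if unlift j i is Some k then w 0 k else 0); rewrite combE !mxE unlift_none.
rewrite scale0r add0r; congr lin_comb; apply/rowP => i.
by rewrite !mxE liftK.
Qed.

End Subspaces.

(** * Operators on a finite-dimensional subspace, in coordinates *)

Section Frames.
Variables (C : numClosedFieldType) (g : lieAlgType C).
Implicit Types (U W : set g) (x y : g) (f h : g -> g).

(* The empty frame when [U] is not finite-dimensional. *)
Definition frame U : {n : nat & 'I_n -> g} :=
  if pselect (exists nb : {n : nat & 'I_n -> g}, is_basis U (projT2 nb)) is left ex
  then projT1 (cid ex) else existT _ 0%N (fun=> 0).

Definition fdim U := projT1 (frame U).
Definition fbasis U : 'I_(fdim U) -> g := projT2 (frame U).
Arguments fbasis : clear implicits.

Lemma fbasisP U : finite_dimensional U -> is_basis U (fbasis U).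
Proof.
move=> /finite_dimensional_basis[n [b bU]]; rewrite /fbasis /fdim /frame.
case: pselect => [ex|[]]; last by exists (existT _ n b).
exact: projT2 (cid ex).
Qed.

Definition coord U x : 'rV[C]_(fdim U) := xget 0 [set v | x = lin_comb (fbasis U) v].

Lemma coordK U x : finite_dimensional U -> U x -> lin_comb (fbasis U) (coord U x) = x.
Proof.
move=> /fbasisP[bU _] /bU ex; rewrite /coord.
by case: xgetP => [v _ ->//|/(_ _)]; case: ex => v xE /(_ v).
Qed.

Lemma lin_combK U v : finite_dimensional U -> coord U (lin_comb (fbasis U) v) = v.
Proof.
move=> fU; have [bU inj] := fbasisP fU; apply: inj; apply: coordK => //.
by apply/bU; exists v.
Qed.

Lemma lin_combU U v : finite_dimensional U -> U (lin_comb (fbasis U) v).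
Proof. by move=> /fbasisP[bU _]; apply/bU; exists v. Qed.

Lemma fbasisU U i : finite_dimensional U -> U (fbasis U i).
Proof. by move=> fU; rewrite -lin_comb_delta; apply: lin_combU. Qed.

Lemma finite_dimensional_subspace U : finite_dimensional U -> subspace U.
Proof. by move=> [F _ ->]; apply: subspace_smallest. Qed.

Lemma coord_inj U x y : finite_dimensional U -> U x -> U y ->
  coord U x = coord U y -> x = y.
Proof. by move=> fU Ux Uy xy; rewrite -(coordK fU Ux) xy coordK. Qed.

Lemma coordP U a x y : finite_dimensional U -> U x -> U y ->
  coord U (a *: x + y) = a *: coord U x + coord U y.
Proof.
move=> fU Ux Uy; rewrite -{1}(coordK fU Ux) -{1}(coordK fU Uy).
by rewrite -linearP lin_combK.
Qed.

Lemma coord0 U : finite_dimensional U -> coord U 0 = 0.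
Proof. by move=> fU; rewrite -(linear0 (lin_comb (fbasis U))) lin_combK. Qed.

Lemma coord_lin_comb U n (b : 'I_n -> g) v : finite_dimensional U ->
  (forall i, U (b i)) -> coord U (lin_comb b v) = \sum_i v 0 i *: coord U (b i).
Proof.
move=> fU Ub; have sU := finite_dimensional_subspace fU.
suff: U (lin_comb b v) /\ coord U (lin_comb b v) = \sum_i v 0 i *: coord U (b i) by case.
rewrite /lin_comb; elim/big_rec2: _ => [|i y x _ [Ux xE]].
  by split; [apply: subspace0|apply: coord0].
by split; [case: sU => _; apply|rewrite coordP // xE].
Qed.

Definition operator U f :=
  (forall x, U x -> U (f x)) /\
  (forall a x y, U x -> U y -> f (a *: x + y) = a *: f x + f y).

Definition mxof U f : 'M[C]_(fdim U) := \matrix_i coord U (f (fbasis U i)).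

Definition mxact U (M : 'M_(fdim U)) x := lin_comb (fbasis U) (coord U x *m M).

Definition trace U f := \tr (mxof U f).

Section Fixed.
Variable U : set g.
Hypothesis fU : finite_dimensional U.
Let sU := finite_dimensional_subspace fU.

Lemma operator0 f : operator U f -> f 0 = 0.
Proof.
move=> [_ /(_ (-1) 0 0 (subspace0 sU) (subspace0 sU))].
by rewrite scaler0 addr0 scaleN1r addNr.
Qed.

Lemma operatorZ f a x : operator U f -> U x -> f (a *: x) = a *: f x.
Proof.
move=> fO Ux; have [_ /(_ a x 0 Ux (subspace0 sU))] := fO.
by rewrite (operator0 fO) !addr0.
Qed.

Lemma operatorD f x y : operator U f -> U x -> U y -> f (x + y) = f x + f y.
Proof. by move=> [_ fP] Ux Uy; have := fP 1 _ _ Ux Uy; rewrite !scale1r. Qed.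

Lemma operatorB f x y : operator U f -> U x -> U y -> f (x - y) = f x - f y.
Proof.
by move=> [_ fP] Ux Uy; have := fP (-1) _ _ Uy Ux; rewrite !scaleN1r ![- _ + _]addrC.
Qed.

Lemma operator_sum f (I : Type) (r : seq I) (F : I -> g) : operator U f ->
  (forall i, U (F i)) -> f (\sum_(i <- r) F i) = \sum_(i <- r) f (F i).
Proof.
move=> fO UF; elim: r => [|i r IHr]; first by rewrite !big_nil operator0.
by rewrite !big_cons operatorD // ?IHr //; apply: subspace_sum.
Qed.

Lemma coord_operator f x : operator U f -> U x ->
  coord U (f x) = coord U x *m mxof U f.
Proof.
move=> fO Ux; have [fU' fP] := fO.
rewrite -{1}(coordK fU Ux) /lin_comb (operator_sum _ fO) => [|i]; last first.
  by apply: subspaceZ => //; apply: fbasisU.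
under eq_bigr => i _ do rewrite (operatorZ _ fO (fbasisU _ fU)).
have := coord_lin_comb (b := fun i => f (fbasis U i)) (coord U x) fU.
rewrite /lin_comb => ->; last by move=> i; apply: fU'; apply: fbasisU.
by rewrite mulmx_sum_row; apply: eq_bigr => i _; rewrite rowK.
Qed.

Lemma operator_mxact M : operator U (mxact (U := U) M).
Proof.
split=> [x _|a x y Ux Uy]; first exact: lin_combU.
by rewrite /mxact coordP // mulmxDl -scalemxAl linearP.
Qed.

Lemma mxof_mxact M : mxof U (mxact M) = M.
Proof.
apply/row_matrixP => i; rewrite rowK /mxact lin_combK //.
by rewrite -[fbasis U i]lin_comb_delta lin_combK // -rowE.
Qed.

Lemma coord_mxact M x : coord U (mxact M x) = coord U x *m M.
Proof. by rewrite /mxact lin_combK. Qed.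

Lemma mxof_ext f h : (forall x, U x -> f x = h x) -> mxof U f = mxof U h.
Proof. by move=> fh; apply/row_matrixP => i; rewrite !rowK fh //; apply: fbasisU. Qed.

Lemma mxof_comp f h : operator U f -> operator U h ->
  mxof U (f \o h) = mxof U h *m mxof U f.
Proof.
move=> fO hO; apply/row_matrixP => i; rewrite rowK /= coord_operator //; last first.
  by have [hU _] := hO; apply: hU; apply: fbasisU.
by rewrite row_mul rowK.
Qed.

Lemma operator_comp f h : operator U f -> operator U h -> operator U (f \o h).
Proof.
move=> [fU' fP] [hU hP]; split=> [x Ux|a x y Ux Uy] /=; first exact/fU'/hU.
by rewrite hP // fP //; apply: hU.
Qed.

Lemma operator_lin f h a : operator U f -> operator U h ->
  operator U (fun x => a *: f x + h x).
Proof.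
move=> [fU' fP] [hU hP]; split=> [x Ux|b x y Ux Uy].
  by apply: subspaceD => //; [apply: subspaceZ; auto|auto].
by rewrite fP // hP // !scalerDr !scalerA addrACA mulrC.
Qed.

Lemma operator_id : operator U id. Proof. by []. Qed.

Lemma operatorBf f h : operator U f -> operator U h -> operator U (fun x => f x - h x).
Proof.
move=> fO hO; have [p1 p2] := operator_lin (-1) hO fO; split=> [x /p1|a x y Ux Uy].
  by rewrite scaleN1r addrC.
by have := p2 a x y Ux Uy; rewrite !scaleN1r ![- _ + _]addrC.
Qed.

Lemma operatorBc f a : operator U f -> operator U (fun x => f x - a *: x).
Proof.
move=> fO; have [p1 p2] := operator_lin (- a) operator_id fO; split=> [x /p1|b x y Ux Uy].
  by rewrite scaleNr addrC.
by have := p2 b x y Ux Uy; rewrite /= !scaleNr ![- _ + _]addrC.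
Qed.

Lemma mxof_lin f h a : operator U f -> operator U h ->
  mxof U (fun x => a *: f x + h x) = a *: mxof U f + mxof U h.
Proof.
move=> [fU' _] [hU _]; apply/row_matrixP => i.
rewrite rowK coordP //; [|by apply: fU'; apply: fbasisU|by apply: hU; apply: fbasisU].
by rewrite linearP /= !rowK.
Qed.

Lemma trace_ext f h : (forall x, U x -> f x = h x) -> trace U f = trace U h.
Proof. by move=> fh; rewrite /trace (mxof_ext fh). Qed.

Lemma traceC f h : operator U f -> operator U h -> trace U (f \o h) = trace U (h \o f).
Proof. by move=> fO hO; rewrite /trace (mxof_comp fO hO) (mxof_comp hO fO) mxtrace_mulC. Qed.

Lemma trace_lin f h a : operator U f -> operator U h ->
  trace U (fun x => a *: f x + h x) = a * trace U f + trace U h.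
Proof. by move=> fO hO; rewrite /trace mxof_lin // linearP. Qed.

Lemma traceB f h : operator U f -> operator U h ->
  trace U (fun x => f x - h x) = trace U f - trace U h.
Proof.
move=> fO hO; rewrite addrC -mulN1r -trace_lin //; apply: trace_ext => x _.
by rewrite scaleN1r addrC.
Qed.

Lemma iterU f k x : operator U f -> U x -> U (iter k f x).
Proof. by move=> [fU' _] Ux; elim: k => //= k; apply: fU'. Qed.

Lemma eigenvalue_mxof f a : operator U f ->
  eigenvalue (mxof U f) a <-> exists x, [/\ U x, x <> 0 & f x = a *: x].
Proof.
move=> fO; split=> [/eigenvalueP[v vf v0]|[x [Ux x0 fx]]].
  have Uv : U (lin_comb (fbasis U) v) by apply: lin_combU.
  exists (lin_comb (fbasis U) v); split=> // [v0'|].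
    by case/eqP: v0; rewrite -(lin_combK v fU) v0' coord0.
  have [fU' _] := fO; apply: (coord_inj fU); auto.
    exact: subspaceZ.
  by rewrite coord_operator // lin_combK // vf -linearZ lin_combK.
apply/eigenvalueP; exists (coord U x).
  by rewrite -coord_operator // fx -[_ *: x]addr0 coordP // ?coord0 ?addr0 //; apply: subspace0.
apply/eqP => x0'; apply: x0; apply: (coord_inj fU) => //; first exact: subspace0.
by rewrite x0' coord0.
Qed.

(** A matrix of largest rank with row space inside [W] works: the coordinates of a further vector of
    [W] would raise the rank. *)
Lemma subspace_mx W : subspace W -> W `<=` U ->
  exists M : 'M[C]_(fdim U), forall x, U x -> W x <-> (coord U x <= M)%MS.
Proof.
move=> sW WU.
pose inW (M : 'M[C]_(fdim U)) :=
  forall v, (v <= M)%MS -> W (lin_comb (fbasis U) v).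
pose P r := `[< exists2 M, inW M & \rank M = r >].
have exP : exists r, P r.
  exists 0%N; apply/asboolP; exists 0; last by rewrite mxrank0.
  by move=> v; rewrite submx0 => /eqP ->; rewrite linear0; apply: subspace0.
have ubP r : P r -> (r <= fdim U)%N.
  by move=> /asboolP[M _ <-]; apply: rank_leq_row.
case: (ex_maxnP exP ubP) => r /asboolP[M WM rM] rmax; exists M => x Ux.
split=> [Wx|/WM]; last by rewrite coordK.
have : inW (M + <<coord U x>>)%MS.
  move=> v /sub_addsmxP[[u w] /= ->]; rewrite linearD /=; apply: subspaceD => //.
    by apply: WM; apply: submxMl.
  have : (w *m <<coord U x>> <= coord U x)%MS.
    by rewrite (submx_trans (submxMl _ _)) // genmxE.
  case/sub_rVP=> a ->; rewrite linearZ /= coordK //; exact: subspaceZ.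
move=> WMx; have /rmax : P (\rank (M + <<coord U x>>)%MS).
  by apply/asboolP; exists (M + <<coord U x>>)%MS.
rewrite -rM => le_r.
have /eqmxP eqM : (M == M + <<coord U x>>)%MS by rewrite -mxrank_leqif_eq ?addsmxSl // eqn_leq le_r mxrankS // addsmxSl.
by rewrite eqM (submx_trans _ (addsmxSr _ _)) // genmxE.
Qed.

Definition subdim W : nat :=
  \rank (xget 0 [set M : 'M[C]_(fdim U) | forall x, U x -> W x <-> (coord U x <= M)%MS]).

Lemma subdim_bound W : (subdim W <= fdim U)%N. Proof. exact: rank_leq_row. Qed.

Lemma subdim_lt W1 W2 : subspace W1 -> subspace W2 -> W1 `<=` W2 -> W2 `<=` U ->
  (subdim W2 <= subdim W1)%N -> W1 = W2.
Proof.
move=> sW1 sW2 W12 W2U; rewrite /subdim.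
have W1U : W1 `<=` U by apply: subset_trans W12 W2U.
move: (xgetPex 0 (subspace_mx sW1 W1U)); set M1 := xget _ _ => M1P.
move: (xgetPex 0 (subspace_mx sW2 W2U)); set M2 := xget _ _ => M2P.
move=> le21.
have M12 : (M1 <= M2)%MS.
  apply/rV_subP => v vM1; rewrite -[v](lin_combK v fU); apply/M2P; first exact: lin_combU.
  by apply/W12/M1P; [exact: lin_combU|rewrite lin_combK].
have /eqmxP eqM : (M1 == M2)%MS.
  by rewrite -mxrank_leqif_eq // eqn_leq le21 mxrankS.
apply/seteqP; split=> // x W2x; apply/M1P; first exact: W2U.
by rewrite eqM; apply/M2P => //; apply: W2U.
Qed.

(** Together with [min_subspace], this takes the place of inductions on dimension below. *)
Lemma max_subspace (P : set (set g)) : P !=set0 ->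
  (forall W, P W -> subspace W /\ W `<=` U) ->
  exists2 W, P W & forall W', P W' -> W `<=` W' -> W' = W.
Proof.
move=> [W0 PW0] PU.
have ex : exists d, `[< exists2 W, P W & subdim W = d >].
  by exists (subdim W0); apply/asboolP; exists W0.
have ub d : `[< exists2 W, P W & subdim W = d >] -> (d <= fdim U)%N.
  by move=> /asboolP[W _ <-]; apply: subdim_bound.
case: (ex_maxnP ex ub) => d /asboolP[W PW dW] dmax; exists W => // W' PW' WW'.
have [sW _] := PU _ PW; have [sW' W'U] := PU _ PW'.
apply/esym/subdim_lt => //; rewrite dW; apply: dmax; apply/asboolP.
by exists W'.
Qed.

Lemma min_subspace (P : set (set g)) : P !=set0 ->
  (forall W, P W -> subspace W /\ W `<=` U) ->
  exists2 W, P W & forall W', P W' -> W' `<=` W -> W' = W.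
Proof.
move=> [W0 PW0] PU.
have ex : exists d, `[< exists2 W, P W & subdim W = d >].
  by exists (subdim W0); apply/asboolP; exists W0.
case: (ex_minnP ex) => d /asboolP[W PW dW] dmin; exists W => // W' PW' W'W.
have [sW WU] := PU _ PW; have [sW' _] := PU _ PW'.
apply/subdim_lt => //; rewrite dW; apply: dmin; apply/asboolP.
by exists W'.
Qed.

End Fixed.
End Frames.
Arguments fbasis {C g} U _.

(** * Jordan decomposition and traces of operators *)

Section OperatorJordan.
Variables (C : numClosedFieldType) (g : lieAlgType C) (U : set g).
Hypothesis fU : finite_dimensional U.
Let sU := finite_dimensional_subspace fU.
Implicit Types (W : set g) (x y : g) (f h : g -> g).

Definition shift f (a : C) (x : g) := f x - a *: x.

Lemma coord_iter_shift f a k x : operator U f -> U x ->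
  coord U (iter k (shift f a) x) = iter k (mulmxr (mxof U f - a%:M)) (coord U x).
Proof.
move=> fO Ux; elim: k => //= k <-; rewrite /shift mulmxBr.
have Uk : U (iter k (fun y => f y - a *: y) x) by apply: iterU => //; apply: operatorBc.
have [fU' _] := fO.
rewrite [f _ - _]addrC -scaleNr coordP //; last exact: fU'.
by rewrite (coord_operator fU fO) // mul_mx_scalar scaleNr addrC.
Qed.

Lemma iter_shift0 f k x : iter k (shift f 0) x = iter k f x.
Proof. by elim: k => //= k ->; rewrite /shift scale0r subr0. Qed.

Lemma iter_op0 f k : operator U f -> iter k f 0 = 0.
Proof. by move=> fO; elim: k => //= k ->; apply: (operator0 fU). Qed.

Definition nil_on f := forall x, U x -> exists k, iter k f x = 0.

Lemma subspace_nil f : operator U f ->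
  subspace [set x | U x /\ exists k, iter k f x = 0].
Proof.
move=> fO; split=> [|a x y [Ux [k kx]] [Uy [l ly]]].
  by split; [apply: subspace0|exists 0%N].
have [Ux' _] := sU; split; first by case: sU => _; apply.
exists (k + l)%N.
have iterP n u v : U u -> U v -> iter n f (a *: u + v) = a *: iter n f u + iter n f v.
  move=> Uu Uv; elim: n => //= n ->; have [_ ->] := fO => //; exact: iterU.
rewrite iterP // [X in _ + X]iterD ly addnC iterD kx.
by rewrite !iter_op0 // scaler0 addr0.
Qed.

(** Here [s] is the semisimple part of [f], and [t] acts by the conjugate eigenvalues. The clause
    ending in [U <= W] expresses that [U] is the sum of the generalized eigenspaces, as an induction
    principle instead of a direct sum. *)
Lemma operator_jordan f : operator U f -> exists s t : g -> g,
  [/\ operator U s, operator U t,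
      forall h, operator U h -> (forall x, U x -> f (h x) = h (f x)) ->
        forall x, U x -> s (h x) = h (s x) /\ t (h x) = h (t x),
      forall W, subspace W -> W `<=` U -> (forall x, W x -> W (f x)) ->
        forall x, W x -> W (s x) /\ W (t x) &
      [/\ forall a k x, U x -> iter k (shift f a) x = 0 ->
            s x = a *: x /\ t x = a^* *: x,
          trace U (t \o f) = 0 -> nil_on f,
          forall W, subspace W ->
            (forall a k x, U x -> iter k (shift f a) x = 0 -> W x) -> U `<=` W &
          nil_on (fun x => f x - s x)]].
Proof.
move=> fO; have [S [T [STc STs STg trT dec]]] := jordan_chevalley_mx (mxof U f).
have sO := operator_mxact fU S; have tO := operator_mxact fU T.
have genP a k x : U x -> iter k (shift f a) x = 0 ->
    mxact S x = a *: x /\ mxact T x = a^* *: x.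
  move=> Ux kx; have : gen_eigen (mxof U f) a (coord U x).
    by exists k; rewrite -coord_iter_shift // kx coord0.
  by move=> /STg[xS xT]; rewrite /mxact xS xT !linearZ /= coordK.
have decP W : subspace W ->
    (forall a k x, U x -> iter k (shift f a) x = 0 -> W x) -> U `<=` W.
  move=> sW WP x Ux; have [r rE rgen] := dec (coord U x).
  rewrite -(coordK fU Ux) rE linear_sum; apply: subspace_sum_seq => // v /rgen[a [k vk]].
  apply: (WP a k); first exact: lin_combU.
  apply: (coord_inj fU); [|exact: subspace0|].
    by apply: iterU; [apply: operatorBc|apply: lin_combU].
  by rewrite coord_iter_shift ?lin_combK ?vk ?coord0 //; apply: lin_combU.
exists (mxact S), (mxact T); split=> // [h hO fh x Ux|W sW WU Wf x Wx|].
- have [hU _] := hO.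
  have AB : comm_mx (mxof U f) (mxof U h).
    by rewrite /comm_mx -(mxof_comp fU fO hO) -(mxof_comp fU hO fO); apply: mxof_ext => // y Uy /=; rewrite fh.
  have [SB TB] := STc _ AB.
  have comm M : comm_mx M (mxof U h) -> mxact M (h x) = h (mxact M x).
    move=> MB; apply: (coord_inj fU).
    - exact: lin_combU.
    - by apply: hU; apply: lin_combU.
    rewrite coord_mxact // !(coord_operator fU hO) //; last exact: lin_combU.
    by rewrite coord_mxact // -!mulmxA MB.
  by split; apply: comm.
- have [M MP] := subspace_mx fU sW WU; have Ux := WU _ Wx.
  have stM : stablemx M (mxof U f).
    apply/rV_subP => v /submxP[w ->]; rewrite mulmxA.
    have /submxP[w' ->] : (w *m M *m mxof U f <= M)%MS; last by rewrite submxMl.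
    have Uw : U (lin_comb (fbasis U) (w *m M)) by apply: lin_combU.
    have Ww : W (lin_comb (fbasis U) (w *m M)) by apply/MP => //; rewrite lin_combK // submxMl.
    have := Wf _ Ww; have [fU' _] := fO.
    by move/(MP _ (fU' _ Uw)).1; rewrite (coord_operator fU fO) // lin_combK.
  have [stS stT] := STs _ _ stM.
  have act N : stablemx M N -> W (mxact N x).
    move=> MN; apply/MP; first exact: lin_combU.
    rewrite coord_mxact //; have /submxP[w ->] := (MP _ Ux).1 Wx.
    by rewrite -mulmxA (submx_trans _ MN) // submxMl.
  by split; apply: act.
split=> // [tr0|].
  have ev0 a : eigenvalue (mxof U f) a -> a = 0.
    by apply: trT; rewrite -[X in mxtrace (X *m _)](mxof_mxact fU) -(mxof_comp fU fO tO) -/(trace U _) traceC.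
  move=> x Ux; suff [//] : [set x | U x /\ exists k, iter k f x = 0] x.
  apply: (decP _ (subspace_nil fO)) => // a k {x Ux}x Ux kx.
  have [a0|a0] := eqVneq a 0.
    by split=> //; exists k; rewrite -iter_shift0 -a0.
  split=> //; exists 0%N => /=.
  elim: k x Ux kx => [//|k IHk] x Ux; rewrite iterSr => kx.
  have := IHk _ _ kx; have := operatorBc fU a fO => -[/(_ _ Ux) Ux' _] /(_ Ux') fx.
  apply/eqP; apply/negPn/negP => /eqP x0; case/eqP: a0; apply: ev0.
  apply/eigenvalue_mxof => //; exists x; split=> //.
  by apply/eqP; rewrite -subr_eq0; apply/eqP.
have dO := operatorBf fU fO sO.
move=> x Ux; suff [//] : [set x | U x /\ exists k, iter k (fun x => f x - mxact S x) x = 0] x.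
apply: (decP _ (subspace_nil dO)) => // a k {x Ux}x Ux kx; split=> //; exists k.
have fO' := operatorBc fU a fO.
suff -> : iter k (fun x => f x - mxact S x) x = iter k (shift f a) x by [].
have iterE j : (j <= k)%N -> iter j (fun x => f x - mxact S x) x = iter j (shift f a) x.
  elim: j => //= j IHj jk; rewrite IHj ?(ltnW jk) // {2}/shift.
  have Uj : U (iter j (shift f a) x) by apply: iterU.
  have [|-> //] := genP a (k - j)%N _ Uj.
  by rewrite -iterD subnK ?kx // ltnW.
exact: iterE.
Qed.

Lemma trace_nil f : operator U f -> nil_on f -> trace U f = 0.
Proof.
move=> fO fnil; rewrite /trace; move: (fun a => eigenvalue_mxof fU a fO); case: (fdim U) (mxof U f) => [|n] A ev.
  by rewrite flatmx0 mxtrace0.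
have [d [dev dtr]] := mxtrace_horner A.
have := dtr 'X; rewrite horner_mx_X => ->; rewrite big1 // => i _; rewrite hornerX.
have /ev[x [Ux x0 fx]] : eigenvalue A (d i) by apply/dev; exists i.
have [k kx] := fnil x Ux; apply/eqP; apply/negPn/negP => di0; apply: x0.
suff iterE j : iter j f x = d i ^+ j *: x.
  by move: kx; rewrite iterE => /eqP; rewrite scaler_eq0 expf_eq0 (negbTE di0) andbF => /eqP.
elim: j => [|j IHj]; first by rewrite scale1r.
by rewrite iterS IHj (operatorZ fU) // fx scalerA -exprSr.
Qed.

(** The trace is a sum of squares of real eigenvalues. This is the source of the positivity of the
    Killing form on [real_cartan]. *)
Lemma trace_sqr_real f : operator U f ->
  (forall a x, U x -> x <> 0 -> f x = a *: x -> a \is Num.real) ->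
  0 <= trace U (f \o f) /\
  (trace U (f \o f) = 0 -> forall a x, U x -> x <> 0 -> f x = a *: x -> a = 0).
Proof.
move=> fO freal; rewrite /trace (mxof_comp fU fO fO).
move: (fun a => eigenvalue_mxof fU a fO); case: (fdim U) (mxof U f) => [|n] A ev.
  split=> [|_ a x Ux x0 fx]; first by rewrite flatmx0 mxtrace0.
  have /eigenvalueP[v _] : eigenvalue A a by apply/ev; exists x.
  by rewrite thinmx0 eqxx.
have [d [dev dtr]] := mxtrace_horner A.
have := dtr ('X ^+ 2); rewrite rmorphXn /= horner_mx_X expr2 -mulmxE => ->.
have ge0 i : 0 <= ('X ^+ 2).[d i].
  have /ev[x [Ux x0 fx]] : eigenvalue A (d i) by apply/dev; exists i.
  by rewrite hornerXn -realEsqr (freal _ _ Ux x0 fx).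
split=> [|/eqP]; first exact: sumr_ge0.
rewrite psumr_eq0 // => /allP d0 a x Ux x0 fx.
have /dev[i ->] : eigenvalue A a by apply/ev; exists x.
by have := d0 i (mem_index_enum i); rewrite hornerXn sqrf_eq0 => /eqP.
Qed.

End OperatorJordan.

(** * Engel's theorem *)

Section LieBasics.
Variables (K : fieldType) (g : lieAlgType K).
Implicit Types (A B N P Q U W : set g) (x y z : g).

Lemma lieDl x y z : [lie x + y, z] = [lie x, z] + [lie y, z].
Proof. by have := lie_linearl 1 x y z; rewrite !scale1r. Qed.
Lemma lieDr x y z : [lie x, y + z] = [lie x, y] + [lie x, z].
Proof. by have := lie_linearr 1 x y z; rewrite !scale1r. Qed.
Lemma lie0l x : [lie 0, x] = 0.
Proof. by apply: (addIr [lie 0, x]); rewrite -lieDl !add0r. Qed.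
Lemma lie0r x : [lie x, 0] = 0.
Proof. by apply: (addIr [lie x, 0]); rewrite -lieDr !add0r. Qed.
Lemma lieZl a x y : [lie a *: x, y] = a *: [lie x, y].
Proof. by have := lie_linearl a x 0 y; rewrite lie0l !addr0. Qed.
Lemma lieZr a x y : [lie x, a *: y] = a *: [lie x, y].
Proof. by have := lie_linearr a x y 0; rewrite lie0r !addr0. Qed.
Lemma lieNl x y : [lie - x, y] = - [lie x, y].
Proof. by rewrite -scaleN1r lieZl scaleN1r. Qed.
Lemma lieNr x y : [lie x, - y] = - [lie x, y].
Proof. by rewrite -scaleN1r lieZr scaleN1r. Qed.
Lemma lieBl x y z : [lie x - y, z] = [lie x, z] - [lie y, z].
Proof. by rewrite lieDl lieNl. Qed.
Lemma lieBr x y z : [lie x, y - z] = [lie x, y] - [lie x, z].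
Proof. by rewrite lieDr lieNr. Qed.
Lemma lieC x y : [lie x, y] = - [lie y, x].
Proof.
apply/eqP; rewrite -subr_eq0 opprK; apply/eqP.
by have := liexx (x + y); rewrite lieDl !lieDr !liexx addr0 add0r.
Qed.

Lemma lie_derivation x y z :
  [lie x, [lie y, z]] = [lie [lie x, y], z] + [lie y, [lie x, z]].
Proof.
have := lie_jacobi x y z; rewrite (lieC z [lie x, y]) (lieC z x) lieNr => /eqP.
by rewrite subr_eq0 subr_eq => /eqP.
Qed.

Lemma lie_bracketE x y z : [lie [lie x, y], z] = [lie x, [lie y, z]] - [lie y, [lie x, z]].
Proof. by rewrite lie_derivation addrK. Qed.

Lemma lie_commute x y z : [lie x, y] = 0 ->
  [lie x, [lie y, z]] = [lie y, [lie x, z]].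
Proof. by move=> xy; rewrite lie_derivation xy lie0l add0r. Qed.

Lemma lie_product_lie A B x y : A x -> B y -> lie_product A B [lie x, y].
Proof. by move=> Ax By; apply: sub_gen_smallest; exists x => //; exists y. Qed.

Lemma lie_product_sub A B U : subspace U ->
  (forall x y, A x -> B y -> U [lie x, y]) -> lie_product A B `<=` U.
Proof.
by move=> sU ABU; apply: smallest_sub => // _ [x Ax [y By <-]]; apply: ABU.
Qed.

Lemma subspace_lie_product A B : subspace (lie_product A B).
Proof. exact: subspace_smallest. Qed.

(** The ascending annihilator series of the [N]-module [Q]. *)
Fixpoint nil_filtration N Q i : set g :=
  if i is i'.+1 then [set v | Q v /\ forall x, N x -> nil_filtration N Q i' [lie x, v]]
  else [set 0].

Lemma subspace_nil_filtration N Q i : subspace Q -> subspace (nil_filtration N Q i).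
Proof.
move=> sQ; elim: i => [|i IHi] /=; first exact: subspace_set0.
split=> [|a u v [Qu uP] [Qv vP]].
  by split=> [|x Nx]; [apply: subspace0|rewrite lie0r; apply: subspace0].
split=> [|x Nx]; first by case: sQ => _; apply.
by rewrite lie_linearr; case: IHi => _; apply; [apply: uP|apply: vP].
Qed.

Lemma nil_filtration_sub N Q i : subspace Q -> nil_filtration N Q i `<=` Q.
Proof. by move=> sQ; case: i => [|i] v => [->|[]//]; apply: subspace0. Qed.

Lemma nil_filtrationS N Q i : subspace Q ->
  nil_filtration N Q i `<=` nil_filtration N Q i.+1.
Proof.
move=> sQ; elim: i => [|i IHi] v => [->|[Qv vP]].
  by split=> [|x _]; [apply: subspace0|rewrite lie0r].
by split=> // x Nx; apply/IHi/vP.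
Qed.

End LieBasics.

Section Engel.
Variables (C : numClosedFieldType) (g : lieAlgType C).
Implicit Types (A B N P Q U W : set g) (x y z : g).

Lemma subalgebra0 : subalgebra [set (0 : g)].
Proof. by split; [exact: subspace_set0|move=> x y -> _; rewrite lie0l]. Qed.

(** Engel's theorem for the module [Q / P], without quotients. In a minimal bad subalgebra [N0] take
    a maximal proper subalgebra [K]. The theorem for [K] acting on [N0 / K] yields [y] outside [K]
    normalizing [K], so [N0] is [K] plus the line of [y]. The invariants of [K] in [Q / P] are
    stable under [y], and the last nonzero iterate of [y] on one of them is the vector sought. *)
Theorem engel U N P Q : finite_dimensional U ->
  subalgebra N -> N `<=` U -> subspace P -> subspace Q -> P `<=` Q -> ~ Q `<=` P ->
  (forall x v, N x -> P v -> P [lie x, v]) ->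
  (forall x v, N x -> Q v -> Q [lie x, v]) ->
  (forall x y, N x -> N y -> exists k, iter k (lie x) y = 0) ->
  (forall x v, N x -> Q v -> exists k, P (iter k (lie x) v)) ->
  exists v, [/\ Q v, ~ P v & forall x, N x -> P [lie x, v]].
Proof.
move=> fU.
pose concl N := forall P Q, subspace P -> subspace Q -> P `<=` Q -> ~ Q `<=` P ->
  (forall x v, N x -> P v -> P [lie x, v]) ->
  (forall x v, N x -> Q v -> Q [lie x, v]) ->
  (forall x y, N x -> N y -> exists k, iter k (lie x) y = 0) ->
  (forall x v, N x -> Q v -> exists k, P (iter k (lie x) v)) ->
  exists v, [/\ Q v, ~ P v & forall x, N x -> P [lie x, v]].
suff main : forall N, subalgebra N -> N `<=` U -> concl N.
  by move=> algN NU; apply: main.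
move=> {}N algN NU; apply: contrapT => badN.
pose bad := [set N' : set g | [/\ subalgebra N', N' `<=` N & ~ concl N']].
have [||N0 [algN0 N0N badN0] N0min] := min_subspace fU (P := bad).
- by exists N; split.
- by move=> W [[sW _] WN _]; split=> //; apply: subset_trans NU.
apply: badN0; have sN0 : subspace N0 by case: algN0.
have {}N0min K : subalgebra K -> K `<=` N0 -> K <> N0 -> concl K.
  move=> algK KN0 KneN0; apply: contrapT => badK; apply: KneN0; apply: N0min => //.
  by split=> //; apply: subset_trans N0N.
move=> {}P {}Q sP sQ PQ QP NP NQ nilN nilQ.
have [N00|N0ne] := pselect (N0 = [set 0]).
  have /existsNP[v /not_implyP[Qv nPv]] := QP; exists v; split=> // x.
  by rewrite N00 => ->; rewrite lie0l; apply: subspace0.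
pose proper := [set K : set g | [/\ subalgebra K, K `<=` N0 & K <> N0]].
have [||K [algK KN0 KneN0] Kmax] := max_subspace fU (P := proper).
- exists [set 0]; split; [exact: subalgebra0|move=> _ ->; exact: subspace0|].
  exact/nesym.
- by move=> W [[sW _] WN _]; split=> //; apply: subset_trans (subset_trans N0N NU).
have sK : subspace K by case: algK.
have concK := N0min K algK KN0 KneN0.
have [|||||y [N0y nKy Ky]] := concK K N0 sK sN0 KN0.
- by move=> N0K; apply: KneN0; apply/seteqP.
- by case: algK.
- by move=> x v /KN0 N0x N0v; case: algN0 => _; apply.
- by move=> x z /KN0 N0x /KN0 N0z; apply: nilN.
- move=> x v /KN0 N0x N0v; have [k kv] := nilN x v N0x N0v.
  by exists k; rewrite kv; apply: subspace0.
pose K' := [set x : g | exists2 k, K k & exists a, x = k + a *: y].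
have sK' : subspace K'.
  split=> [|a _ _ [k1 Kk1 [a1 ->]] [k2 Kk2 [a2 ->]]].
    by exists 0; [apply: subspace0|exists 0; rewrite scale0r addr0].
  exists (a *: k1 + k2); first by case: sK => _; apply.
  by exists (a * a1 + a2); rewrite scalerDr scalerDl scalerA addrACA.
have KK' : K `<=` K' by move=> k Kk; exists k => //; exists 0; rewrite scale0r addr0.
have K'N0 : K' `<=` N0.
  by move=> _ [k /KN0 N0k [a ->]]; apply: subspaceD => //; apply: subspaceZ.
have algK' : subalgebra K'.
  split=> // _ _ [k1 Kk1 [a1 ->]] [k2 Kk2 [a2 ->]]; apply: KK'.
  rewrite lieDl !lieDr !(lieZl, lieZr) liexx !scaler0 addr0.
  have [_ Klie] := algK.
  apply: subspaceD => //; last by apply: subspaceZ => //; rewrite lieC; apply: subspaceN => //; apply: Ky.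
  by apply: subspaceD => //; [apply: Klie|apply: subspaceZ => //; apply: Ky].
have K'E : K' = N0.
  apply: contrapT => K'ne; have K'K := Kmax K' _ KK'.
  apply: nKy; rewrite -K'K //; exists 0; first exact: subspace0.
  by exists 1; rewrite scale1r add0r.
have [||||v0 [Qv0 nPv0 Kv0]] := concK P Q sP sQ PQ QP.
- by move=> x v /KN0; apply: NP.
- by move=> x v /KN0; apply: NQ.
- by move=> x z /KN0 N0x /KN0 N0z; apply: nilN.
- by move=> x v /KN0; apply: nilQ.
have itQ m : Q (iter m (lie y) v0) by elim: m => //= m; apply: NQ.
have itK m x : K x -> P [lie x, iter m (lie y) v0].
  elim: m x => [|m IHm] x Kx /=; first exact: Kv0.
  rewrite lie_derivation; apply: subspaceD => //; first exact/IHm/Ky.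
  by apply: NP => //; apply: IHm.
have [m [nPm Pm]] : exists m, ~ P (iter m (lie y) v0) /\ P (iter m.+1 (lie y) v0).
  have [k] := nilQ y v0 N0y Qv0; elim: k => [//|k IHk] Pk.
  by have [/IHk//|nPk] := pselect (P (iter k (lie y) v0)); exists k.
exists (iter m (lie y) v0); split=> // x; rewrite -K'E => -[k Kk [a ->]].
rewrite lieDl lieZl; apply: subspaceD => //; first exact: itK.
exact: subspaceZ.
Qed.

Lemma engel_filtration U N Q : finite_dimensional U ->
  subalgebra N -> N `<=` U -> subspace Q -> Q `<=` U ->
  (forall x v, N x -> Q v -> Q [lie x, v]) ->
  (forall x y, N x -> N y -> exists k, iter k (lie x) y = 0) ->
  (forall x v, N x -> Q v -> exists k, iter k (lie x) v = 0) ->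
  exists n, Q `<=` nil_filtration N Q n.
Proof.
move=> fU algN NU sQ QU NQ nilN nilQ.
have [||W [n _ <-] nmax] := max_subspace fU (P := range (nil_filtration N Q)).
- by exists [set 0], 0%N.
- move=> _ [i _ <-]; split; first exact: subspace_nil_filtration.
  exact: subset_trans (nil_filtration_sub (i := i) sQ) QU.
have sn : subspace (nil_filtration N Q n) := subspace_nil_filtration N n sQ.
exists n; apply: contrapT => Qn.
have [||x v Nx Qv|v [Qv nv vn]] := engel fU algN NU sn sQ _ Qn _ NQ nilN.
- exact: nil_filtration_sub.
- elim: (n) => [|i IHi] x v Nx /= => [->|[Qv vP]]; first by rewrite lie0r.
  by split=> [|y Ny]; [apply: NQ|apply: IHi => //; apply: vP].
- have [k kv] := nilQ x v Nx Qv; exists k; rewrite kv; exact: subspace0.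
apply: nv; rewrite -(nmax (nil_filtration N Q n.+1)); last exact: nil_filtrationS.
  by split.
by exists n.+1.
Qed.

End Engel.

Section FiniteSpan.
Variables (C : numClosedFieldType) (g : lieAlgType C).
Implicit Types (T U W : set g).

Lemma finite_spanning_subset U T : finite_dimensional U -> T `<=` U ->
  exists s : seq g, (forall x, x \in s -> T x) /\
    T `<=` smallest (@subspace C g) [set` s].
Proof.
move=> fU TU; have sU := finite_dimensional_subspace fU.
pose P := [set W : set g | exists s : seq g, (forall x, x \in s -> T x) /\
  W = smallest (@subspace C g) [set` s]].
have [||W [s [sT WE]] Wmax] := max_subspace fU (P := P).
- by exists (smallest (@subspace C g) [set` [::]]), [::].
- move=> _ [s [sT ->]]; split; first exact: subspace_smallest.
  by apply: smallest_sub => // x /sT /TU.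
exists s; split=> // x Tx; rewrite -WE.
rewrite -(Wmax (smallest (@subspace C g) [set` x :: s])).
- by apply: sub_gen_smallest; rewrite /= mem_head.
- exists (x :: s); split=> // y; rewrite inE => /orP[/eqP->//|]; exact: sT.
- rewrite WE; apply: smallest_sub; first exact: subspace_smallest.
  by move=> y /= ys; apply: sub_gen_smallest; rewrite /= inE ys orbT.
Qed.

Lemma finite_dimensional_sub U W : finite_dimensional U -> subspace W ->
  W `<=` U -> finite_dimensional W.
Proof.
move=> fU sW WU; have [s [sW' Ws]] := finite_spanning_subset fU WU.
exists [set` s]; first exact: finite_seq.
by apply/seteqP; split=> //; apply: smallest_sub => // x /sW'.
Qed.

End FiniteSpan.

(** * The Killing form of a reductive algebra *)

Section Diagonalizable.
Variables (C : numClosedFieldType) (g : lieAlgType C).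
Implicit Types (G U W : set g) (x y z v : g) (f h : g -> g).

(* [G] is spanned by eigenvectors of [f]. *)
Definition diag_on G f := forall W, subspace W ->
  (forall a v, G v -> f v = a *: v -> W v) -> G `<=` W.

(** An operator spanned by eigenvectors coincides with its semisimple part, which is scalar on
    generalized eigenspaces. *)
Lemma diag_on_gen G f a k v : finite_dimensional G -> operator G f ->
  diag_on G f -> G v -> iter k (shift f a) v = 0 -> f v = a *: v.
Proof.
move=> fG fO fd Gv kv; have sG := finite_dimensional_subspace fG.
have [s [t [sO _ _ _ [gen _ _ _]]]] := operator_jordan fG fO.
have [<- _] := gen a k v Gv kv.
suff [//] : [set u | G u /\ f u = s u] v.
apply: fd Gv => [|b u Gu fu].
  split=> [|b u w [Gu fu] [Gw fw]] /=.
    by rewrite (operator0 fG fO) (operator0 fG sO); split=> //; apply: subspace0.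
  split; first by case: sG => _; apply.
  by have [_ ->] := fO => //; have [_ ->] := sO => //; rewrite fu fw.
split=> //; have [|-> //] := gen b 1%N u Gu.
by rewrite /= /shift fu subrr.
Qed.

Lemma diag_onP G f : finite_dimensional G -> operator G f ->
  (forall a v, G v -> shift f a (shift f a v) = 0 -> f v = a *: v) -> diag_on G f.
Proof.
move=> fG fO ss W sW fW; have sG := finite_dimensional_subspace fG.
have [s [t [_ _ _ _ [_ _ dec _]]]] := operator_jordan fG fO.
apply: dec => // a k v Gv kv; apply: (fW a) => //.
elim: k v Gv kv => [v _ /= ->|k IHk v Gv]; first by rewrite (operator0 fG fO) scaler0.
rewrite iterSr => kv; apply: ss => //; have [shG _] := operatorBc fG a fO.
by rewrite {1}/shift (IHk _ _ kv) ?subrr //; apply: shG.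
Qed.

Lemma operator_sub G U f : operator G f -> U `<=` G -> (forall x, U x -> U (f x)) ->
  operator U f.
Proof. by move=> [_ fP] UG fU; split=> // a x y /UG Gx /UG; apply: fP. Qed.

Lemma diag_on_sub G U f : finite_dimensional G -> operator G f -> diag_on G f ->
  subspace U -> U `<=` G -> (forall x, U x -> U (f x)) -> diag_on U f.
Proof.
move=> fG fO fd sU UG fU; have fdU := finite_dimensional_sub fG sU UG.
have fUO := operator_sub fO UG fU.
apply: diag_onP => // a v Uv v2; apply: (@diag_on_gen G f a 2) => //.
exact: UG.
Qed.

(** A stable complement of an eigenspace excludes Jordan blocks. Conversely, a maximal stable [W]
    meeting [U] trivially is a complement, since any eigenvector outside [U + W] could be added to
    [W]. *)
Lemma semisimple_inP G x : finite_dimensional G -> operator G (lie x) -> G x ->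
  semisimple_in G x <-> diag_on G (lie x).
Proof.
move=> fG xO Gx; have sG := finite_dimensional_subspace fG.
have [xG _] := xO; split=> [[_ ss]|xd].
  apply: diag_onP => // a v Gv v2.
  pose U := [set u | G u /\ [lie x, u] = a *: u].
  have sU : subspace U.
    split=> [|b u w [Gu xu] [Gw xw]]; first by split; [apply: subspace0|rewrite lie0r scaler0].
    split; first by case: sG => _; apply.
    by rewrite lie_linearr xu xw scalerDr !scalerA mulrC.
  have [|W [sW WG xW] [UW0 GUW]] := ss U.
    split=> //; first by move=> u [].
    by move=> u [Gu xu]; rewrite xu; apply: subspaceZ.
  have [u [Gu xu] [w Ww vE]] : [set u + w | u in U & w in W] v by rewrite -GUW.
  have Ww' : W (shift (lie x) a v).
    rewrite -vE /shift lieDr xu scalerDr opprD addrACA subrr add0r.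
    by apply: subspaceB => //; [apply: xW|apply: subspaceZ].
  have : (U `&` W) (shift (lie x) a v).
    split=> //; split; first exact: WG.
    by apply/eqP; rewrite -subr_eq0; apply/eqP.
  by rewrite UW0 => /eqP; rewrite subr_eq0 => /eqP.
split=> // U [sU UG xU].
pose P := [set W : set g | ad_stable_subspace G x W /\ U `&` W = [set 0]].
have [||W [[sW WG xW] UW0] Wmax] := max_subspace fG (P := P).
- exists [set 0]; split; first split.
  + exact: subspace_set0.
  + by move=> _ ->; apply: subspace0.
  + by move=> _ ->; rewrite /= lie0r.
  + apply/seteqP; split=> [y [_ ->]//|_ ->]; split=> //; exact: subspace0.
- by move=> W [[sW WG _] _].
exists W; split=> //.
have sUW : subspace [set u + w | u in U & w in W].
  split=> [|a _ _ [u1 Uu1 [w1 Ww1 <-]] [u2 Uu2 [w2 Ww2 <-]]].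
    by exists 0; [apply: subspace0|exists 0; [apply: subspace0|rewrite addr0]].
  exists (a *: u1 + u2); first by case: sU => _; apply.
  exists (a *: w1 + w2); first by case: sW => _; apply.
  by rewrite scalerDr addrACA.
apply/seteqP; split; last first.
  by move=> _ [u /UG Gu [w /WG Gw <-]]; apply: subspaceD.
apply: xd => // a v Gv xv; apply: contrapT => nv.
have Wv : ~ W v by move=> Wv; apply: nv; exists 0; [apply: subspace0|exists v => //; rewrite add0r].
pose W' := [set w' : g | exists2 w, W w & exists b, w' = w + b *: v].
have WW' : W `<=` W' by move=> w Ww; exists w => //; exists 0; rewrite scale0r addr0.
apply: Wv; rewrite -(Wmax W') //; first by exists 0; [apply: subspace0|exists 1; rewrite scale1r add0r].
split; first split.
- split=> [|b _ _ [w1 Ww1 [b1 ->]] [w2 Ww2 [b2 ->]]].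
    by exists 0; [apply: subspace0|exists 0; rewrite scale0r addr0].
  exists (b *: w1 + w2); first by case: sW => _; apply.
  by exists (b * b1 + b2); rewrite scalerDr scalerDl scalerA addrACA.
- by move=> _ [w /WG Gw [b ->]]; apply: subspaceD => //; apply: subspaceZ.
- move=> _ [w Ww [b ->]]; exists [lie x, w]; first exact: xW.
  by exists (b * a); rewrite lieDr lieZr xv scalerA.
apply/seteqP; split=> [y [Uy [w Ww [b yE]]]|_ ->]; last first.
  by split; [apply: subspace0|exists 0; [apply: subspace0|exists 0; rewrite scale0r addr0]].
have [b0|b0] := eqVneq b 0.
  have : (U `&` W) y by split=> //; rewrite yE b0 scale0r addr0.
  by rewrite UW0.
case: nv; exists (b^-1 *: y); first exact: subspaceZ.
exists (- b^-1 *: w); first exact: subspaceZ.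
by rewrite yE scalerDr scalerA mulVf // scale1r scaleNr addrAC subrr add0r.
Qed.

End Diagonalizable.

(** * The Killing form and the Jordan parts of a derivation *)

Section Killing.
Variables (C : numClosedFieldType) (g : lieAlgType C) (G : set g).
Hypothesis (fG : finite_dimensional G) (aG : subalgebra G).
Let sG := finite_dimensional_subspace fG.
Implicit Types (U W N : set g) (x y z v : g) (f h D : g -> g).

Lemma operator_lie x : G x -> operator G (lie x).
Proof.
by move=> Gx; split=> [y Gy|a y z _ _]; [case: aG => _; apply|apply: lie_linearr].
Qed.

Definition derivation D := forall x y, G x -> G y ->
  D [lie x, y] = [lie D x, y] + [lie x, D y].

Lemma derivation_lie x : derivation (lie x).
Proof. by move=> y z _ _; apply: lie_derivation. Qed.

Definition killing x y := trace G (lie x \o lie y).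

Lemma killingC x y : G x -> G y -> killing x y = killing y x.
Proof. by move=> Gx Gy; apply: traceC => //; apply: operator_lie. Qed.

Lemma killingPl a x y z : G x -> G y -> G z ->
  killing (a *: x + y) z = a * killing x z + killing y z.
Proof.
move=> Gx Gy Gz; rewrite /killing -(trace_lin fG).
- by apply: (trace_ext fG) => v _; rewrite /= lie_linearl.
- by apply: operator_comp; apply: operator_lie.
- by apply: operator_comp; apply: operator_lie.
Qed.

Lemma killing0l z : G z -> killing 0 z = 0.
Proof.
move=> Gz; have G0 := subspace0 sG.
by have := killingPl (-1) G0 G0 Gz; rewrite scaler0 addr0 mulN1r addNr.
Qed.

Lemma killingZl a x z : G x -> G z -> killing (a *: x) z = a * killing x z.
Proof.
move=> Gx Gz; have := killingPl a Gx (subspace0 sG) Gz.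
by rewrite addr0 killing0l // addr0.
Qed.

Lemma killingDl x y z : G x -> G y -> G z ->
  killing (x + y) z = killing x z + killing y z.
Proof. by move=> Gx Gy Gz; have := killingPl 1 Gx Gy Gz; rewrite scale1r mul1r. Qed.

Lemma killingNl x z : G x -> G z -> killing (- x) z = - killing x z.
Proof. by move=> Gx Gz; rewrite -scaleN1r killingZl // mulN1r. Qed.

Lemma killingBl x y z : G x -> G y -> G z ->
  killing (x - y) z = killing x z - killing y z.
Proof. by move=> Gx Gy Gz; rewrite killingDl ?killingNl //; apply: subspaceN. Qed.

Lemma subspace_killing_orthogonal z : G z -> subspace [set x | G x /\ killing x z = 0].
Proof.
move=> Gz; split=> [|a x y [Gx xz] [Gy yz]].
  by split; [apply: subspace0|apply: killing0l].
split; first by case: sG => _; apply.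
by rewrite killingPl // xz yz mulr0 addr0.
Qed.

(** Applied to the conjugate part [t] of a derivation, which is again a derivation, this turns the
    trace of [t w], for [w] a sum of brackets, into values of the Killing form. All nilpotency
    proofs below use it in this way. *)
Lemma trace_derivation D x y : operator G D -> derivation D -> G x -> G y ->
  trace G (D \o lie [lie x, y]) = trace G (lie (D x) \o lie y).
Proof.
move=> DO Dder Gx Gy; have xO := operator_lie Gx; have yO := operator_lie Gy.
have DxyO := operator_comp DO (operator_comp xO yO).
have DyxO := operator_comp DO (operator_comp yO xO).
have xDyO := operator_comp xO (operator_comp DO yO).
have -> : trace G (D \o lie [lie x, y]) =
          trace G (D \o (lie x \o lie y)) - trace G (D \o (lie y \o lie x)).
  rewrite -(traceB fG DxyO DyxO); apply: (trace_ext fG) => v Gv /=.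
  rewrite -(operatorB DO); first by rewrite lie_derivation addrK.
    by have [xG _] := xO; have [yG _] := yO; apply/xG/yG.
  by have [xG _] := xO; have [yG _] := yO; apply/yG/xG.
have -> : trace G (D \o (lie y \o lie x)) = trace G (lie x \o (D \o lie y)).
  exact: (traceC fG (operator_comp DO yO) xO).
rewrite -(traceB fG DxyO xDyO); apply: (trace_ext fG) => v Gv /=.
by rewrite Dder // ?addrK //; have [yG _] := yO; apply: yG.
Qed.

Lemma killing_lie x y z : G x -> G y -> G z ->
  killing [lie x, y] z = killing x [lie y, z].
Proof.
move=> Gx Gy Gz; rewrite /killing -trace_derivation //; first exact: operator_lie.
exact: derivation_lie.
Qed.

Lemma iter_shift_lie D a b k l x y : operator G D -> derivation D -> G x -> G y ->
  iter k (shift D a) x = 0 -> iter l (shift D b) y = 0 ->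
  iter (k + l) (shift D (a + b)) [lie x, y] = 0.
Proof.
move=> DO Dder; have [n] := ubnP (k + l).
have sO c : operator G (shift D c) := operatorBc fG c DO.
elim: n => // n IHn in k l x y * => kln Gx Gy.
have it0 m c : iter m (shift D c) 0 = 0 := iter_op0 fG m (sO c).
case: k kln => [_ /= -> _|k kln]; first by rewrite lie0l it0.
case: l kln => [_ _ ly|l kln kx ly]; first by rewrite (ly : y = 0) lie0r it0.
have Gk : G (shift D a x) by have [sD _] := sO a; apply: sD.
have Gl : G (shift D b y) by have [sD _] := sO b; apply: sD.
have Glie u v : G u -> G v -> G [lie u, v] by case: aG => _; apply.
have -> : iter (k.+1 + l.+1) (shift D (a + b)) [lie x, y] =
  iter (k + l.+1) (shift D (a + b)) [lie shift D a x, y] +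
  iter (k.+1 + l) (shift D (a + b)) [lie x, shift D b y].
  have addS u v m : G u -> G v -> iter m (shift D (a + b)) (u + v) =
      iter m (shift D (a + b)) u + iter m (shift D (a + b)) v.
    move=> Gu Gv; elim: m => // m IHm.
    by rewrite !iterS IHm (operatorD (sO (a + b))) //; apply: iterU.
  rewrite addSn iterSr addnS -addnS addSn -addnS -addS; try exact: Glie.
  congr (iter _ _ _); rewrite /shift Dder // lieBl lieBr lieZl lieZr scalerDl.
  by rewrite addrACA opprD.
rewrite (IHn k l.+1) ?(IHn k.+1 l) ?addr0 //.
- by move: kln; rewrite addnS.
- by move: ly; rewrite iterSr.
- by move: kx; rewrite iterSr.
Qed.

(** Brackets add generalized eigenvalues by [iter_shift_lie], so any additive function [c] of the
    eigenvalue gives a derivation. It is used for the identity and for complex conjugation. *)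
Lemma gen_eigen_derivation D s c : operator G D -> operator G s -> derivation D ->
  (forall W, subspace W ->
     (forall a k x, G x -> iter k (shift D a) x = 0 -> W x) -> G `<=` W) ->
  {morph c : a b / a + b} ->
  (forall a k x, G x -> iter k (shift D a) x = 0 -> s x = c a *: x) ->
  derivation s.
Proof.
move=> DO sO Dder dec cD sP x y Gx Gy.
have Glie u v : G u -> G v -> G [lie u, v] by case: aG => _; apply.
have [sG' sl] := sO.
suff [_ /(_ _ Gx)//] : [set y | G y /\
    forall x, G x -> s [lie x, y] = [lie s x, y] + [lie x, s y]] y.
apply: (dec) Gy => [|b l {x Gx}{}y Gy ly].
  split=> [|a u v [Gu uP] [Gv vP]]; split.
  - exact: subspace0.
  - by move=> z Gz; rewrite (operator0 fG sO) !lie0r (operator0 fG sO) addr0.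
  - by case: sG => _; apply.
  - move=> z Gz; rewrite sl // !lie_linearr sl; try exact: Glie.
    by rewrite uP // vP // scalerDr addrACA.
split=> // x Gx.
suff [//] : [set x | G x /\ s [lie x, y] = [lie s x, y] + [lie x, s y]] x.
apply: (dec) Gx => [|a k {}x Gx kx].
  split=> [|a u v [Gu uP] [Gv vP]]; split.
  - exact: subspace0.
  - by rewrite (operator0 fG sO) !lie0l (operator0 fG sO) addr0.
  - by case: sG => _; apply.
  - rewrite sl // !lie_linearl sl; try exact: Glie.
    by rewrite uP vP scalerDr addrACA.
split=> //; rewrite (sP _ _ _ Gx kx) (sP _ _ _ Gy ly).
rewrite (sP (a + b) (k + l)%N); first by rewrite lieZl lieZr -scalerDl cD.
  exact: Glie.
exact: iter_shift_lie.
Qed.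

Lemma derivation_jordan D : operator G D -> derivation D -> exists s t : g -> g,
  [/\ operator G s, operator G t, derivation s, derivation t &
   [/\
      forall h, operator G h -> (forall x, G x -> D (h x) = h (D x)) ->
        forall x, G x -> s (h x) = h (s x) /\ t (h x) = h (t x),
      forall W, subspace W -> W `<=` G -> (forall x, W x -> W (D x)) ->
        forall x, W x -> W (s x) /\ W (t x) &
      [/\ forall a k x, G x -> iter k (shift D a) x = 0 ->
            s x = a *: x /\ t x = a^* *: x,
          trace G (t \o D) = 0 -> nil_on G D,
          forall W, subspace W ->
            (forall a k x, G x -> iter k (shift D a) x = 0 -> W x) -> G `<=` W &
          nil_on G (fun x => D x - s x)]]].
Proof.
move=> DO Dder; have [s [t [sO tO comm stab [gen nilD dec nilDs]]]] := operator_jordan fG DO.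
exists s, t; split=> //.
  apply: (gen_eigen_derivation (D := D) (c := id)) => // a k x Gx kx.
  by have [] := gen a k x Gx kx.
apply: (gen_eigen_derivation (D := D) (c := Num.conj)) => // [|a k x Gx kx].
  exact: rmorphD.
by have [] := gen a k x Gx kx.
Qed.

Lemma trace_nil_comm f h : operator G f -> operator G h ->
  (forall x, G x -> f (h x) = h (f x)) -> nil_on G h -> trace G (f \o h) = 0.
Proof.
move=> fO hO fh hnil; apply: (trace_nil fG); first exact: operator_comp.
move=> x Gx; have [k kx] := hnil x Gx; exists k.
suff -> : iter k (f \o h) x = iter k f (iter k h x) by rewrite kx (iter_op0 fG).
elim: k {kx} => //= k ->; congr (f _).
have Gk : G (iter k h x) by apply: iterU.
elim: k (iter k h x) Gk => //= k IHk y Gy.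
by rewrite -fh ?IHk //; apply: iterU.
Qed.

End Killing.

(** * Cartan's criterion, inner derivations, and Jordan decomposition in a reductive algebra *)

Section Reductive.
Variables (C : numClosedFieldType) (g : lieAlgType C) (G : set g).
Hypothesis (fG : finite_dimensional G) (aG : subalgebra G) (rG : reductive G).
Let sG : subspace G := finite_dimensional_subspace fG.
Let Glie : forall x y, G x -> G y -> G [lie x, y] := aG.2.
Let adO := operator_lie aG.
Implicit Types (U W N : set g) (x y z v : g) (f h D : g -> g).
Local Notation kappa := (killing G).
Local Notation S := (lie_product G G).

Definition lie_center (A : set g) := [set x | A x /\ forall y, A y -> [lie x, y] = 0].

Lemma trace_compP t a x y : operator G t -> G x -> G y ->
  trace G (t \o lie (a *: x + y)) = a * trace G (t \o lie x) + trace G (t \o lie y).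
Proof.
move=> tO Gx Gy; have xO := adO Gx; have yO := adO Gy.
rewrite -(trace_lin fG _ (operator_comp tO xO) (operator_comp tO yO)).
apply: (trace_ext fG) => v Gv /=; have [_ tl] := tO.
by rewrite lie_linearl tl //; apply: Glie.
Qed.

Lemma subspace_trace_comp t : operator G t ->
  subspace [set x | G x /\ trace G (t \o lie x) = 0].
Proof.
move=> tO; have G0 := subspace0 sG; split=> [|a x y [Gx tx] [Gy ty]].
  split=> //; have := trace_compP (-1) tO G0 G0.
  by rewrite scaler0 addr0 mulN1r addNr.
split; first by case: sG => _; apply.
by rewrite trace_compP // tx ty mulr0 addr0.
Qed.

Lemma derived_sub : S `<=` G. Proof. exact: lie_product_sub. Qed.

Lemma ideal_complement U : ideal G U -> exists W,
  [/\ ideal G W, forall u w, U u -> W w -> [lie u, w] = 0,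
      forall x, G x -> exists u w, [/\ U u, W w & x = u + w] &
      forall x, U x -> W x -> x = 0].
Proof.
move=> iU; have [W iW [UW0 GE]] := rG iU; exists W.
have [sU UG GU] := iU; have [sW WG GW] := iW.
have disj x : U x -> W x -> x = 0 by move=> Ux Wx; have : (U `&` W) x by []; rewrite UW0.
split=> // [u w Uu Ww|x Gx].
  apply: disj; last exact/GW/Ww/UG.
  by rewrite lieC; apply: subspaceN => //; apply/GU/Uu/WG.
have : [set u + w | u in U & w in W] x by rewrite -GE.
by case=> u Uu [w Ww <-]; exists u, w.
Qed.

Lemma ideal_derived : ideal G S.
Proof.
split; [exact: subspace_lie_product|exact: derived_sub|].
by move=> x y Gx /derived_sub Gy; apply: lie_product_lie.
Qed.

Lemma ideal_center : ideal G (lie_center G).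
Proof.
split=> [||x y Gx [Gy yZ]]; [|by move=> x []|].
  split=> [|a x y [Gx xZ] [Gy yZ]].
    by split=> [|y _]; [apply: subspace0|rewrite lie0l].
  split=> [|z Gz]; first by case: sG => _; apply.
  by rewrite lie_linearl xZ // yZ // scaler0 addr0.
have -> : [lie x, y] = 0 by rewrite lieC yZ // oppr0.
by split=> [|z _]; [apply: subspace0|rewrite lie0l].
Qed.

Lemma center_derived_decomposition x : G x ->
  exists z s, [/\ lie_center G z, S s & x = z + s].
Proof.
have [W [[sW WG GW] SW dec disj]] := ideal_complement ideal_derived.
move=> /dec[s [z [Ss Wz ->]]]; exists z, s; split=> //; last exact: addrC.
split=> [|y Gy]; first exact: WG.
apply: disj; first by apply: lie_product_lie => //; apply: WG.
by rewrite lieC; apply: subspaceN => //; apply: GW.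
Qed.

Lemma center_derived_trivial x : lie_center G x -> S x -> x = 0.
Proof.
have [W [[sW WG GW] ZW dec disj]] := ideal_complement ideal_center.
move=> Zx Sx; apply: disj => //; move: x {Zx} Sx.
apply: lie_product_sub => // x y Gx Gy.
have [z [w [[Gz zZ] Ww ->]]] := dec x Gx.
by rewrite lieDl zZ // add0r lieC; apply: subspaceN => //; apply: GW.
Qed.

(** The derived algebra [D] of the radical [R] consists of ad-nilpotent elements, since the trace of
    [t w] reduces to Killing products with elements of [R]. A complementary ideal of [D] makes [D]
    perfect, and by Engel's theorem a perfect algebra of this kind is zero. So [R] is abelian; it
    also commutes with its own complementary ideal. *)
Lemma killing_radical_central x : G x -> (forall y, G y -> kappa x y = 0) ->
  lie_center G x.
Proof.
pose R := [set x | G x /\ forall y, G y -> kappa x y = 0].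
have iR : ideal G R.
  split=> [||y z Gy [Gz zR]]; [|by move=> ? []|].
    split=> [|a u v [Gu uR] [Gv vR]].
      by split=> [|y Gy]; [apply: subspace0|apply: killing0l].
    split=> [|y Gy]; first by case: sG => _; apply.
    by rewrite killingPl // uR // vR // mulr0 addr0.
  split=> [|w Gw]; first exact: Glie.
  rewrite lieC killingNl //; last exact: Glie.
  by rewrite killing_lie // zR ?oppr0 //; apply: Glie.
have [sR RG GR] := iR.
pose D := lie_product R R.
have DR : D `<=` R by apply: lie_product_sub => // u v /RG Gu Rv; apply: GR.
have sD : subspace D := subspace_lie_product _ _.
have nilD w : D w -> nil_on G (lie w).
  move=> Dw; have Gw : G w := RG _ (DR _ Dw).
  have [s [t [sO tO _ tder [_ _ [_ nilw _ _]]]]] :=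
    derivation_jordan fG aG (adO Gw) (@derivation_lie _ _ _ w).
  apply: nilw; suff [] : [set x | G x /\ trace G (t \o lie x) = 0] w by [].
  move: w Dw {Gw}; apply: lie_product_sub; first exact: subspace_trace_comp.
  move=> u v Ru Rv; have [Gu _] := Ru; have [Gv vR] := Rv; split; first exact: Glie.
  have [tG _] := tO; rewrite trace_derivation // -/(killing G _ _) killingC //; auto.
have GD y w : G y -> D w -> D [lie y, w].
  move=> Gy; move: w; apply: lie_product_sub => [|u v Ru Rv].
    split=> [|a u v yu yv]; first by rewrite lie0r; apply: subspace0.
    by rewrite lie_linearr; case: sD => _; apply.
  by rewrite lie_derivation; apply: (subspaceD sD); apply: lie_product_lie => //; apply: GR.
have DG : D `<=` G by apply: subset_trans DR RG.
have [W [[sW WG GW] DW dec disj]] : exists W,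
    [/\ ideal G W, forall u w, D u -> W w -> [lie u, w] = 0,
        forall x, G x -> exists u w, [/\ D u, W w & x = u + w] &
        forall x, D x -> W x -> x = 0].
  by apply: ideal_complement.
have Dperf : D `<=` lie_product D D.
  apply: lie_product_sub => [|u v Ru Rv]; first exact: subspace_lie_product.
  have [d [w [Dd Ww uE]]] := dec u (RG _ Ru); have [d' [w' [Dd' Ww' vE]]] := dec v (RG _ Rv).
  have Rw : R w by rewrite -[w](addKr d) -uE addrC; apply: subspaceB => //; apply: DR.
  have Rw' : R w' by rewrite -[w'](addKr d') -vE addrC; apply: subspaceB => //; apply: DR.
  have ww' : [lie w, w'] = 0.
    by apply: disj; [apply: lie_product_lie|apply: GW => //; apply: WG].
  rewrite uE vE lieDl !lieDr (DW d w') // ww' (lieC w d') (DW d' w) // oppr0 !addr0.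
  exact: lie_product_lie.
have D0 w : D w -> w = 0.
  have aD : subalgebra D by split=> // u v Du Dv; apply: GD => //; apply: DG.
  have [|||n Dn] := engel_filtration fG aD DG sD DG.
  - by move=> u v Du Dv; apply: GD => //; apply: DG.
  - by move=> u v Du Dv; apply: nilD => //; apply: DG.
  - by move=> u v Du Dv; apply: nilD => //; apply: DG.
  elim: n Dn => [D0 /D0 //|n IHn DSn]; apply: IHn => v /Dperf; move: v.
  apply: lie_product_sub; first exact: subspace_nil_filtration.
  by move=> u v Du /DSn[_]; apply.
move=> Gx xR; split=> // y Gy.
have [W' [_ RW' dec' _]] := ideal_complement iR.
have [r [w [Rr Ww ->]]] := dec' y Gy.
by rewrite lieDr (RW' x w) // addr0; apply: D0; apply: lie_product_lie.
Qed.

Lemma killing_center_l z x : lie_center G z -> G x -> kappa z x = 0.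
Proof.
move=> [Gz zZ] Gx; apply: (trace_nil fG).
  by apply: operator_comp; apply: adO.
by move=> v Gv; exists 1%N => /=; rewrite zZ //; apply: Glie.
Qed.

Lemma killing_nondegenerate x : S x -> (forall y, G y -> kappa x y = 0) -> x = 0.
Proof.
move=> Sx xG; apply: center_derived_trivial => //.
by apply: killing_radical_central => //; apply: derived_sub.
Qed.

Lemma killing_riesz (phi : g -> C) :
  (forall a x y, G x -> G y -> phi (a *: x + y) = a * phi x + phi y) ->
  (forall z, lie_center G z -> phi z = 0) ->
  exists2 y, S y & forall x, G x -> kappa y x = phi x.
Proof.
move=> phiP phiZ.
have phi0 : phi 0 = 0.
  by have := phiP (-1) 0 0 (subspace0 sG) (subspace0 sG); rewrite scaler0 addr0 mulN1r addNr.
pose b := fbasis G; have Gb i : G (b i) by apply: fbasisU.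
pose K := \matrix_(i, j) kappa (b i) (b j).
pose p := \row_j phi (b j).
have Gl (v : 'rV_(fdim G)) : G (lin_comb b v) := lin_combU v fG.
have phiE (v : 'rV_(fdim G)) : phi (lin_comb b v) = (p *m v^T) 0 0.
  suff [] : G (lin_comb b v) /\ phi (lin_comb b v) = \sum_i p 0 i * v 0 i.
    by rewrite mxE => _ ->; apply: eq_bigr => i _; rewrite [_^T _ _]mxE.
  rewrite /lin_comb; elim/big_rec2: _ => [|i c x _ [Gx xE]].
    by split=> //; apply: subspace0.
  by split; [case: sG => _; apply|rewrite phiP // xE mxE mulrC].
have kappaE (v : 'rV_(fdim G)) x : G x -> kappa (lin_comb b v) x = \sum_i v 0 i * kappa (b i) x.
  move=> Gx; suff [] : G (lin_comb b v) /\
      kappa (lin_comb b v) x = \sum_i v 0 i * kappa (b i) x by [].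
  rewrite /lin_comb; elim/big_rec2: _ => [|i c y _ [Gy yE]].
    by split; [apply: subspace0|apply: killing0l].
  by split; [case: sG => _; apply|rewrite killingPl // yE].
have kappaK (v : 'rV_(fdim G)) j : kappa (lin_comb b v) (b j) = (v *m K) 0 j.
  by rewrite kappaE // mxE; apply: eq_bigr => i _; rewrite mxE.
have Ksym : K^T = K by apply/matrixP => i j; rewrite !mxE killingC.
(* By symmetry of the Gram matrix [K], the columns of its cokernel are coordinates of
   Killing-radical vectors; these are central, so [phi] kills them. *)
have : (p <= K)%MS.
  rewrite submxE; apply/eqP/rowP => j; rewrite [RHS]mxE.
  pose c := (col j (cokermx K))^T.
  have cK : c *m K = 0.
    by rewrite -[c *m K]trmxK trmx_mul Ksym trmxK colE mulmxA mulmx_coker mul0mx trmx0.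
  have -> : (p *m cokermx K) 0 j = phi (lin_comb b c).
    rewrite phiE /c trmxK.
    have -> : p *m col j (cokermx K) = col j (p *m cokermx K) by rewrite !colE mulmxA.
    by rewrite [RHS]mxE.
  apply: phiZ; apply: killing_radical_central; first exact: lin_combU.
  move=> y Gy; rewrite -(coordK fG Gy) -/b killingC // kappaE //.
  by apply: big1 => i _; rewrite killingC // kappaK cK mxE mulr0.
case/submxP => w pE.
have [z [y [Zz Sy wE]]] := center_derived_decomposition (lin_combU w fG).
have Gy := derived_sub Sy; have [Gz _] := Zz.
exists y => // x Gx; rewrite -[kappa y x]add0r -(killing_center_l Zz Gx) -killingDl // -wE.
rewrite -(coordK fG Gx) phiE -/b killingC // kappaE // mxE.
by apply: eq_bigr => i _; rewrite [_^T _ _]mxE pE killingC // kappaK mulrC.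
Qed.

(** Let [y] represent the form sending [x] to the trace of [D] composed with [ad x]. Then
    [d = D - ad y] has values in the Killing radical, hence in the center, so it kills all brackets;
    it kills the center by assumption. *)
Lemma derivation_inner D : operator G D -> derivation G D ->
  (forall z, lie_center G z -> D z = 0) ->
  exists2 y, S y & forall x, G x -> D x = [lie y, x].
Proof.
move=> DO Dder DZ; have [DG Dl] := DO.
have [|z Zz|y Sy yP] := killing_riesz (phi := fun x => trace G (D \o lie x)).
- by move=> a x y; apply: trace_compP.
- apply: (trace_nil fG); first by have [Gz _] := Zz; apply: operator_comp => //; apply: adO.
  by have [Gz zZ] := Zz; move=> v Gv; exists 1%N; rewrite /= zZ // (operator0 fG DO).
have Gy := derived_sub Sy; exists y => // x Gx.
have dO := operatorBf fG DO (adO Gy).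
pose d x := D x - [lie y, x]; rewrite -/(d) in dO.
have dder : derivation G d.
  move=> u v Gu Gv; rewrite /d Dder // lie_derivation opprD addrACA lieBl lieBr //.
have [dG dl] := dO.
have dZ u : G u -> lie_center G (d u).
  move=> Gu; apply: killing_radical_central => [|v Gv]; first exact: dG.
  rewrite /killing -trace_derivation //.
  have -> : trace G (d \o lie [lie u, v]) =
            trace G (D \o lie [lie u, v]) - trace G (lie y \o lie [lie u, v]).
    rewrite -traceB //; first by apply: operator_comp => //; apply/adO/Glie.
    by apply: operator_comp; apply: adO => //; apply: Glie.
  by rewrite -/(killing G _ _) -yP ?subrr //; apply: Glie.
suff dS : S `<=` [set u | G u /\ d u = 0].
  have [z [s [Zz Ss ->]]] := center_derived_decomposition Gx.
  have [Gz zZ] := Zz; have [Gs ds0] := dS _ Ss.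
  apply/eqP; rewrite -subr_eq0 -/(d (z + s)) (operatorD dO) // ds0 addr0.
  by rewrite /d DZ // sub0r lieC opprK zZ.
apply: lie_product_sub => [|u v Gu Gv].
  split=> [|a u v [Gu du] [Gv dv]].
    by split; [apply: subspace0|apply: (operator0 fG dO)].
  by split; [case: sG => _; apply|rewrite dl // du dv scaler0 addr0].
split; first exact: Glie.
have [_ uZ] := dZ u Gu; have [_ vZ] := dZ v Gv.
by rewrite dder // uZ // lieC vZ // oppr0 addr0.
Qed.

Lemma reductive_jordan x : G x -> exists s n : g,
  [/\ G s, S n, x = s + n, [lie s, n] = 0 &
   [/\ nil_on G (lie n), diag_on G (lie s),
       forall k v, G v -> iter k (lie x) v = 0 -> [lie s, v] = 0 &
       forall h, operator G h -> (forall y, G y -> [lie x, h y] = h [lie x, y]) ->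
         forall y, G y -> [lie s, h y] = h [lie s, y]]].
Proof.
move=> Gx.
have [s [t [sO tO sder _ [comm _ [gen _ dec nilDs]]]]] :=
  derivation_jordan fG aG (adO Gx) (@derivation_lie _ _ _ x).
have [sG' _] := sO.
have sZ z : lie_center G z -> s z = 0.
  move=> [Gz zZ]; have [|-> _] := gen 0 1%N z Gz; last by rewrite scale0r.
  by rewrite iter_shift0 /= lieC zZ // oppr0.
have [y Sy sE] := derivation_inner sO sder sZ.
have [z [w [[Gz zZ] Sw xE]]] := center_derived_decomposition Gx.
have Gy := derived_sub Sy; have Gw := derived_sub Sw.
have adn v : G v -> [lie w - y, v] = [lie x, v] - s v.
  by move=> Gv; rewrite lieBl sE // xE lieDl zZ // add0r.
have ads v : G v -> [lie z + y, v] = s v.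
  by move=> Gv; rewrite lieDl zZ // add0r sE.
have sx : s x = 0.
  have [|-> _] := gen 0 1%N x Gx; last by rewrite scale0r.
  by rewrite iter_shift0 /= liexx.
exists (z + y), (w - y); split.
- exact: subspaceD.
- exact: (subspaceB (subspace_lie_product G G)).
- by rewrite addrACA subrr addr0 xE.
- have Gn : G (w - y) by apply: subspaceB.
  rewrite ads // sE // lieBr liexx subr0.
  have := sx; rewrite sE // xE lieDr => <-.
  by rewrite (lieC y z) zZ // oppr0 add0r.
split.
- move=> v Gv; have [k kv] := nilDs v Gv; exists k; rewrite -kv.
  elim: k {kv} => //= k <-; rewrite adn //.
  by apply: iterU => //; apply: adO; apply: subspaceB.
- move=> W sW W_eigen; apply: dec => // a k v Gv kv; apply: (W_eigen a) => //.
  by rewrite ads //; have [] := gen a k v Gv kv.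
- move=> k v Gv kv; rewrite ads //; have [|-> _] := gen 0 k v Gv.
    by rewrite iter_shift0.
  by rewrite scale0r.
- move=> h hO hx v Gv; have [hG _] := hO.
  by rewrite !ads //; [have [] := comm h hO hx v Gv|apply: hG].
Qed.

End Reductive.

(** * Nilpotent elements of a subalgebra whose semisimple parts are central *)

Section NilpotentPart.
Variables (C : numClosedFieldType) (g : lieAlgType C) (G : set g).
Hypothesis (fG : finite_dimensional G) (aG : subalgebra G).
Let sG : subspace G := finite_dimensional_subspace fG.
Let Glie : forall x y, G x -> G y -> G [lie x, y] := aG.2.
Let adO := operator_lie aG.
Implicit Types (U W : set g) (x y z v : g) (f h D : g -> g).
Local Notation kappa := (killing G).

(** Simultaneous diagonalization as an induction principle: an inclusion of subspaces is checked on
    joint eigenvectors. *)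
Lemma joint_eigen_span (L : seq g) U W :
  (forall s, s \in L -> G s /\ diag_on G (lie s)) ->
  (forall s s', s \in L -> s' \in L -> [lie s, s'] = 0) ->
  subspace U -> U `<=` G -> (forall s u, s \in L -> U u -> U [lie s, u]) ->
  subspace W ->
  (forall v, U v -> (forall s, s \in L -> exists a, [lie s, v] = a *: v) -> W v) ->
  U `<=` W.
Proof.
elim: L => [|s L IHL] in U W *; first by move=> _ _ _ _ _ _ WU v Uv; apply: WU.
move=> Ld Lc sU UG LU sW WU.
have [Gs sd] := Ld s (mem_head _ _).
apply: (diag_on_sub fG (adO Gs) sd sU UG) => // [u Uu|a v Uv sv].
  by apply: LU => //; apply: mem_head.
have inL s' : s' \in L -> s' \in s :: L by rewrite inE orbC => ->.
apply: (IHL [set u | U u /\ [lie s, u] = a *: u] W) => //.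
- by move=> s' /inL /Ld.
- by move=> s1 s2 /inL Ls1 /inL Ls2; apply: Lc.
- split=> [|b u w [Uu su] [Uw sw]]; first by split; [apply: subspace0|rewrite lie0r scaler0].
  by split; [case: sU => _; apply|rewrite lie_linearr su sw scalerDr !scalerA mulrC].
- by move=> u [/UG].
- move=> s' u /inL Ls' [Uu su]; split; first exact: LU.
  by rewrite lie_commute ?su ?lieZr //; apply: Lc => //; apply: mem_head.
- move=> u [Uu su] uL; apply: WU => // s'; rewrite inE => /orP[/eqP->|/uL//].
  by exists a.
Qed.

(** The trace of [t] composed with [ad s] is the sum of the squared moduli of the eigenvalues of
    [ad s]. *)
Lemma conj_part s : G s -> diag_on G (lie s) -> exists t,
  [/\ operator G t, derivation G t,
      forall x, G x -> [lie s, x] = 0 -> t x = 0 /\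
         forall v, G v -> t [lie x, v] = [lie x, t v] &
      trace G (t \o lie s) = 0 -> forall v, G v -> [lie s, v] = 0].
Proof.
move=> Gs sd; have [s0 [t [_ tO _ tder [comm _ [gen nils _ _]]]]] :=
  derivation_jordan fG aG (adO Gs) (@derivation_lie _ _ _ s).
exists t; split=> // [x Gx sx|/nils nils' v Gv].
  split; first by have [|_ ->] := gen 0 1%N x Gx; rewrite ?iter_shift0 //= rmorph0 scale0r.
  move=> v Gv; have [|_ ->//] := comm (lie x) (adO Gx) _ v Gv.
  by move=> w _; apply: lie_commute.
have [k kv] := nils' v Gv; rewrite -(scale0r v).
by apply: (diag_on_gen fG (adO Gs) sd (k := k)); rewrite ?iter_shift0.
Qed.

Variables (N M : set g).
Hypothesis aN : subalgebra N.
Hypothesis NM : N `<=` M.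
Hypothesis MG : M `<=` G.
Hypothesis split_N : forall w, N w -> exists s n, [/\ G s, w = s + n,
  forall x, M x -> [lie s, x] = 0, diag_on G (lie s) & nil_on G (lie n)].
Let NG : N `<=` G := subset_trans NM MG.

Definition nil_part := [set x | N x /\ nil_on G (lie x)].

(** The map [t] of [conj_part], taken for the semisimple part [s] of [w], kills [M] because [s]
    centralizes [M]. The nilpotent part contributes nothing to the trace, so the trace condition
    forces [ad s = 0]. As traces are linear, [nil_part] is thereby closed under sums and under
    brackets with normalizing elements of [M]. *)
Lemma nil_of_trace w : N w ->
  (forall t, operator G t -> derivation G t ->
    (forall x, M x -> t x = 0 /\ forall v, G v -> t [lie x, v] = [lie x, t v]) ->
    trace G (t \o lie w) = 0) ->
  nil_on G (lie w).
Proof.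
move=> Nw tr0; have [s [n [Gs wE sM sd nn]]] := split_N Nw.
have [t [tO tder tc tnil]] := conj_part Gs sd.
have nE : n = w - s by rewrite wE addrC addKr.
have Gn : G n by rewrite nE; apply: subspaceB => //; apply: NG.
have sn : [lie s, n] = 0 by rewrite nE lieBr liexx sM ?subr0 //; apply: NM.
have tw : trace G (t \o lie w) = 0 by apply: tr0 => // x Mx; apply: tc; [apply: MG|apply: sM].
have tn : trace G (t \o lie n) = 0.
  by apply: (trace_nil_comm fG) => //; [exact: adO|have [] := tc n Gn sn].
have s0 : forall v, G v -> [lie s, v] = 0.
  apply: tnil; have := trace_compP fG aG 1 tO Gs Gn.
  by rewrite scale1r -wE tw tn mul1r addr0.
move=> v Gv; have [k kv] := nn v Gv; exists k; rewrite -kv.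
elim: k {kv} => //= k <-; rewrite wE lieDl s0 ?add0r //.
by apply: iterU => //; rewrite -wE; apply/adO/NG.
Qed.

Lemma subspace_nil_part : subspace nil_part.
Proof.
have sN : subspace N by case: aN.
split=> [|a x y [Nx xn] [Ny yn]].
  by split; [apply: subspace0|move=> v _; exists 1%N => /=; rewrite lie0l].
have Nw : N (a *: x + y) by case: sN => _; apply.
split=> //; apply: nil_of_trace => // t tO tder tc.
have tr0 z : N z -> nil_on G (lie z) -> trace G (t \o lie z) = 0.
  move=> Nz zn; apply: (trace_nil_comm fG) => //; first exact/adO/NG.
  by have [] := tc z (NM Nz).
by rewrite trace_compP ?tr0 ?mulr0 ?addr0 //; apply: NG.
Qed.

Lemma nil_part_lie r x : M r -> (forall y, N y -> N [lie r, y]) ->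
  nil_part x -> nil_part [lie r, x].
Proof.
move=> Mr rN [Nx xn]; split; first exact: rN.
apply: nil_of_trace => [|t tO tder tc]; first exact: rN.
rewrite trace_derivation //; [|exact: MG|exact: NG].
have [-> _] := tc r Mr; exact/killing0l/NG.
Qed.

(* By Engel's theorem [nil_part] acts nilpotently on a filtration of [G], which
   [r] preserves. *)
Lemma killing_nil_part r b : M r -> (forall y, N y -> N [lie r, y]) ->
  nil_part b -> kappa b r = 0.
Proof.
move=> Mr rN nb; have [Nb bn] := nb; have sn := subspace_nil_part.
have Nlie x y : N x -> N y -> N [lie x, y] by case: aN => _; apply.
have an : subalgebra nil_part.
  by split=> // x y [Nx _] ny; apply: nil_part_lie => // [|z Nz]; [apply: NM|apply: Nlie].
have nG : nil_part `<=` G by move=> x [/NG].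
have [|||m Gm] := engel_filtration fG an nG sG (@subset_refl _ G).
- by move=> x v /nG; apply: Glie.
- by move=> x y [_ xn] /nG Gy; apply: xn.
- by move=> x v [_ xn]; apply: xn.
have rF i v : nil_filtration nil_part G i v -> nil_filtration nil_part G i [lie r, v].
  elim: i v => [v ->|i IHi v [Gv vF]]; first by rewrite lie0r.
  split=> [|x nx]; first by apply: Glie => //; apply: MG.
  rewrite lie_derivation; apply: subspaceD; first exact: subspace_nil_filtration.
    rewrite (lieC x r) lieNl; apply: subspaceN; first exact: subspace_nil_filtration.
    by apply: vF; apply: nil_part_lie.
  by apply: IHi; apply: vF.
apply: (trace_nil fG); first by apply: operator_comp; apply: adO; [apply: NG|apply: MG].
move=> v /Gm Fv; exists m; elim: m v Fv {Gm} => [v //|m IHm v Fv].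
by rewrite iterSr; apply: IHm => /=; have [_] := rF _ _ Fv; apply.
Qed.

End NilpotentPart.

(** * Cartan subalgebras and roots *)

Section NilpotentAlgebras.
Variables (K : fieldType) (g : lieAlgType K).
Implicit Types (A : set g).

Lemma lower_central_iter A k x y : A x -> A y -> lower_central A k (iter k (lie x) y).
Proof.
move=> Ax Ay; elim: k => //= k IHk; rewrite lieC.
apply: (subspaceN (subspace_lie_product _ _)); exact: lie_product_lie.
Qed.

Lemma nilpotent_engel A x y : nilpotent A -> A x -> A y ->
  exists k, iter k (lie x) y = 0.
Proof.
by move=> [k Ak0] Ax Ay; exists k; have := lower_central_iter k Ax Ay; rewrite Ak0.
Qed.

End NilpotentAlgebras.

(** * A Cartan subalgebra of a reductive algebra is abelian and acts diagonally *)

Section Cartan.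
Variables (C : numClosedFieldType) (g : lieAlgType C) (G H : set g).
Hypothesis (fG : finite_dimensional G) (aG : subalgebra G) (rG : reductive G).
Hypothesis cH : findim_cartan G H.
Let sG : subspace G := finite_dimensional_subspace fG.
Let Glie : forall x y, G x -> G y -> G [lie x, y] := aG.2.
Implicit Types (U W N : set g) (x y z v : g) (f h D : g -> g).
Local Notation kappa := (killing G).

Let aH : subalgebra H. Proof. by case: cH. Qed.
Let HG : H `<=` G. Proof. by case: cH. Qed.
Let sH : subspace H. Proof. by case: aH. Qed.
Let Hlie x y : H x -> H y -> H [lie x, y]. Proof. by case: aH => _; apply. Qed.

Let cartan_norm v : G v -> (forall x, H x -> H [lie v, x]) -> H v.
Proof.
by move=> Gv vH; have : normalizer G H v by []; case: cH => _ _ _ ->.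
Qed.

Let split_cartan w : H w -> exists s n, [/\ G s, w = s + n,
  forall x, H x -> [lie s, x] = 0, diag_on G (lie s) & nil_on G (lie n)].
Proof.
move=> Hw; have [s [n [Gs Sn wE sn [nn sd s0 _]]]] := reductive_jordan fG aG rG (HG Hw).
exists s, n; split=> // x Hx; have [_ _ nH _] := cH.
by have [k kx] := nilpotent_engel nH Hw Hx; apply: (s0 k) => //; apply: HG.
Qed.

(** A substitute for the Fitting null component of [H], defined through the semisimple elements that
    centralize [H]. *)
Let fitting_zero := [set v | G v /\ forall s, G s -> diag_on G (lie s) ->
  (forall x, H x -> [lie s, x] = 0) -> [lie s, v] = 0].

(** On [fitting_zero] an element of [H] acts like its nilpotent part. If the inclusion failed,
    Engel's theorem modulo [H] would give a vector outside [H] that normalizes [H]. *)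
Let fitting_zero_sub : fitting_zero `<=` H.
Proof.
apply: contrapT => fzH.
have sfz : subspace fitting_zero.
  split=> [|a u v [Gu uP] [Gv vP]].
    by split=> [|s _ _ _]; [apply: subspace0|rewrite lie0r].
  split=> [|s Gs sd sx]; first by case: sG => _; apply.
  by rewrite lie_linearr uP // vP // scaler0 addr0.
have fzlie x v : H x -> fitting_zero v -> fitting_zero [lie x, v].
  move=> Hx [Gv vP]; split=> [|s Gs sd sH']; first by apply: Glie => //; apply: HG.
  by rewrite lie_commute ?vP ?lie0r // sH'.
have [|||v [[Gv vP] nHv Hv]] := engel fG aH HG sH sfz _ fzH (fun x v Hx => Hlie Hx) fzlie.
- move=> x Hx; split; first exact: HG.
  by move=> s _ _; apply.
- by move=> x y Hx Hy; have [_ _ nH _] := cH; apply: (nilpotent_engel nH).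
- move=> x v Hx fzv; have [s [n [Gs xE sx sd nn]]] := split_cartan Hx.
  have [Gv vP] := fzv; have [k kv] := nn v Gv; exists k.
  suff -> : iter k (lie x) v = 0 by apply: subspace0.
  suff [_ ->//] : fitting_zero (iter k (lie x) v) /\ iter k (lie x) v = iter k (lie n) v.
  elim: k {kv} => //= k [fzk <-]; split; first exact: fzlie.
  by rewrite xE lieDl -xE; have [_ ->] := fzk => //; rewrite add0r.
apply: nHv; apply: cartan_norm => // x Hx.
by rewrite lieC; apply: subspaceN => //; apply: Hv.
Qed.

Lemma cartan_centralizer v : G v -> (forall x, H x -> [lie x, v] = 0) -> H v.
Proof.
move=> Gv vH; apply: cartan_norm => // x Hx.
by rewrite lieC vH // oppr0; apply: subspace0.
Qed.

Let split_central s : G s -> (forall x, H x -> [lie s, x] = 0) -> H s.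
Proof. by move=> Gs sH'; apply: cartan_centralizer => // x Hx; rewrite lieC sH' // oppr0. Qed.

(** The element [n] is Killing-orthogonal to [H] by [killing_nil_part], and to the other joint
    eigenvectors of the toral elements [T] by invariance, since [T] commutes with [n]. It thus lies
    in the Killing radical. *)
Let nil_central n : H n -> nil_on G (lie n) -> forall v, G v -> [lie n, v] = 0.
Proof.
move=> Hn nn; have Gn := HG Hn.
suff kn : G `<=` [set v | G v /\ kappa v n = 0].
  apply: (killing_radical_central fG aG rG Gn _).2 => v Gv.
  by rewrite killingC //; have [] := kn v Gv.
have nH v : H v -> kappa n v = 0.
  move=> Hv; apply: (killing_nil_part fG aG aH (@subset_refl _ H) HG split_cartan) => //.
  by move=> y; apply: Hlie.
pose T := [set s | [/\ G s, diag_on G (lie s) & forall x, H x -> [lie s, x] = 0]].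
have [L [LT TL]] := finite_spanning_subset fG (T := T) (fun s Ts => let: And3 Gs _ _ := Ts in Gs).
have sk := subspace_killing_orthogonal fG aG Gn.
apply: (joint_eigen_span fG aG (L := L) _ _ sG (@subset_refl _ G) _ sk).
- by move=> s /LT[].
- by move=> s s' /LT[_ _ sH'] /LT[Gs' _ s'H]; apply/sH'/split_central.
- by move=> s u /LT[Gs _ _] Gu; apply: Glie.
move=> v Gv vL; split=> //.
have [s0|/existsNP[s /not_implyP[Ls sv]]] := pselect (forall s, s \in L -> [lie s, v] = 0).
  rewrite killingC //; apply: nH; apply: fitting_zero_sub; split=> // s Gs sd sH'.
  have : T s by []; move=> /TL; move: s {Gs sd sH'}.
  apply: smallest_sub => [|s /s0//]; split=> /= [|a x y xv yv]; first exact: lie0l.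
  by rewrite lie_linearl xv yv scaler0 addr0.
have [a sva] := vL s Ls; have [Gs _ sH'] := LT s Ls.
have a0 : a != 0 by apply: contra_notN sv => /eqP a0; rewrite sva a0 scale0r.
have -> : v = a^-1 *: [lie s, v] by rewrite sva scalerA mulVf // scale1r.
rewrite killingZl //; last exact: Glie.
have Gvs : G [lie v, s] by apply: Glie.
rewrite lieC (killingNl fG aG Gvs Gn) (killing_lie fG aG Gv Gs Gn) sH' //.
by rewrite (killingC fG aG Gv (subspace0 sG)) (killing0l fG aG Gv) oppr0 mulr0.
Qed.

Lemma cartan_abelian x y : H x -> H y -> [lie x, y] = 0.
Proof.
move=> Hx Hy; have [s [n [Gs xE sH' sd nn]]] := split_cartan Hx.
have Hs := split_central Gs sH'.
have Hn : H n by rewrite -[n](addKr s) -xE addrC; apply: subspaceB.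
by rewrite xE lieDl sH' // (nil_central Hn nn) ?addr0 //; apply: HG.
Qed.

Lemma cartan_diag x : H x -> diag_on G (lie x).
Proof.
move=> Hx; have [s [n [Gs xE sH' sd nn]]] := split_cartan Hx.
have Hs := split_central Gs sH'.
have Hn : H n by rewrite -[n](addKr s) -xE addrC; apply: subspaceB.
move=> W sW Wx; apply: sd => // a v Gv sv; apply: (Wx a) => //.
by rewrite xE lieDl (nil_central Hn nn) // addr0.
Qed.

Lemma cartan_weight_span U W : subspace U -> U `<=` G ->
  (forall s u, H s -> U u -> U [lie s, u]) -> subspace W ->
  (forall v, U v -> (forall s, H s -> exists a, [lie s, v] = a *: v) -> W v) ->
  U `<=` W.
Proof.
move=> sU UG HU sW WU; have [L [LH HL]] := finite_spanning_subset fG HG.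
apply: (joint_eigen_span fG aG (L := L)) => //.
- by move=> s /LH Hs; split; [apply: HG|apply: cartan_diag].
- by move=> s s' /LH Hs /LH; apply: cartan_abelian.
- by move=> s u /LH; apply: HU.
move=> v Uv vL; apply: WU => // s /HL; move: s.
apply: smallest_sub => //; split=> [|a x y [b xv] [c yv]].
  by exists 0; rewrite lie0l scale0r.
by exists (a * b + c); rewrite lie_linearl xv yv scalerA scalerDl.
Qed.

End Cartan.

(** * Weights of sl2-triples *)

Section Sl2.
Variables (C : numClosedFieldType) (g : lieAlgType C) (G : set g).
Hypothesis (fG : finite_dimensional G) (aG : subalgebra G).
Let Glie : forall x y, G x -> G y -> G [lie x, y] := aG.2.
Let adO := operator_lie aG.
Implicit Types (x y z v : g).

Definition sl2_triple (e f h : g) := [/\ [lie e, f] = h, [lie h, e] = 2 *: e &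
  [lie h, f] = - 2 *: f].

Lemma sl2_tripleC e f h : sl2_triple e f h -> sl2_triple f e (- h).
Proof.
move=> [ef he hf]; split; first by rewrite lieC ef.
  by rewrite lieNl hf scaleNr opprK.
by rewrite lieNl he scaleNr.
Qed.

Lemma eigenvalues_finite f : operator G f -> exists r : seq C,
  forall a v, G v -> v <> 0 -> f v = a *: v -> a \in r.
Proof.
move=> fO; have [r rE] := closed_field_poly_normal (char_poly (mxof G f)).
exists r => a v Gv v0 fv.
have : eigenvalue (mxof G f) a by apply/(eigenvalue_mxof fG) => //; exists v.
rewrite eigenvalue_root_char rE (monicP (char_poly_monic _)) scale1r.
by rewrite root_prod_XsubC.
Qed.

Lemma sl2_raise e f h c v k : sl2_triple e f h -> [lie h, v] = c *: v ->
  [lie h, iter k (lie e) v] = (c + (2 * k)%:R) *: iter k (lie e) v.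
Proof.
move=> [ef he hf] hv; elim: k => [|k IHk]; first by rewrite muln0 addr0.
rewrite iterS lie_derivation he IHk lieZl lieZr -scalerDl; congr (_ *: _).
by rewrite mulnS natrD; ring.
Qed.

Lemma sl2_locally_nilpotent e f h c v : sl2_triple e f h -> G e -> G f -> G v ->
  [lie h, v] = c *: v -> exists k, iter k (lie e) v = 0.
Proof.
move=> efh Ge Gf Gv hv; apply: contrapT => /forallNP nv.
have [ef _ _] := efh; have Gh : G h by rewrite -ef; apply: Glie.
have [r rP] := eigenvalues_finite (adO Gh).
pose s := [seq c + (2 * k)%:R | k <- iota 0 (size r).+1].
have us : uniq s.
  rewrite map_inj_uniq ?iota_uniq // => i j /addrI /eqP.
  by rewrite eqr_nat eqn_mul2l => /eqP.
have /(uniq_leq_size us) : {subset s <= r}.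
  move=> _ /mapP[k _ ->]; apply: (rP _ (iter k (lie e) v)) => //.
    by apply: iterU => //; apply: adO.
  exact: sl2_raise efh hv.
by rewrite size_map size_iota ltnn.
Qed.

Lemma sl2_highest e f h c v : sl2_triple e f h -> G e -> G f -> G v -> v <> 0 ->
  [lie h, v] = c *: v -> [lie e, v] = 0 -> exists m : nat, c = m%:R.
Proof.
move=> efh Ge Gf Gv v0 hv ev; have fenh := sl2_tripleC efh.
have [ef he hf] := efh.
have hfv k : [lie h, iter k (lie f) v] = (c - (2 * k)%:R) *: iter k (lie f) v.
  have nhv : [lie - h, v] = (- c) *: v by rewrite lieNl hv scaleNr.
  apply: oppr_inj; have := sl2_raise k fenh nhv; rewrite lieNl => ->.
  by rewrite -scaleNr opprB addrC.
have ef_v k : [lie e, iter k.+1 (lie f) v] = (k.+1%:R * (c - k%:R)) *: iter k (lie f) v.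
  elim: k => [|k IHk].
    by rewrite /= lie_derivation ef ev lie0r addr0 hv subr0 mul1r.
  rewrite iterS lie_derivation ef hfv IHk lieZr -scalerDl; congr (_ *: _).
  by rewrite natrM -!natr1; ring.
have [k kv] := sl2_locally_nilpotent fenh Gf Ge Gv (etrans (lieNl h v) (etrans (congr1 _ hv) (esym (scaleNr c v)))).
(* At the last nonzero iterate, [ef_v m] reads [0 = (m + 1) (c - m)]. *)
have [m [mv mv1]] : exists m, iter m (lie f) v <> 0 /\ iter m.+1 (lie f) v = 0.
  elim: k kv => [//|k IHk] kv.
  by have [/IHk//|nk] := pselect (iter k (lie f) v = 0); exists k.
exists m; have /esym/eqP := ef_v m; rewrite mv1 lie0r scaler_eq0 mulf_eq0 pnatr_eq0 /=.
by rewrite subr_eq0 => /orP[/eqP//|/eqP].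
Qed.

Lemma sl2_integral e f h c v : sl2_triple e f h -> G e -> G f -> G v -> v <> 0 ->
  [lie h, v] = c *: v -> exists m : int, c = m%:~R.
Proof.
move=> efh Ge Gf Gv v0 hv.
have [k kv] := sl2_locally_nilpotent efh Ge Gf Gv hv.
have [m [mv mv1]] : exists m, iter m (lie e) v <> 0 /\ iter m.+1 (lie e) v = 0.
  elim: k kv => [//|k IHk] kv.
  by have [/IHk//|nk] := pselect (iter k (lie e) v = 0); exists k.
have [|n cE] := sl2_highest efh Ge Gf _ mv (sl2_raise m efh hv) mv1.
  by apply: iterU => //; apply: adO.
exists (n%:Z - (2 * m)%:Z); rewrite -[c](addrK (2 * m)%:R) cE.
by rewrite rmorphB /= !pmulrn.
Qed.

Lemma sl2_raise_neq0 e f h c v : sl2_triple e f h -> G e -> G f -> G v -> v <> 0 ->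
  [lie h, v] = c *: v -> c < 0 -> [lie e, v] <> 0.
Proof.
move=> efh Ge Gf Gv v0 hv c0 ev; have [m cE] := sl2_highest efh Ge Gf Gv v0 hv ev.
by move: c0; rewrite cE ltrn0.
Qed.

Lemma sl2_lower_neq0 e f h c v : sl2_triple e f h -> G e -> G f -> G v -> v <> 0 ->
  [lie h, v] = c *: v -> 0 < c -> [lie f, v] <> 0.
Proof.
move=> efh Ge Gf Gv v0 hv c0; apply: (sl2_raise_neq0 (sl2_tripleC efh) Gf Ge Gv v0 (c := - c)).
  by rewrite lieNl hv scaleNr.
by rewrite oppr_lt0.
Qed.

End Sl2.

(** * Roots of a finite-dimensional reductive algebra *)

Section Roots.
Variables (C : numClosedFieldType) (g : lieAlgType C) (G H : set g).
Hypothesis (fG : finite_dimensional G) (aG : subalgebra G) (rG : reductive G).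
Hypothesis cH : findim_cartan G H.
Let sG : subspace G := finite_dimensional_subspace fG.
Let Glie : forall x y, G x -> G y -> G [lie x, y] := aG.2.
Let adO := operator_lie aG.
Let HG : H `<=` G. Proof. by case: cH. Qed.
Let sH : subspace H. Proof. by case: cH => -[]. Qed.
Implicit Types (U W N : set g) (x y z v t : g) (al be : g -> C).
Local Notation kappa := (killing G).
Local Notation S := (lie_product G G).
Local Notation wt := (weight_space G H).
Let habel := cartan_abelian fG aG rG cH.

Lemma subspace_weight al : subspace (wt al).
Proof.
split=> [|a x y [Gx xP] [Gy yP]].
  by split=> [|t _]; [apply: subspace0|rewrite lie0r scaler0].
split=> [|t Ht]; first by case: sG => _; apply.
by rewrite lie_linearr xP // yP // scalerDr !scalerA mulrC.
Qed.

Lemma weight_zero al x : (forall t, H t -> al t = 0) -> wt al x -> H x.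
Proof.
move=> al0 [Gx xP]; apply: (cartan_centralizer cH) => // t Ht.
by rewrite xP // al0 // scale0r.
Qed.

Lemma weight_lie al be x y : wt al x -> wt be y ->
  wt (fun t => al t + be t) [lie x, y].
Proof.
move=> [Gx xP] [Gy yP]; split=> [|t Ht]; first exact: Glie.
by rewrite lie_derivation (xP t Ht) (yP t Ht) lieZl lieZr scalerDl.
Qed.

Lemma killing_weight al be x y t : wt al x -> wt be y -> H t ->
  al t + be t != 0 -> kappa x y = 0.
Proof.
move=> [Gx xP] [Gy yP] Ht; have Gt := HG Ht; apply: contraNeq => xy0.
have Gxt : G [lie x, t] by apply: Glie.
have xt : [lie x, t] = - (al t *: x) by rewrite lieC xP.
have ty : [lie t, y] = be t *: y by rewrite yP.
apply/eqP; apply: (mulIf xy0); rewrite mul0r mulrDl.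
have := killing_lie fG aG Gx Gt Gy; rewrite xt ty (killingNl fG aG) //; last exact: subspaceZ.
have Gby : G (be t *: y) by apply: subspaceZ.
rewrite (killingZl fG aG) // (killingC fG aG Gx Gby) (killingZl fG aG) //.
by rewrite (killingC fG aG Gy Gx) => <-; rewrite subrr.
Qed.

Lemma weight_pair al x t : wt al x -> x <> 0 -> H t -> al t != 0 ->
  exists2 y, wt (fun t => - al t) y & kappa x y != 0.
Proof.
move=> xw x0 Ht alt; have [Gx xP] := xw; apply: contrapT => nex.
have xG : G `<=` [set y | G y /\ kappa y x = 0].
  apply: (cartan_weight_span fG aG rG cH sG) => //.
  - by move=> s u /HG; apply: Glie.
  - exact: subspace_killing_orthogonal.
  move=> v Gv vH; split=> //; rewrite killingC //.
  have [be beP] : exists be : g -> C, forall s, H s -> [lie s, v] = be s *: v.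
    pose be s := xget 0 [set a | [lie s, v] = a *: v].
    exists be => s /vH ex; exact: (xgetPex 0 ex).
  have [eq_al|/existsNP[s /not_implyP[Hs nbe]]] :=
    pselect (forall s, H s -> al s + be s = 0); last first.
    by apply: (killing_weight xw (be := be) _ Hs); [split|apply/eqP].
  apply/eqP; apply: contra_notT nex => xv; exists v => //; split=> // s Hs.
  by rewrite beP //; congr (_ *: _); apply/eqP; rewrite -addr_eq0 addrC eq_al.
have [_ xZ] : lie_center G x.
  apply: (killing_radical_central fG aG rG Gx) => y Gy.
  by rewrite killingC //; have [] := xG y Gy.
have := xP t Ht; rewrite lieC xZ ?oppr0; last exact: HG.
by move/esym/eqP; rewrite scaler_eq0 (negbTE alt) => /eqP.
Qed.

Lemma weight_bracket al x y : wt al x -> wt (fun t => - al t) y ->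
  H [lie x, y] /\ forall t, H t -> kappa [lie x, y] t = al t * kappa x y.
Proof.
move=> xw yw; have [Gx xP] := xw; have [Gy yP] := yw; split=> [|t Ht].
  by apply: weight_zero (weight_lie xw yw) => t _; rewrite subrr.
have Gt := HG Ht; rewrite (killing_lie fG aG) // lieC yP // scaleNr opprK.
rewrite killingC //; last exact: subspaceZ.
by rewrite (killingZl fG aG) // killingC.
Qed.

Lemma cartan_killing_nondegenerate z : H z -> S z ->
  (forall t, H t -> kappa z t = 0) -> z = 0.
Proof.
move=> Hz Sz zH; have Gz := HG Hz; apply: (killing_nondegenerate fG aG rG) => // y Gy.
rewrite killingC //; suff [] : [set y | G y /\ kappa y z = 0] y by [].
move: y Gy; apply: (cartan_weight_span fG aG rG cH sG) => //.
- by move=> s u /HG; apply: Glie.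
- exact: subspace_killing_orthogonal.
move=> v Gv vH; split=> //; rewrite killingC //.
have [v0|/existsNP[s /not_implyP[Hs sv]]] := pselect (forall s, H s -> [lie s, v] = 0).
  by apply/zH/(cartan_centralizer cH).
have [a sva] := vH s Hs; have Gs := HG Hs.
have a0 : a != 0 by apply: contra_notN sv => /eqP a0; rewrite sva a0 scale0r.
have -> : v = a^-1 *: [lie s, v] by rewrite sva scalerA mulVf // scale1r.
have Gsv : G [lie s, v] by apply: Glie.
rewrite killingC //; last exact: subspaceZ.
rewrite (killingZl fG aG) // (killingC fG aG Gsv Gz) -(killing_lie fG aG) // habel //.
by rewrite (killing0l fG aG) // mulr0.
Qed.

Definition root_triple al e f h :=
  [/\ wt al e, wt (fun t => - al t) f, H h, sl2_triple e f h & e <> 0].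

Lemma root_triple_root al e f h : root_triple al e f h -> al h = 2.
Proof.
move=> [[Ge eP] _ Hh [_ he _] e0]; have := eP h Hh; rewrite he => /esym/eqP.
by rewrite -subr_eq0 -scalerBl scaler_eq0 subr_eq0 => /orP[/eqP//|/eqP].
Qed.

Lemma root_triple_exists al x t : wt al x -> x <> 0 -> H t -> al t != 0 ->
  exists f h, root_triple al x f h.
Proof.
move=> xw x0 Ht alt; have [Gx xP] := xw.
have [y yw xy0] := weight_pair xw x0 Ht alt; have [Gy yP] := yw.
have [Hz zK] := weight_bracket xw yw; set z := [lie x, y] in Hz zK.
have Gz := HG Hz.
(* If [al z = 0], then [z] commutes with [x], so the conjugate part [d] of [z] kills [x]. The trace
   of [d z] is then the Killing product of [d x] and [y], which is zero, and [z] is central; this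
   contradicts [zK] at [t]. *)
have alz : al z != 0.
  apply/eqP => alz.
  have zx : [lie z, x] = 0 by rewrite xP // alz scale0r.
  have [d [dO dder dc dz]] := conj_part fG aG Gz (cartan_diag fG aG rG cH Hz).
  have [dx _] := dc x Gx zx.
  have z0 : forall v, G v -> [lie z, v] = 0.
    apply: dz; rewrite /z (trace_derivation fG aG dO dder Gx Gy) dx.
    exact: (killing0l fG aG).
  have /eqP := zK t Ht; rewrite killing_center_l //; last exact: HG.
  by rewrite eq_sym mulf_eq0 (negbTE alt) (negbTE xy0).
exists ((2 / al z) *: y), ((2 / al z) *: z); split=> //.
- by apply: subspaceZ => //; apply: subspace_weight.
- exact: subspaceZ.
split; first by rewrite lieZr.
  by rewrite lieZl xP // scalerA mulfVK.
by rewrite lieZl lieZr yP // !scalerA; congr (_ *: _); field.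
Qed.

Lemma root_triple_killing al e f h t : root_triple al e f h -> H t ->
  kappa h t = al t * kappa e f.
Proof.
move=> [ew fw _ [<- _ _] _] Ht; by have [_ ->] := weight_bracket ew fw.
Qed.

Lemma root_triple_derived al e f h : root_triple al e f h -> S h.
Proof. by move=> [[Ge _] [Gf _] _ [<- _ _] _]; apply: lie_product_lie. Qed.

Lemma root_triple_neq0 al e f h : root_triple al e f h -> h <> 0.
Proof.
move=> [_ _ _ [_ he _] e0] h0; apply: e0; move: he; rewrite h0 lie0l => /esym/eqP.
by rewrite scaler_eq0 pnatr_eq0 => /eqP.
Qed.

(** Subtracting a multiple of [e] makes [x] Killing-orthogonal to [f]. The difference [y] then
    commutes with [f], whereas a nonzero vector of [h]-weight 2 cannot be killed by [f]. *)
Lemma root_triple_dim1 al e f h x : root_triple al e f h -> wt al x ->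
  exists a, x = a *: e.
Proof.
move=> tr xw; have [ew fw Hh efh e0] := tr.
have [Ge eP] := ew; have [Gf fP] := fw; have [Gx xP] := xw.
have ef0 : kappa e f != 0.
  apply: contra_notN (root_triple_neq0 tr) => /eqP ef0.
  apply: cartan_killing_nondegenerate => //; first exact: root_triple_derived tr.
  by move=> t Ht; rewrite (root_triple_killing tr) // ef0 mulr0.
pose a := kappa x f / kappa e f.
pose y := - a *: e + x.
have yw : wt al y by have [_] := subspace_weight al; apply.
have Gy : G y by case: yw.
have yf : kappa y f = 0 by rewrite (killingPl fG aG) // mulNr divfK // addNr.
have yf0 : [lie y, f] = 0.
  have [Hyf yfK] := weight_bracket yw fw.
  apply: cartan_killing_nondegenerate => //; first exact: lie_product_lie.
  by move=> t Ht; rewrite yfK // yf mulr0.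
exists a; have [y0|y0] := pselect (y = 0).
  by apply/eqP; rewrite -subr_eq0 addrC -scaleNr -/y y0.
have hy : [lie h, y] = 2 *: y by have [_ ->//] := yw; rewrite (root_triple_root tr).
by case: (sl2_lower_neq0 fG aG efh Ge Gf Gy y0 hy) => //; rewrite lieC yf0 oppr0.
Qed.

(** A stand-in for the real span of the coroots. It contains the coroots, is closed under real
    combinations, and carries a positive definite Killing form. *)
Definition real_cartan := [set t | [/\ H t, S t &
  forall a v, G v -> v <> 0 -> [lie t, v] = a *: v -> a \is Num.real]].

Lemma real_cartanE t : H t -> S t ->
  (forall v, G v -> v <> 0 -> (forall s, H s -> exists a, [lie s, v] = a *: v) ->
    exists2 a, a \is Num.real & [lie t, v] = a *: v) ->
  real_cartan t.
Proof.
move=> Ht St tP; split=> // a v Gv v0 tv; apply: contrapT => na.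
suff : [set u | G u /\ [lie t, u] = a *: u] `<=` [set 0] by move/(_ v (conj Gv tv)).
apply: (cartan_weight_span fG aG rG cH); last 1 first.
- move=> u [Gu tu] uH; apply: contrapT => u0; apply: na.
  have [b br tub] := tP u Gu u0 uH.
  suff -> : a = b by [].
  apply/eqP; rewrite -subr_eq0; apply/negPn/negP => ab; apply: u0.
  by apply: (scalerI ab); rewrite scalerBl -tu -tub subrr scaler0.
- split=> [|b x y [Gx tx] [Gy ty]]; first by split; [apply: subspace0|rewrite lie0r scaler0].
  by split; [case: sG => _; apply|rewrite lie_linearr tx ty scalerDr !scalerA mulrC].
- by move=> u [].
- move=> s u Hs [Gu tu]; split; first by apply: Glie => //; apply: HG.
  by rewrite lie_commute ?tu ?lieZr //; apply: habel.
- exact: subspace_set0.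
Qed.

Lemma real_cartanP r x y : r \is Num.real -> real_cartan x -> real_cartan y ->
  real_cartan (r *: x + y).
Proof.
move=> rr [Hx Sx xr] [Hy Sy yr]; apply: real_cartanE.
- by case: sH => _; apply.
- by have [_] := subspace_lie_product G G; apply.
move=> v Gv v0 vH; have [a xv] := vH x Hx; have [b yv] := vH y Hy.
exists (r * a + b); last by rewrite lie_linearl xv yv scalerDl scalerA.
by rewrite rpredD ?rpredM //; [apply: xr xv|apply: yr yv].
Qed.

Lemma real_cartan_coroot al e f h : root_triple al e f h -> real_cartan h.
Proof.
move=> tr; have [[Ge _] [Gf _] Hh efh _] := tr; apply: real_cartanE => //.
  exact: root_triple_derived tr.
move=> v Gv v0 /(_ h Hh)[a hv]; exists a => //.
by have [m ->] := sl2_integral fG aG efh Ge Gf Gv v0 hv; apply: realz.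
Qed.

Lemma real_cartan_killing x : real_cartan x -> 0 <= kappa x x /\ (kappa x x = 0 -> x = 0).
Proof.
move=> [Hx Sx xr]; have Gx := HG Hx.
have [ge0 eq0] := trace_sqr_real fG (adO Gx) xr.
split=> // /eq0 x0; apply: (center_derived_trivial fG rG) => //; split=> // v Gv.
suff [] : [set u | G u /\ [lie x, u] = 0] v by [].
move: v Gv; apply: (cartan_diag fG aG rG cH Hx) => [|a v Gv xv].
  split=> [|b u w [Gu xu] [Gw xw]]; first by split; [apply: subspace0|rewrite lie0r].
  by split; [case: sG => _; apply|rewrite lie_linearr xu xw scaler0 addr0].
split=> //; have [->|v0] := pselect (v = 0); first by rewrite lie0r.
by rewrite xv (x0 a v) // scale0r.
Qed.

Lemma root_triple_killing_gt0 al e f h : root_triple al e f h -> 0 < kappa e f.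
Proof.
move=> tr; have [_ _ Hh _ _] := tr.
have [ge0 eq0] := real_cartan_killing (real_cartan_coroot tr).
have hh : kappa h h = 2 * kappa e f by rewrite (root_triple_killing tr Hh) (root_triple_root tr).
rewrite lt_def; apply/andP; split.
  apply/eqP => ef0; apply: (root_triple_neq0 tr); apply: eq0; by rewrite hh ef0 mulr0.
by rewrite -(pmulr_rge0 _ (ltr0n _ 2)) -hh.
Qed.

End Roots.

(** * Root-reductive algebras *)

Section Embedding.
Variables (C : numClosedFieldType) (g : lieAlgType C) (A B : set g).
Hypothesis (fA : finite_dimensional A) (aA : subalgebra A).
Hypothesis (aB : subalgebra B) (BA : B `<=` A).

(** The subalgebra [B] lies in the generalized null space of [ad n], so the conjugate part [t] kills
    [B]. Since [n] is a sum of brackets of elements of [B], [trace_derivation] makes the trace of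
    [t n] vanish. *)
Lemma nil_on_extend n : lie_product B B n -> nil_on B (lie n) -> nil_on A (lie n).
Proof.
move=> BBn nB; have sA := finite_dimensional_subspace fA.
have fB : finite_dimensional B := finite_dimensional_sub fA aB.1 BA.
have Bn : B n := derived_sub fB aB BBn.
have An := BA Bn; have nO := operator_lie aA An.
have [s0 [t [_ tO _ tder [_ _ [gen nilt _ _]]]]] :=
  derivation_jordan fA aA nO (@derivation_lie _ _ _ n).
have tB x : B x -> t x = 0.
  move=> Bx; have [k kx] := nB x Bx.
  by have [|_ ->] := gen 0 k x (BA Bx); rewrite ?iter_shift0 // rmorph0 scale0r.
apply: nilt; suff [] : [set x | A x /\ trace A (t \o lie x) = 0] n by [].
move: n BBn {nB Bn An nO gen}; apply: lie_product_sub.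
  exact: subspace_trace_comp.
move=> x y Bx By; have Ax := BA Bx; have Ay := BA By.
split; first by case: aA => _; apply.
by rewrite trace_derivation // tB //; apply: killing0l.
Qed.

End Embedding.

(** * Roots along the exhaustion *)

Section Chain.
Variables (C : numClosedFieldType) (g : lieAlgType C) (G_ H_ : nat -> set g).
Hypothesis rr : root_reductive G_ H_.
Implicit Types (U W N : set g) (x y z v t : g) (al be ga : g -> C) (i j k l : nat).

Lemma rr_fd i : finite_dimensional (G_ i). Proof. by case: rr. Qed.
Lemma rr_alg i : subalgebra (G_ i). Proof. by case: rr. Qed.
Lemma rr_red i : reductive (G_ i). Proof. by case: rr. Qed.
Arguments rr_red i _ _ : clear implicits.
Lemma rr_car i : findim_cartan (G_ i) (H_ i). Proof. by case: rr. Qed.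
Hint Resolve rr_fd rr_alg rr_red rr_car : core.

Lemma rr_sub i : subspace (G_ i). Proof. exact/finite_dimensional_subspace. Qed.
Lemma rr_lie i x y : G_ i x -> G_ i y -> G_ i [lie x, y].
Proof. by have [_] := rr_alg i; apply. Qed.
Hint Resolve rr_sub : core.

Lemma rr_mono i j : (i <= j)%N -> G_ i `<=` G_ j.
Proof.
move=> /subnK <-; elim: (j - i)%N => [|d IHd]; first exact: subset_refl.
by apply: subset_trans IHd _; have [] := rr_root rr (d + i).
Qed.

Lemma rr_cover x : exists i, G_ i x.
Proof.
have [i _ Gx] : (\bigcup_i G_ i) x by rewrite (rr_union rr).
by exists i.
Qed.

Lemma rr_cover_from k x : exists2 i, (k <= i)%N & G_ i x.
Proof.
have [i Gx] := rr_cover x; exists (maxn k i); first exact: leq_maxl.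
by apply: (rr_mono (leq_maxr _ _)).
Qed.

Lemma rr_cartan_meet i j : (i <= j)%N -> H_ i = H_ j `&` G_ i.
Proof.
move=> /subnK <-; elim: (j - i)%N => [|d IHd].
  by apply/seteqP; split=> [x Hx|x []//]; split=> //; have [_ HG _ _] := rr_car i; apply: HG.
rewrite IHd (rr_compat rr) -setIA; congr (_ `&` _).
by rewrite setIC; apply/setIidPl/rr_mono/leq_addl.
Qed.

Definition splitting := \bigcup_i H_ i.
Local Notation HH := splitting.

Lemma splitting_meet i x : HH x -> G_ i x -> H_ i x.
Proof.
move=> [j _ Hx] Gx; have [ij|/ltnW ji] := leqP i j.
  by rewrite (rr_cartan_meet ij).
by move: Hx; rewrite (rr_cartan_meet ji) => -[].
Qed.

Lemma splitting_H i x : H_ i x -> HH x. Proof. by move=> Hx; exists i. Qed.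

Lemma rr_HG i : H_ i `<=` G_ i. Proof. by case: (rr_car i). Qed.

Lemma rr_Hmono i j : (i <= j)%N -> H_ i `<=` H_ j.
Proof. by move=> ij x; rewrite (rr_cartan_meet ij) => -[]. Qed.

Lemma splitting_from k t : HH t -> exists2 i, (k <= i)%N & H_ i t.
Proof.
move=> [i _ Ht]; exists (maxn k i); first exact: leq_maxl.
exact: rr_Hmono (leq_maxr _ _) _ Ht.
Qed.

Definition gweight al := [set x | forall t, HH t -> [lie t, x] = al t *: x].

Lemma subspace_gweight al : subspace (gweight al).
Proof.
split=> [t _|a x y xP yP t Ht]; first by rewrite lie0r scaler0.
by rewrite lie_linearr xP // yP // scalerDr !scalerA mulrC.
Qed.

Lemma gweight_at al i x : gweight al x -> G_ i x -> weight_space (G_ i) (H_ i) al x.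
Proof. by move=> xw Gx; split=> // t Ht; apply/xw/(splitting_H Ht). Qed.

Lemma is_root_space_extend i j S : (i <= j)%N ->
  is_root_space (G_ i) (H_ i) S -> is_root_space (G_ j) (H_ j) S.
Proof.
move=> /subnK <-; elim: (j - i)%N => [//|d IHd] /IHd {IHd}.
have [_ _ _] := rr_root rr (d + i).
by rewrite setIC -(rr_compat rr); apply.
Qed.

(** By the root inclusions a root space of [G_ i] remains a root space at every later level, so [x]
    is an eigenvector of each [H_ j]. *)
Lemma weight_extend al i x t : weight_space (G_ i) (H_ i) al x -> x <> 0 ->
  H_ i t -> al t != 0 -> exists be, [/\ gweight be x,
    forall t, H_ i t -> be t = al t & forall t, ~ HH t -> be t = 0].
Proof.
move=> xw x0 Ht alt.
have rS : is_root_space (G_ i) (H_ i) (weight_space (G_ i) (H_ i) al).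
  exists al; split=> //; first by exists t.
  by move=> S0; apply: x0; rewrite S0 in xw.
have ev s : HH s -> exists a, [lie s, x] = a *: x.
  move=> /(splitting_from i)[j ij Hs]; have [be [_ SE _]] := is_root_space_extend ij rS.
  by exists (be s); move: xw; rewrite SE => -[_]; apply.
pose be s := if pselect (HH s) is left Hs then projT1 (cid (ev s Hs)) else 0.
have beP s : HH s -> [lie s, x] = be s *: x.
  by move=> Hs; rewrite /be; case: pselect => // Hs'; exact: (projT2 (cid (ev s Hs'))).
exists be; split=> // [s Hs|s nHs]; last by rewrite /be; case: pselect.
have [_ /(_ s Hs)] := xw; rewrite beP; last exact: splitting_H Hs.
by move=> /eqP; rewrite -subr_eq0 -scalerBl scaler_eq0 subr_eq0 => /orP[/eqP//|/eqP].
Qed.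

Lemma gweight_nonzero_at al i x : gweight al x -> G_ i x -> x <> 0 ->
  (exists2 t, HH t & al t != 0) -> exists2 t, H_ i t & al t != 0.
Proof.
move=> xw Gx x0 [t Ht alt]; apply: contrapT => nex.
have al0 s : H_ i s -> al s = 0.
  by move=> Hs; apply/eqP; apply: contra_notT nex => als; exists s.
have Hx : H_ i x by apply: (weight_zero (rr_car i) al0); apply: gweight_at.
have [j ij Hjt] := splitting_from i Ht.
have := xw t Ht; rewrite (cartan_abelian (rr_fd j) (rr_alg j) (rr_red j) (rr_car j)) //.
  by move/esym/eqP; rewrite scaler_eq0 (negbTE alt) => /eqP.
exact: rr_Hmono ij _ Hx.
Qed.

(** Root inclusions preserve the whole root space as a set: it does not grow from [G_ i] to
    [G_ j]. *)
Lemma gweight_sub al i x : gweight al x -> G_ i x -> x <> 0 ->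
  (exists2 t, HH t & al t != 0) -> gweight al `<=` G_ i.
Proof.
move=> xw Gx x0 alt y yw; have [t Ht alt'] := gweight_nonzero_at xw Gx x0 alt.
have rS : is_root_space (G_ i) (H_ i) (weight_space (G_ i) (H_ i) al).
  exists al; split=> //; first by exists t.
  by move=> S0; apply: x0; have := gweight_at xw Gx; rewrite S0.
have [j ij Gy] := rr_cover_from i y.
have [be [_ SE _]] := is_root_space_extend ij rS.
have [_ beP] : weight_space (G_ j) (H_ j) be x by rewrite -SE; apply: gweight_at.
suff : weight_space (G_ i) (H_ i) al y by case.
rewrite SE; split=> // s Hs; have Hs' := splitting_H Hs.
have := beP s Hs; rewrite xw // => /eqP; rewrite -subr_eq0 -scalerBl scaler_eq0 subr_eq0.
by move=> /orP[/eqP <-|/eqP//]; apply: yw.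
Qed.

(* Roots are extended by [0] outside the splitting Cartan subalgebra, so that
   two roots with the same root space are equal functions. *)
Definition root al := [/\ forall t, ~ HH t -> al t = 0,
  exists2 t, HH t & al t != 0 & exists2 x, gweight al x & x <> 0].

Definition root_in i al := root al /\ gweight al `<=` G_ i.

Lemma root_in_exists k al : root al -> exists2 i, (k <= i)%N & root_in i al.
Proof.
move=> ral; have [_ alt [x xw x0]] := ral; have [i ki Gx] := rr_cover_from k x.
by exists i => //; split=> //; apply: (gweight_sub xw Gx x0 alt).
Qed.

Lemma root_in_mono i j al : (i <= j)%N -> root_in i al -> root_in j al.
Proof. by move=> ij [ral aG]; split=> //; apply: subset_trans aG (rr_mono ij). Qed.

Lemma root_in_gen al i x : root al -> gweight al x -> x <> 0 -> G_ i x -> root_in i al.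
Proof. by move=> ral xw x0 Gx; split=> //; have [_ alt _] := ral; apply: gweight_sub xw Gx x0 alt. Qed.

Lemma rr_span i W : subspace W -> H_ i `<=` W ->
  (forall al, root_in i al -> gweight al `<=` W) -> G_ i `<=` W.
Proof.
move=> sW HW RW.
apply: (cartan_weight_span (rr_fd i) (rr_alg i) (rr_red i) (rr_car i)) => //.
  by move=> s u /rr_HG; apply: rr_lie.
move=> v Gv vH; have [v0|v0] := pselect (v = 0); first by rewrite v0; apply: subspace0.
pose al s := xget 0 [set a | [lie s, v] = a *: v].
have vw : weight_space (G_ i) (H_ i) al v.
  by split=> // s /vH ex; exact: (xgetPex 0 ex).
have [[t Ht alt]|nex] := pselect (exists2 t, H_ i t & al t != 0); last first.
  apply/HW/(weight_zero (rr_car i) _ vw) => t Ht.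
  by apply/eqP; apply: contra_notT nex => als; exists t.
have [be [bew beal be0]] := weight_extend vw v0 Ht alt.
apply: (RW be) => //; apply: (root_in_gen _ bew) => //; split=> //; last by exists v.
by exists t; [apply: splitting_H Ht|rewrite beal].
Qed.

Definition oppf al : g -> C := fun t => - al t.

Lemma gweight_lie al be x y : gweight al x -> gweight be y ->
  gweight (fun t => al t + be t) [lie x, y].
Proof.
move=> xw yw t Ht.
by rewrite lie_derivation (xw t Ht) (yw t Ht) lieZl lieZr scalerDl.
Qed.

(** The weight of [y] is a priori known on [H_ i] only. Elsewhere it is determined because the
    nonzero bracket of [x] and [y] lies in the splitting Cartan subalgebra, which is abelian, and so
    has weight zero. *)
Lemma gweight_opp al i x y : gweight al x -> weight_space (G_ i) (H_ i) (oppf al) y ->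
  G_ i x -> [lie x, y] <> 0 -> (exists2 t, H_ i t & al t != 0) -> gweight (oppf al) y.
Proof.
move=> xw yw Gx xy0 [t Ht alt].
have y0 : y <> 0 by move=> y0; apply: xy0; rewrite y0 lie0r.
have altN : oppf al t != 0 by rewrite /oppf oppr_eq0.
have [be [bew beal _]] := weight_extend yw y0 Ht altN.
have Hxy : H_ i [lie x, y] by have [] := weight_bracket (rr_fd i) (rr_alg i) (rr_car i) (gweight_at xw Gx) yw.
move=> s Hs; rewrite bew //; congr (_ *: _).
have [j ij Hjs] := splitting_from i Hs.
have := gweight_lie xw bew Hs.
rewrite (cartan_abelian (rr_fd j) (rr_alg j) (rr_red j) (rr_car j)) //; last exact: rr_Hmono ij _ Hxy.
move/esym/eqP; rewrite scaler_eq0 addrC addr_eq0 => /orP[/eqP//|/eqP//].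
Qed.

Definition gtriple al e f h :=
  [/\ gweight al e, gweight (oppf al) f, HH h, sl2_triple e f h & e <> 0].

Lemma gtriple_exists al i x : root_in i al -> gweight al x -> x <> 0 ->
  exists f h, gtriple al x f h /\ root_triple (G_ i) (H_ i) al x f h.
Proof.
move=> [[_ alt _] aG] xw x0; have Gx := aG x xw.
have [t Ht alt'] := gweight_nonzero_at xw Gx x0 alt.
have [f [h tr]] := root_triple_exists (rr_fd i) (rr_alg i) (rr_red i) (rr_car i) (gweight_at xw Gx) x0 Ht alt'.
have [_ fw Hh efh _] := tr; have [ef _ _] := efh.
exists f, h; split=> //; split=> //; last exact: splitting_H Hh.
apply: (gweight_opp xw fw Gx); last by exists t.
by rewrite ef; apply: root_triple_neq0 tr.
Qed.

Lemma gtriple_in al e f h i : root_in i al -> gtriple al e f h ->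
  root_triple (G_ i) (H_ i) al e f h.
Proof.
move=> rin [ew fw Hh efh e0]; have [_ aG] := rin; have Ge := aG e ew.
have [f' [h' [[_ f'w _ _ _] tr]]] := gtriple_exists rin ew e0.
have [_ [Gf' _] _ efh' _] := tr.
have [ef _ _] := efh; have [ef' _ _] := efh'.
have f'0 : f' <> 0 by move=> f'0; apply: (root_triple_neq0 tr); rewrite -ef' f'0 lie0r.
have [[_ [t Ht alt] _] _] := rin.
have Gf : G_ i f.
  apply: (gweight_sub f'w Gf' f'0) fw.
  by exists t => //; rewrite /oppf oppr_eq0.
have Gh : G_ i h by rewrite -ef; apply: rr_lie.
split=> //; [exact: gweight_at|exact: gweight_at|exact: splitting_meet].
Qed.

Lemma root_opp i al : root_in i al -> root_in i (oppf al).
Proof.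
move=> rin; have [[al0 [t Ht alt] [x xw x0]] _] := rin.
have [f [h [tr tr']]] := gtriple_exists rin xw x0; have [_ fw _ [ef _ _] _] := tr.
have f0 : f <> 0 by move=> f0; apply: (root_triple_neq0 tr'); rewrite -ef f0 lie0r.
have [_ [Gf _] _ _ _] := tr'.
apply: (root_in_gen _ fw f0 Gf); split; last by exists f.
  by move=> s nHs; rewrite /oppf al0 // oppr0.
by exists t => //; rewrite /oppf oppr_eq0.
Qed.

End Chain.

Arguments rr_red {C g G_ H_} rr i _ _.

(** * Semisimplicity at later levels; root spaces in ideals *)

Section Chain2.
Variables (C : numClosedFieldType) (g : lieAlgType C) (G_ H_ : nat -> set g).
Hypothesis rr : root_reductive G_ H_.
Implicit Types (U W N : set g) (x y z v t : g) (al be ga : g -> C) (i j k l : nat).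
Local Notation gweight := (gweight H_).
Local Notation root_in := (root_in G_ H_).
Local Notation root := (root H_).
Local Notation gtriple := (gtriple H_).
Let fdG i : finite_dimensional (G_ i) := rr_fd rr i.
Let alG i : subalgebra (G_ i) := rr_alg rr i.
Let rdG i : reductive (G_ i) := rr_red rr i.
Let crG i : findim_cartan (G_ i) (H_ i) := rr_car rr i.
Let sbG i : subspace (G_ i) := rr_sub rr i.
Let lieG i x y : G_ i x -> G_ i y -> G_ i [lie x, y] := @rr_lie _ _ _ _ rr i x y.
Let adG i x := @operator_lie _ _ _ (alG i) x.
Let HG i : H_ i `<=` G_ i := @rr_HG _ _ _ _ rr i.

Lemma weight_space_ext (A B : set g) al be : (forall t, B t -> al t = be t) ->
  weight_space A B al `<=` weight_space A B be.
Proof. by move=> ab x [Ax xP]; split=> // t Bt; rewrite xP // ab. Qed.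

(* The nilpotent part of [ad s] on [G_ j] is some [ad y].  The element [y]
   centralizes [G_ i] and is Killing-orthogonal to the centralizer of [G_ i];
   looking at its weight vectors, this forces it into [H_ j], hence [ad y = 0]. *)
Lemma diag_on_extend i j s : (i <= j)%N -> G_ i s ->
  diag_on (G_ i) (lie s) -> diag_on (G_ j) (lie s).
Proof.
move=> ij Gs sd; have Gij := rr_mono rr ij; have Gjs := Gij _ Gs.
have [p [p1 [pO _ pder _ [_ _ [gen _ dec nilp]]]]] :=
  derivation_jordan (fdG j) (alG j) (adG Gjs) (@derivation_lie _ _ _ s).
have dO := operatorBf (fdG j) (adG Gjs) pO.
have dder : derivation (G_ j) (fun x => [lie s, x] - p x).
  move=> x y Gx Gy; rewrite pder // lie_derivation lieBl lieBr opprD addrACA //.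
have p0 x : G_ j x -> [lie s, x] = 0 -> p x = 0.
  by move=> Gx sx; have [|-> _] := gen 0 1%N x Gx; rewrite ?iter_shift0 // scale0r.
have [z [Gz zZ]|y Sy yE] := derivation_inner (fdG j) (alG j) (@rdG j) dO dder.
  have sz : [lie s, z] = 0 by rewrite lieC zZ // oppr0.
  by rewrite sz p0 // subr0.
have Gy := derived_sub (fdG j) (alG j) Sy.
have ynil : nil_on (G_ j) (lie y).
  move=> x Gx; have [k kx] := nilp x Gx; exists k; rewrite -kx.
  by elim: k {kx} => //= k <-; rewrite yE //; apply: iterU => //; apply: adG.
pose C0 := [set x | G_ j x /\ forall u, G_ i u -> [lie u, x] = 0].
have sC0 : subspace C0.
  split=> [|a u v [Gu uP] [Gv vP]]; first by split; [apply: subspace0|move=> u _; rewrite lie0r].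
  split; first by case: (sbG j) => _; apply.
  by move=> w Gw; rewrite lie_linearr uP // vP // scaler0 addr0.
have C0y : C0 y.
  split=> // u Gu; suff [_ yu] : [set u | G_ i u /\ [lie y, u] = 0] u by rewrite lieC yu oppr0.
  move: u Gu; apply: sd => [|a v Gv sv].
    split=> [|a u v [Gu yu] [Gv yv]]; first by split; [apply: subspace0|rewrite lie0r].
    by split; [case: (sbG i) => _; apply|rewrite lie_linearr yu yv scaler0 addr0].
  split=> //; rewrite -yE ?sv; last exact: Gij.
  have [|-> _] := gen a 1%N v (Gij _ Gv); last by rewrite subrr.
  by rewrite /= /shift sv subrr.
pose Y := [set x | C0 x /\ forall z, C0 z -> killing (G_ j) x z = 0].
have Yy : Y y.
  split=> // z [Gz zP]; have sz : [lie s, z] = 0 by apply: zP.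
  have yz : [lie y, z] = 0 by rewrite -yE // sz p0 // subr0.
  rewrite killingC // /killing; apply: trace_nil_comm => //; try exact: adG.
  by move=> v Gv; apply: lie_commute; rewrite lieC yz oppr0.
have sY : subspace Y.
  split=> [|a u v [Cu uP] [Cv vP]].
    by split; [apply: subspace0|move=> z [Gz _]; apply: killing0l].
  split; first by case: sC0 => _; apply.
  move=> z Cz; have [Gz _] := Cz; have [Gu _] := Cu; have [Gv _] := Cv.
  by rewrite killingPl // uP // vP // mulr0 addr0.
have C0H t x : H_ j t -> C0 x -> C0 [lie t, x].
  move=> Ht [Gx xP]; split; first by apply: lieG => //; apply: HG.
  move=> u Gu; rewrite lie_derivation (xP u) // lie0r addr0.
  have ->// : [lie [lie u, t], x] = 0.
  apply: xP; rewrite lieC; apply: subspaceN => //.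
  suff [] : [set u | G_ i u /\ G_ i [lie t, u]] u by [].
  have Ht' := splitting_H Ht.
  move: u Gu; apply: (rr_span rr) => [|u Hu|al [ral aG] u uw].
  - split=> [|a u v [Gu tu] [Gv tv]]; first by split; [|rewrite lie0r]; apply: subspace0.
    by split; [|rewrite lie_linearr]; case: (sbG i) => _; apply.
  - split; first exact: HG.
    rewrite (cartan_abelian (fdG j) (alG j) (@rdG j) (crG j)) //; first exact: subspace0.
    exact: (rr_Hmono rr ij).
  - by split; [exact: aG|rewrite (uw t Ht'); apply: subspaceZ => //; apply: aG].
(* A weight vector [v] of [Y] outside [H_ j] has a nonzero weight [be], which vanishes on [H_ i]. If
   the opposite root vector [f] also centralizes [G_ i], then [v] is Killing-orthogonal to [f],
   which is absurd. So it remains to prove [C0 f]. *)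
have YH : Y `<=` H_ j.
  apply: (cartan_weight_span (fdG j) (alG j) (@rdG j) (crG j) sY).
  - by move=> x [[]].
  - move=> t x Ht [Cx xP]; split; first exact: C0H.
    move=> z Cz; have [Gx _] := Cx; have [Gz _] := Cz; have Gt := HG Ht.
    rewrite lieC (killingNl (fdG j) (alG j)) //; last exact: lieG.
    by rewrite (killing_lie (fdG j) (alG j)) // xP ?oppr0 //; apply: C0H.
  - by case: (crG j) => -[].
  move=> v [[Gv vP] vK] vH; apply: contrapT => nHv.
  pose be t := xget 0 [set a | [lie t, v] = a *: v].
  have vw : weight_space (G_ j) (H_ j) be v.
    by split=> // t /vH ex; exact: (xgetPex 0 ex).
  have v0 : v <> 0 by move=> v0; apply: nHv; rewrite v0; apply: subspace0; case: (crG j) => -[].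
  have [[t Ht bet]|nex] := pselect (exists2 t, H_ j t & be t != 0); last first.
    apply: nHv; apply: (weight_zero (crG j) _ vw) => t Ht.
    by apply/eqP; apply: contra_notT nex => als; exists t.
  have [f [h tr]] := root_triple_exists (fdG j) (alG j) (@rdG j) (crG j) vw v0 Ht bet.
  have [_ [Gf fP] Hh efh _] := tr; have [ef _ _] := efh.
  have beHi u : H_ i u -> be u = 0.
    move=> Hu; have [_ /(_ u (rr_Hmono rr ij Hu))] := vw.
    rewrite vP; last exact: HG.
    by move/esym/eqP; rewrite scaler_eq0 => /orP[/eqP//|/eqP].
  have C0f : C0 f.
    split=> // u Gu; suff [] : [set u | G_ i u /\ [lie u, f] = 0] u by [].
    move: u Gu; apply: (rr_span rr) => [|u Hu|ga rga u uw].
    - split=> [|a u w [Gu uf] [Gw wf]]; first by split; [apply: subspace0|rewrite lie0l].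
      by split; [case: (sbG i) => _; apply|rewrite lie_linearl uf wf scaler0 addr0].
    - split; first exact: HG.
      by rewrite (fP u (rr_Hmono rr ij Hu)) beHi // oppr0 scale0r.
    have Gu : G_ i u by case: rga => _; apply.
    split=> //; have [->|u0] := pselect (u = 0); first by rewrite lie0l.
    have [f' [h' [tr' tri]]] := gtriple_exists rr rga uw u0.
    have [_ [Gf' _] Hh' efh' _] := tri.
    have [_ f'w _ _ _] := tr'.
    have [_ h'u _] := efh'.
    (* The vector [w] has weight 2 for the triple of [u], so its bracket with [f'] is nonzero;
       having weight [- be], it is a multiple of [f]. But [v] commutes with [f'], so by invariance
       this multiple is orthogonal to [v], hence zero. *)
    apply: contrapT => w0; set w := [lie u, f] in w0.
    have h'w : [lie h', w] = 2 *: w.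
      rewrite /w lie_derivation h'u (fP h' (rr_Hmono rr ij Hh')) beHi // oppr0.
      by rewrite scale0r lie0r addr0 lieZl.
    have Gw : G_ j w by apply: lieG => //; apply: Gij.
    have := sl2_lower_neq0 (fdG j) (alG j) efh' (Gij _ Gu) (Gij _ Gf') Gw w0 h'w (ltr0n _ 2).
    apply; have trN : root_triple (G_ j) (H_ j) (oppf be) f v (- h).
      split=> //; first by apply: weight_space_ext vw => t' _; rewrite /oppf opprK.
        by apply: subspaceN => //; case: (crG j) => -[].
        exact: sl2_tripleC.
      by move=> f0; apply: (root_triple_neq0 tr); rewrite -ef f0 lie0r.
    have fw : weight_space (G_ j) (H_ j) (oppf be) [lie f', w].
      apply: weight_space_ext (weight_lie (alG j) (gweight_at f'w (Gij _ Gf')) (weight_lie (alG j) (gweight_at uw (Gij _ Gu)) (conj Gf fP))) => t' _.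
      by rewrite /oppf addrA addNr add0r.
    have [c cE] := root_triple_dim1 (fdG j) (alG j) (@rdG j) (crG j) trN fw.
    have f'v : [lie f', v] = 0 by apply: vP.
    have : killing (G_ j) v [lie f', w] = 0.
      rewrite -killing_lie //; last exact: Gij.
      by rewrite lieC f'v oppr0 killing0l.
    rewrite cE killingC //; last exact: subspaceZ.
    rewrite killingZl // killingC // => /eqP.
    have := root_triple_killing_gt0 (fdG j) (alG j) (@rdG j) (crG j) tr.
    by rewrite mulf_eq0 => /lt0r_neq0/negbTE ->; rewrite orbF => /eqP ->; rewrite scale0r.
  have := root_triple_killing_gt0 (fdG j) (alG j) (@rdG j) (crG j) tr.
  by rewrite vK // ltxx.
have y0 x : G_ j x -> [lie y, x] = 0.
  move=> Gx; have [k kx] := ynil x Gx; rewrite -(scale0r x).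
  have yd := cartan_diag (fdG j) (alG j) (@rdG j) (crG j) (YH _ Yy).
  by apply: (diag_on_gen (fdG j) (adG Gy) yd Gx (k := k)); rewrite iter_shift0.
move=> W sW sWP; apply: dec => // a k x Gx kx; apply: (sWP a) => //.
have [<- _] := gen a k x Gx kx.
by apply/eqP; rewrite -subr_eq0 yE // y0.
Qed.

(** The ideal [J] generated by [z] contains a nonzero weight vector [v]. If its weight is nonzero,
    it spans a root space. Otherwise [v] lies in [H_ k] and is not central, so some root is nonzero
    at [v], and bracketing with [v] puts its root space into [J]. *)
Lemma root_in_ideal k z : lie_product (G_ k) (G_ k) z -> z <> 0 ->
  exists2 be, root_in k be & forall I, ideal (G_ k) I -> I z -> gweight be `<=` I.
Proof.
move=> Sz z0; have Gz := derived_sub (fdG k) (alG k) Sz.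
pose J := [set x | forall I, ideal (G_ k) I -> I z -> I x].
have JS : J `<=` lie_product (G_ k) (G_ k).
  by move=> x; apply => //; apply: ideal_derived.
have sJ : subspace J.
  split=> [I [sI _ _] _|a x y Jx Jy I iI Iz]; first exact: subspace0.
  by have [[_ sI] _ _] := iI; apply: sI; [apply: Jx|apply: Jy].
have JG : J `<=` G_ k by apply: subset_trans JS (derived_sub (fdG k) (alG k)).
have GJ u x : G_ k u -> J x -> J [lie u, x].
  by move=> Gu Jx I iI Iz; have [_ _ GI] := iI; apply: GI => //; apply: Jx.
have [v [Jv v0 vH]] : exists v, [/\ J v, v <> 0 &
    forall s, H_ k s -> exists a, [lie s, v] = a *: v].
  apply: contrapT => nex.
  have : J `<=` [set 0].
    apply: (cartan_weight_span (fdG k) (alG k) (@rdG k) (crG k) sJ JG).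
    - by move=> s u /HG; apply: GJ.
    - exact: subspace_set0.
    by move=> v Jv vH; apply: contrapT => v0; apply: nex; exists v.
  by move=> Jz; apply: z0; apply: Jz => I.
have Gv := JG _ Jv.
pose al t := xget 0 [set a | [lie t, v] = a *: v].
have vw : weight_space (G_ k) (H_ k) al v.
  by split=> // t /vH ex; exact: (xgetPex 0 ex).
have [[t Ht alt]|nex] := pselect (exists2 t, H_ k t & al t != 0).
  have [be [bew beal be0]] := weight_extend rr vw v0 Ht alt.
  have rbe : root_in k be.
    apply: (root_in_gen rr _ bew v0 Gv); split=> //; last by exists v.
    by exists t; [apply: splitting_H Ht|rewrite beal].
  exists be => // I iI Iz x xw; have [f [h [_ tr]]] := gtriple_exists rr rbe bew v0.
  have xk : weight_space (G_ k) (H_ k) be x by apply: gweight_at => //; case: rbe => _; apply.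
  have [a ->] := root_triple_dim1 (fdG k) (alG k) (@rdG k) (crG k) tr xk.
  by have [sI _ _] := iI; apply: subspaceZ => //; apply: Jv.
have Hv : H_ k v.
  apply: (weight_zero (crG k) _ vw) => t Ht.
  by apply/eqP; apply: contra_notT nex => als; exists t.
have [be rbe [x xw vx]] : exists2 be, root_in k be & exists2 x, gweight be x & [lie v, x] <> 0.
  apply: contrapT => nbe; apply: v0; apply: (center_derived_trivial (fdG k) (@rdG k)); last exact: JS.
  split=> // x Gx; suff [] : [set x | G_ k x /\ [lie v, x] = 0] x by [].
  move: x Gx; apply: (rr_span rr) => [|x Hx|be rbe x xw].
  - split=> [|a u w [Gu uf] [Gw wf]]; first by split; [apply: subspace0|rewrite lie0r].
    by split; [case: (sbG k) => _; apply|rewrite lie_linearr uf wf scaler0 addr0].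
  - by split; [apply: HG|apply: (cartan_abelian (fdG k) (alG k) (@rdG k) (crG k))].
  split; first by case: rbe => _; apply.
  by apply: contrapT => vx; apply: nbe; exists be => //; exists x.
exists be => // I iI Iz y yw; have Hv' := splitting_H Hv.
have bev : be v != 0 by apply/eqP => b0; apply: vx; rewrite (xw v Hv') b0 scale0r.
have [sI _ GI] := iI.
have -> : y = - (be v)^-1 *: [lie y, v].
  by rewrite lieC (yw v Hv') scalerN scaleNr opprK scalerA mulVf // scale1r.
apply: subspaceZ => //; apply: GI; first by case: rbe => _; apply.
exact: Jv.
Qed.

End Chain2.

(** * Pairings of roots with coroots *)

Section FiniteByValues.
Variables (T : Type) (X C : choiceType).

Lemma finite_by_values (A : set T) (L : seq X) (v : T -> X -> C) :
  (forall x, x \in L -> exists r : seq C, forall a, A a -> v a x \in r) ->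
  (forall a b, A a -> A b -> (forall x, x \in L -> v a x = v b x) -> a = b) ->
  finite_set A.
Proof.
elim: L A => [|x L IHL] A Ar Ainj.
  have [->|/set0P[a Aa]] := eqVneq A set0; first exact: finite_set0.
  by apply: (sub_finite_set (B := [set a])) => // b Ab; apply: Ainj.
have [r rP] := Ar x (mem_head _ _).
apply: (sub_finite_set (B := \bigcup_(c in [set` r]) [set a | A a /\ v a x = c])).
  by move=> a Aa; exists (v a x) => //=; apply: rP.
apply: bigcup_finite => [|c _]; first exact: finite_seq.
apply: IHL => [y Ly|a b [Aa ax] [Ab bx] ab].
  have [r' r'P] := Ar y (mem_behead (s := x :: L) Ly); exists r' => a [Aa _]; exact: r'P.
by apply: Ainj => // y; rewrite inE => /predU1P[->|/ab//]; rewrite ax bx.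
Qed.

Lemma infinite_injection (A : set T) n : infinite_set A ->
  exists f : nat -> T, (forall i, (i < n)%N -> A (f i)) /\
    forall i j, (i < j < n)%N -> f i <> f j.
Proof.
move=> infA; elim: n => [|n [f [Af injf]]].
  have /set0P[a Aa] : A != set0 by apply: contra_notN infA => /eqP ->; apply: finite_set0.
  by exists (fun=> a); split=> // i j; rewrite ltn0 andbF.
have [a [Aa na]] : exists a, A a /\ ~ (f @` `I_n) a.
  apply: contrapT => nex; apply: infA; apply: (sub_finite_set (B := f @` `I_n)).
    by move=> a Aa; apply: contrapT => na; apply: nex; exists a.
  exact/finite_image/finite_II.
exists (fun i => if i == n then a else f i); split=> [i|i j /andP[ij]].
  by rewrite ltnS leq_eqVlt; case: eqP => // _ /= /Af.
rewrite ltnS leq_eqVlt => /orP[/eqP jn|jn].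
  rewrite jn eqxx (ltn_eqF (leq_trans ij _)) ?jn // => fia; apply: na.
  by exists i => //=; rewrite -jn.
rewrite (ltn_eqF jn) (ltn_eqF (ltn_trans ij jn)); apply: injf.
by rewrite ij.
Qed.

End FiniteByValues.

(** * Coroots and their integral pairings *)

Section RootForm.
Variables (C : numClosedFieldType) (g : lieAlgType C) (G_ H_ : nat -> set g).
Hypothesis rr : root_reductive G_ H_.
Implicit Types (U W N : set g) (x y z v t : g) (al be ga : g -> C) (i j k l : nat).
Local Notation HH := (splitting H_).
Local Notation gweight := (gweight H_).
Local Notation root_in := (root_in G_ H_).
Local Notation root := (root H_).
Local Notation gtriple := (gtriple H_).
Let fdG i : finite_dimensional (G_ i) := rr_fd rr i.
Let alG i : subalgebra (G_ i) := rr_alg rr i.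
Let rdG i : reductive (G_ i) := rr_red rr i.
Let crG i : findim_cartan (G_ i) (H_ i) := rr_car rr i.
Let HG i : H_ i `<=` G_ i := @rr_HG _ _ _ _ rr i.

(* [0] when [al] is not a root. *)
Definition coroot al : g := xget 0 [set h | exists e f, gtriple al e f h].

Lemma coroot_ex al : root al -> exists e f, gtriple al e f (coroot al).
Proof.
move=> ral; have [i _ rin] := root_in_exists rr 0 ral.
have [_ _ [x xw x0]] := ral; have [f [h [tr _]]] := gtriple_exists rr rin xw x0.
by apply: (@xgetPex _ 0 [set h | exists e f, gtriple al e f h]); exists h, x, f.
Qed.

Lemma coroot_triple al i : root_in i al ->
  exists e f, root_triple (G_ i) (H_ i) al e f (coroot al).
Proof.
move=> rin; have [ral _] := rin; have [e [f tr]] := coroot_ex ral.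
by exists e, f; apply: gtriple_in.
Qed.

Lemma coroot_in al i : root_in i al -> H_ i (coroot al).
Proof. by move=> /coroot_triple[e [f [_ _]]]. Qed.

Lemma coroot_splitting al : root al -> HH (coroot al).
Proof. by move=> /coroot_ex[e [f []]]. Qed.

Lemma pairing_self al : root al -> al (coroot al) = 2.
Proof.
move=> ral; have [i _ rin] := root_in_exists rr 0 ral.
by have [e [f tr]] := coroot_triple rin; apply: root_triple_root tr.
Qed.

Lemma root_common al be k : root al -> root be ->
  exists2 i, (k <= i)%N & root_in i al /\ root_in i be.
Proof.
move=> ral rbe; have [i ki ia] := root_in_exists rr k ral.
have [j ij jb] := root_in_exists rr i rbe; exists j; first exact: leq_trans ij.
by split=> //; apply: root_in_mono ij ia.
Qed.

Lemma pairing_int al be : root al -> root be -> exists m : int, be (coroot al) = m%:~R.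
Proof.
move=> ral rbe; have [i _ [ia ib]] := root_common 0 ral rbe.
have [e [f [[Ge _] [Gf _] Hh efh _]]] := coroot_triple ia.
have [[_ _ [x xw x0]] bG] := ib.
apply: (sl2_integral (fdG i) (alG i) efh Ge Gf (bG _ xw) x0).
exact: (xw _ (splitting_H Hh)).
Qed.

(** The coroot does not depend on the triple: any two candidates represent multiples of [al] under
    the Killing form, and the normalization to 2 makes the multiples equal. *)
Lemma gtriple_coroot al x : root al -> gweight al x -> x <> 0 ->
  exists f, gtriple al x f (coroot al).
Proof.
move=> ral xw x0; have [i _ rin] := root_in_exists rr 0 ral.
have [f [h [tr tri]]] := gtriple_exists rr rin xw x0.
have [e' [f' tr']] := coroot_ex ral; have tri' := gtriple_in rr rin tr'.
exists f; suff <- : h = coroot al by [].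
have [_ _ _ [ef _ _] _] := tri; have [_ _ _ [ef' _ _] _] := tri'.
have [a e'E] := root_triple_dim1 (fdG i) (alG i) (@rdG i) (crG i) tri (let: And5 e'w _ _ _ _ := tri' in e'w).
have [_ kf] := weight_bracket (fdG i) (alG i) (crG i) (let: And5 e'w _ _ _ _ := tri in e'w) (let: And5 _ f'w _ _ _ := tri' in f'w).
have kcE t : H_ i t -> killing (G_ i) (coroot al) t = al t * (a * killing (G_ i) x f').
  move=> Ht; rewrite -ef' e'E lieZl killingZl ?kf //; first by rewrite mulrCA.
    apply: (rr_lie rr) => //; first by have [_ aG] := rin; apply: aG.
    by have [_ [Gf' _] _ _ _] := tri'.
  exact: HG.
have khE t : H_ i t -> killing (G_ i) h t = al t * killing (G_ i) x f := root_triple_killing (fdG i) (alG i) (crG i) tri.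
have al2 := root_triple_root tri; have al2' := root_triple_root tri'.
have [_ _ Hh _ _] := tri; have Hc := coroot_in rin.
have two0 : (2 : C) != 0 by rewrite pnatr_eq0.
have cE : a * killing (G_ i) x f' = killing (G_ i) x f.
  apply: (mulfI two0); have := khE _ Hc; rewrite al2' => <-.
  by have := kcE _ Hh; rewrite al2 => <-; apply: (killingC (fdG i) (alG i)); apply: HG.
apply/eqP; rewrite -subr_eq0; apply/eqP.
apply: (cartan_killing_nondegenerate (fdG i) (alG i) (@rdG i) (crG i)).
- by apply: subspaceB => //; case: (crG i) => -[].
- apply: (subspaceB (subspace_lie_product _ _)); first exact: root_triple_derived tri.
  exact: root_triple_derived tri'.
by move=> t Ht; rewrite killingBl ?khE ?kcE ?cE ?subrr //; apply: HG.
Qed.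

Lemma raise_neq0 al be e x : root al -> gweight al e -> e <> 0 ->
  gweight be x -> x <> 0 -> be (coroot al) < 0 -> [lie e, x] <> 0.
Proof.
move=> ral ew e0 xw x0 neg; have [f [_ fw Hh efh _]] := gtriple_coroot ral ew e0.
have [i _ ia] := root_in_exists rr 0 ral; have [l il Gx] := rr_cover_from rr i x.
have la := root_in_mono rr il ia.
have [f' tr'] := gtriple_coroot ral ew e0.
have [[Ge _] [Gf _] Hh' efh' _] := gtriple_in rr la tr'.
by apply: (sl2_raise_neq0 (fdG l) (alG l) efh' Ge Gf Gx x0 _ neg); apply: xw.
Qed.

(* The factor between [al] and its coroot under the Killing form of [G_ l]. *)
Definition kcoef l al := killing (G_ l) (coroot al) (coroot al) / 2.

Lemma kcoefP l al : root_in l al -> 0 < kcoef l al /\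
  forall t, H_ l t -> killing (G_ l) (coroot al) t = kcoef l al * al t.
Proof.
move=> la; have [e [f tr]] := coroot_triple la.
have khE t : H_ l t -> killing (G_ l) (coroot al) t = al t * killing (G_ l) e f := root_triple_killing (fdG l) (alG l) (crG l) tr.
have cE : kcoef l al = killing (G_ l) e f.
  rewrite /kcoef khE; last exact: coroot_in la.
  by rewrite (root_triple_root tr) mulrAC divff ?mul1r // pnatr_eq0.
split=> [|t Ht]; last by rewrite cE khE // mulrC.
by rewrite cE; apply: root_triple_killing_gt0 tr.
Qed.

Lemma coroot_real l al : root_in l al -> real_cartan (G_ l) (H_ l) (coroot al).
Proof. by move=> la; have [e [f tr]] := coroot_triple la; apply: real_cartan_coroot tr. Qed.

End RootForm.

(** * Euclidean geometry of roots *)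

Section RootCombinatorics.
Variables (C : numClosedFieldType) (g : lieAlgType C) (G_ H_ : nat -> set g).
Hypothesis rr : root_reductive G_ H_.
Implicit Types (U W N : set g) (x y z v t : g) (al be ga th : g -> C) (i j k l : nat).
Local Notation HH := (splitting H_).
Local Notation gweight := (gweight H_).
Local Notation root_in := (root_in G_ H_).
Local Notation root := (root H_).
Local Notation gtriple := (gtriple H_).
Local Notation coroot := (coroot H_).
Local Notation kcoef := (kcoef G_ H_).
Let fdG i : finite_dimensional (G_ i) := rr_fd rr i.
Let alG i : subalgebra (G_ i) := rr_alg rr i.
Let rdG i : reductive (G_ i) := rr_red rr i.
Let crG i : findim_cartan (G_ i) (H_ i) := rr_car rr i.
Let HG i : H_ i `<=` G_ i := @rr_HG _ _ _ _ rr i.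

Lemma root_lin al a s t : root al -> HH s -> HH t -> HH (a *: s + t) ->
  al (a *: s + t) = a * al s + al t.
Proof.
move=> [_ _ [x xw /eqP/negPf x0]] Hs Ht Hst; have := xw _ Hst.
rewrite lie_linearl (xw _ Hs) (xw _ Ht) scalerA -scalerDl => /esym/eqP.
by rewrite -subr_eq0 -scalerBl scaler_eq0 x0 orbF subr_eq0 => /eqP.
Qed.

Lemma root_ext l al be : root_in l al -> root_in l be ->
  (forall t, H_ l t -> al t = be t) -> al = be.
Proof.
move=> ra rb ab; have [[al0 _ [x xw x0]] _] := ra.
have [[be0 _ [y yw /eqP/negPf y0]] bG] := rb.
have [f [h [_ tr]]] := gtriple_exists rr ra xw x0.
have [c yE] : exists c, y = c *: x.
  apply: (root_triple_dim1 (fdG l) (alG l) (@rdG l) (crG l) tr).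
  by have [Gy yP] := gweight_at yw (bG y yw); split=> // s Hs; rewrite yP // ab.
apply/funext => s; have [Hs|nHs] := pselect (HH s); last by rewrite al0 // be0.
have := yw s Hs; rewrite yE lieZr (xw s Hs) scalerA mulrC -scalerA -yE => /eqP.
by rewrite -subr_eq0 -scalerBl scaler_eq0 y0 orbF subr_eq0 => /eqP.
Qed.

Lemma pairingC l al be : root_in l al -> root_in l be ->
  kcoef l al * al (coroot be) = kcoef l be * be (coroot al).
Proof.
move=> ra rb; have [_ <-] := kcoefP rr ra; last exact: coroot_in rb.
have [_ <-] := kcoefP rr rb; last exact: coroot_in ra.
by apply: killingC => //; apply: HG; [apply: coroot_in ra|apply: coroot_in rb].
Qed.

Lemma adjacentC al be : root al -> root be -> al (coroot be) = 0 -> be (coroot al) = 0.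
Proof.
move=> ral rbe; have [l _ [ra rb]] := root_common rr 0 ral rbe.
have [cb _] := kcoefP rr rb; have := pairingC ra rb => + ab0.
rewrite ab0 mulr0 => /esym/eqP; rewrite mulf_eq0 (gt_eqF cb) => /eqP //.
Qed.

(** The form dual to the Killing form of [G_ l]: when [v] represents [al] and [w] represents [be],
    [al v] is the squared norm of [al] and [al w] is the inner product of [al] and [be]. The squared
    norm of a root is [2 / kcoef]. *)
Definition rep l al v := real_cartan (G_ l) (H_ l) v /\
  forall t, H_ l t -> killing (G_ l) v t = al t.

Lemma rep_root l al : root_in l al -> rep l al ((kcoef l al)^-1 *: coroot al).
Proof.
move=> ra; have [c0 cP] := kcoefP rr ra; have Hc := coroot_in rr ra; split=> [|t Ht].
  have := real_cartanP (fdG l) (alG l) (@rdG l) (crG l) _ (coroot_real rr ra) (coroot_real rr ra).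
  move=> /(_ ((kcoef l al)^-1 - 1)); rewrite scalerBl scale1r subrK; apply.
  by rewrite realB // realV gtr0_real.
rewrite (killingZl (fdG l) (alG l)); try by apply: HG.
by rewrite cP // mulKf // gt_eqF.
Qed.

Lemma rep_lin l r al be v w : r \is Num.real -> rep l al v -> rep l be w ->
  rep l (fun t => r * al t + be t) (r *: v + w).
Proof.
move=> rR [vR vP] [wR wP]; split=> [|t Ht]; first exact: (real_cartanP _ _ _ (crG l)).
by have [Hv _ _] := vR; have [Hw _ _] := wR; rewrite killingPl ?vP ?wP //; apply: HG.
Qed.

Lemma rep_sym l al be v w : rep l al v -> rep l be w -> al w = be v.
Proof.
move=> [[Hv _ _] vP] [[Hw _ _] wP]; rewrite -vP // -wP //.
by apply: killingC => //; apply: HG.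
Qed.

Lemma rep_ge0 l al v : rep l al v -> 0 <= al v /\
  (al v = 0 -> forall t, H_ l t -> al t = 0).
Proof.
move=> [vR vP]; have [Hv _ _] := vR.
have [ge0 eq0] := real_cartan_killing (fdG l) (alG l) (@rdG l) (crG l) vR.
rewrite -(vP v Hv); split=> // /eq0 v0 t Ht; rewrite -vP // v0.
by apply: killing0l => //; apply: HG.
Qed.

Lemma rep_norm l r al be v w : r \is Num.real -> rep l al v -> rep l be w ->
  r * al (r *: v + w) + be (r *: v + w) = r ^+ 2 * al v + 2 * r * al w + be w.
Proof.
move=> rR av bw; have [_ /(_ (r *: v + w)) <-] := rep_lin rR av bw; last first.
  by have [[]] := rep_lin rR av bw.
have [[Hv _ _] vP] := av; have [[Hw _ _] wP] := bw; have [[Hs _ _] _] := rep_lin rR av bw.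
have kC x y : H_ l x -> H_ l y -> killing (G_ l) x y = killing (G_ l) y x.
  by move=> Hx Hy; apply: (killingC (fdG l) (alG l)); apply: HG.
rewrite killingPl; try by [|apply: HG].
rewrite kC // [X in _ + X]kC // !killingPl; try by [|apply: HG].
by rewrite !(vP, wP) // (rep_sym bw av); ring.
Qed.

Lemma rep_norm_ge0 l r al be v w : r \is Num.real -> rep l al v -> rep l be w ->
  0 <= r ^+ 2 * al v + 2 * r * al w + be w.
Proof.
move=> rR av bw; rewrite -(rep_norm rR av bw).
by have [] := rep_ge0 (rep_lin rR av bw).
Qed.

Lemma rep_rootE l al be : root_in l al -> root be ->
  be ((kcoef l al)^-1 *: coroot al) = be (coroot al) / kcoef l al.
Proof.
move=> ra rb; have Hc := coroot_in rr ra; have sH : subspace (H_ l) by case: (crG l) => [[]].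
have H0 : H_ l 0 by case: sH.
rewrite -[_ *: _]addr0 root_lin //; first last.
- by exists l => //; rewrite addr0; apply: subspaceZ.
- by exists l.
- by exists l.
have -> : be 0 = 0.
  have := root_lin (a := 1) rb (splitting_H H0) (splitting_H H0).
  rewrite scale1r addr0 mul1r => /(_ (splitting_H H0)) /eqP.
  by rewrite -subr_eq0 opprD addNKr oppr_eq0 => /eqP.
by rewrite addr0 mulrC.
Qed.

(** The component of [be] orthogonal to [al] has squared norm at least 0, which bounds the product
    [m * n] of the two integral pairings by 4. The bound is the same at every level. *)
Lemma pairing_bounded : exists r : seq C, forall al be, root al -> root be -> be (coroot al) \in r.
Proof.
exists (map (fun i : int => i%:~R) [:: -4; -3; -2; -1; 0; 1; 2; 3; 4]) => al be ral rbe.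
have [l _ [ra rb]] := root_common rr 0 ral rbe.
have [m mE] := pairing_int rr ral rbe; have [n nE] := pairing_int rr rbe ral.
have [ca _] := kcoefP rr ra; have [cb _] := kcoefP rr rb.
have eqc := pairingC ra rb; rewrite mE nE in eqc.
suff mn : m * n <= 4.
  rewrite mE; apply: map_f; have [m0|m0] := eqVneq m 0; first by rewrite m0.
  have n0 : n != 0.
    apply: contraNneq m0 => n0; move/eqP: eqc; rewrite n0 mulr0 eq_sym mulf_eq0.
    by rewrite (gt_eqF cb) intr_eq0.
  have mn0 : 0 < m * n.
    rewrite -(ltr0z C) intrM -(pmulr_rgt0 _ cb) mulrA -eqc mulrAC -mulrA mulr_gt0 //.
    by rewrite -expr2 real_exprn_even_gt0 ?realz //= intr_eq0.
  rewrite !inE; nia.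
have rR : - (m%:~R / 2) \is @Num.real C by rewrite realN realM ?realV ?realz // realn.
have := rep_norm_ge0 rR (rep_root ra) (rep_root rb).
rewrite !rep_rootE // !(pairing_self rr) // nE.
have E : n%:~R / kcoef l be = m%:~R / kcoef l al.
  by apply/eqP; rewrite eqr_div ?(gt_eqF ca) ?(gt_eqF cb) // mulrC eqc mulrC.
have -> : (- (m%:~R / 2)) ^+ 2 * (2 / kcoef l al) + 2 * - (m%:~R / 2) * (n%:~R / kcoef l be) +
    2 / kcoef l be = (4 - (m * n)%:~R) / 2 / kcoef l be.
  have -> : (- (m%:~R / 2)) ^+ 2 * (2 / kcoef l al) = m%:~R * (n%:~R / kcoef l be) / 2.
    by rewrite E; field; rewrite (gt_eqF ca).
  by rewrite intrM; field; rewrite (gt_eqF cb).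
rewrite pmulr_lge0 ?invr_gt0 // pmulr_lge0 ?invr_gt0 ?ltr0n // subr_ge0.
by rewrite -[4]/(4%:~R) ler_int.
Qed.

(* Otherwise the component orthogonal to [al] of the sum of the five roots would
   have negative norm. *)
Lemma five_roots l al (th : nat -> g -> C) (d d' : C) : root_in l al ->
  (forall i, (i < 5)%N -> [/\ root_in l (th i), th i (coroot al) = d & al (coroot (th i)) = d']) ->
  d != 0 -> exists i j, (i < j < 5)%N /\ 0 < th i (coroot (th j)).
Proof.
move=> ra thP d0; apply: contrapT => nex.
have [ral _] := ra; have [ca _] := kcoefP rr ra.
have [m dE] : exists m : int, d = m%:~R.
  by have [[rt _] <- _] := thP 0%N isT; apply: (pairing_int rr).
have [n d'E] : exists n : int, d' = n%:~R.
  by have [[rt _] _ <-] := thP 0%N isT; apply: (pairing_int rr).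
pose c := kcoef l (th 0%N).
have c0 : 0 < c by have [rt _ _] := thP 0%N isT; have [] := kcoefP rr rt.
have cE i : (i < 5)%N -> kcoef l (th i) = c.
  move=> i5; apply: (mulIf d0); have [rt <- _] := thP i i5.
  rewrite pairingC //; have [r0 e0 e1] := thP 0%N isT; have [_ e2 e3] := thP i i5.
  by rewrite e3 e2 -e0 /c pairingC // e1.
have cd : c * d = kcoef l al * d'.
  by have [r0 <- <-] := thP 0%N isT; rewrite /c pairingC.
have rthE i be : (i < 5)%N -> root be -> be (c^-1 *: coroot (th i)) = be (coroot (th i)) / c.
  by move=> i5 rb; have [rt _ _] := thP i i5; rewrite -(cE i i5) rep_rootE.
have repth i : (i < 5)%N -> rep l (th i) (c^-1 *: coroot (th i)).
  by move=> i5; have [rt _ _] := thP i i5; rewrite -(cE i i5); apply: rep_root.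
have nonpos i j : (i < j < 5)%N -> th i (coroot (th j)) <= 0.
  move=> ij5; have /andP[ij j5] := ij5; have [[ri _] _ _] := thP i (ltn_trans ij j5).
  have [[rj _] _ _] := thP j j5.
  rewrite real_leNgt ?real0 //; last by have [q ->] := pairing_int rr rj ri; apply: realz.
  by apply/negP => gt0; apply: nex; exists i, j.
pose va := (kcoef l al)^-1 *: coroot al.
(* The functional [f] is the sum of the roots [th 0], ..., [th p]. Its squared norm is at most the
   sum of theirs because all mixed products are nonpositive. *)
have step p : (p < 5)%N -> exists f v, [/\ rep l f v, f v <= (2 * p.+1)%:R / c,
    f va = p.+1%:R * d / kcoef l al &
    forall j, (p < j < 5)%N -> f (c^-1 *: coroot (th j)) <= 0].
  elim: p => [|p IHp] p5.
    have [rt e0 _] := thP 0%N isT; have [rt0 _] := rt.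
    exists (th 0%N), (c^-1 *: coroot (th 0%N)); split; first exact: repth.
    - by rewrite rthE // (pairing_self rr).
    - by rewrite /va rep_rootE // e0 mul1r.
    move=> j j5; have /andP[_ j5'] := j5; rewrite rthE // pmulr_lle0 ?invr_gt0 //.
    exact: nonpos.
  have [f [v [fv fv_le fva fj]]] := IHp (ltnW p5); have [rt e0 _] := thP _ p5; have [rt0 _] := rt.
  exists (fun t => 1 * f t + th p.+1 t), (1 *: v + c^-1 *: coroot (th p.+1)); split.
  - exact: rep_lin (real1 _) fv (repth _ p5).
  - rewrite (rep_norm (real1 _) fv (repth _ p5)).
    rewrite expr1n mul1r mulr1 (rthE _ (th p.+1)) // (pairing_self rr) //.
    rewrite -[leLHS]addrA [_ * _ + _]addrC addrA.
    have -> : (2 * p.+2)%:R / c = (2 * p.+1)%:R / c + 2 / c :> C.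
      by rewrite -mulrDl -natrD; congr (_%:R / _); lia.
    rewrite -[leRHS]addr0; apply: lerD; first by apply: lerD.
    by rewrite pmulr_rle0 ?ltr0n // fj // leqnn.
  - by rewrite mul1r fva /va rep_rootE // e0 -mulrDl -[p.+2]addn1 natrD [in RHS]mulrDl mul1r.
  move=> j /andP[pj j5]; rewrite mul1r (rthE _ (th p.+1)) // -[leRHS]addr0; apply: lerD.
    by apply: fj; rewrite j5 andbT ltnW.
  by rewrite pmulr_lle0 ?invr_gt0 // nonpos // pj.
have [f [v [fv fv_le fva _]]] := step 4%N isT.
(* This coefficient removes the projection on [al]. For [q] roots the bound on the remaining squared
   norm is [(4 q - q ^ 2 d d') / (2 c)], where [d d'] is a positive integer; five is the least [q]
   that makes it negative in all cases. *)
have rR : - (5%:R * d / 2) \is Num.real.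
  by rewrite realN realM ?realV ?realn // realM ?realn // dE realz.
have := rep_norm_ge0 rR (rep_root ra) fv.
rewrite (rep_sym (rep_root ra) fv) fva rep_rootE // (pairing_self rr) // => ge0.
have : 0 <= (- (5%:R * d / 2)) ^+ 2 * (2 / kcoef l al) + 2 * - (5%:R * d / 2) * (5%:R * d / kcoef l al) + 10%:R / c.
  by apply: le_trans ge0 _; rewrite lerD2l.
have -> : (- (5%:R * d / 2)) ^+ 2 * (2 / kcoef l al) + 2 * - (5%:R * d / 2) * (5%:R * d / kcoef l al) + 10%:R / c
   = (20%:R - 25%:R * d * d') / 2 / c.
  have -> : d' = c * d / kcoef l al by rewrite cd mulrAC divff ?mul1r // gt_eqF.
  by field; rewrite (gt_eqF ca) (gt_eqF c0).
rewrite pmulr_lge0 ?invr_gt0 // pmulr_lge0 ?invr_gt0 ?ltr0n // dE d'E.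
have dd' : 0 < m * n.
  rewrite -(ltr0z C) intrM -dE -d'E -(pmulr_rgt0 _ ca) mulrCA -cd mulrCA mulr_gt0 //.
  by rewrite -expr2 dE real_exprn_even_gt0 ?realz //= -dE.
rewrite -mulrA -intrM -[25%:R]/(25%:~R) -intrM -[20%:R]/(20%:~R) -intrB ler0z; lia.
Qed.

Lemma kcoef_eq l al be ga : root_in l al -> root_in l be -> root_in l ga ->
  be (coroot al) = ga (coroot al) -> al (coroot be) = al (coroot ga) -> be (coroot al) != 0 ->
  kcoef l be = kcoef l ga.
Proof.
move=> ra rb rc e e' n0; apply: (mulIf n0); rewrite pairingC // e' [in RHS]e.
by rewrite -pairingC.
Qed.

(** For roots of equal length, the squared norm of [be - al] is [2 * (2 - m) / kcoef l be]. *)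
Lemma pairing_le2 l al be : root_in l al -> root_in l be -> kcoef l al = kcoef l be ->
  exists m : int, [/\ be (coroot al) = m%:~R, m <= 2 & m = 2 -> al = be].
Proof.
move=> ra rb cE; have [ral _] := ra; have [rbe _] := rb.
have [m mE] := pairing_int rr ral rbe; have [cb _] := kcoefP rr rb.
have abE : al (coroot be) = m%:~R.
  by rewrite -mE; apply: (mulfI (_ : kcoef l be != 0)); rewrite ?gt_eqF // -{1}cE pairingC.
have N1 : (-1 : C) \is Num.real by rewrite realN real1.
have nE : -1 * al (-1 *: ((kcoef l al)^-1 *: coroot al) + (kcoef l be)^-1 *: coroot be)
    + be (-1 *: ((kcoef l al)^-1 *: coroot al) + (kcoef l be)^-1 *: coroot be)
    = 2 * (2 - m)%:~R / kcoef l be.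
  rewrite (rep_norm N1 (rep_root ra) (rep_root rb)) !rep_rootE // !(pairing_self rr) // abE cE.
  by rewrite intrB; ring.
have [ge0 eq0] := rep_ge0 (rep_lin N1 (rep_root ra) (rep_root rb)).
exists m; split=> // [|m2].
  by move: ge0; rewrite nE pmulr_lge0 ?invr_gt0 // pmulr_rge0 ?ltr0n // ler0z; lia.
apply: (root_ext ra rb) => t Ht; apply/esym/eqP; rewrite -subr_eq0 addrC -mulN1r.
by apply/eqP; apply: eq0 => //; rewrite nE m2 subrr mulr0 mul0r.
Qed.

Lemma pairing_sum l al be ga : root_in l al -> root_in l be -> root_in l ga ->
  kcoef l al = kcoef l be -> kcoef l al = kcoef l ga ->
  2 < be (coroot al) + ga (coroot al) -> al = be \/ al = ga.
Proof.
move=> ra rb rc eb ec; have [m [-> mle m2]] := pairing_le2 ra rb eb.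
have [n [-> nle n2]] := pairing_le2 ra rc ec.
rewrite -intrD -[2]/(2%:~R) ltr_int => mn.
have [/m2 ->|m2'] := eqVneq m 2; first by left.
by right; apply: n2; lia.
Qed.

Lemma subspace_splitting : subspace HH.
Proof.
have sH i : subspace (H_ i) by case: (crG i) => [[]].
split=> [|a x y [i _ Hx] [j _ Hy]]; first by exists 0%N => //; case: (sH 0%N).
exists (maxn i j) => //; have [_] := sH (maxn i j); apply.
  exact: (rr_Hmono rr (leq_maxl i j) Hx).
exact: (rr_Hmono rr (leq_maxr i j) Hy).
Qed.

Lemma root_bracket al be x y : root al -> root be -> gweight al x -> gweight be y ->
  [lie x, y] <> 0 -> al + be <> 0 -> root (al + be).
Proof.
move=> [al0 _ _] [be0 _ _] xw yw xy0 ab0; split.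
- by move=> t nt; rewrite addrfctE al0 // be0 // addr0.
- apply: contrapT => nex; apply: ab0; apply/funext => t.
  have [Ht|nHt] := pselect (HH t); last by rewrite addrfctE al0 // be0 // addr0.
  by apply/eqP; apply: contra_notT nex => ?; exists t.
by exists [lie x, y] => //; apply: gweight_lie.
Qed.

Lemma root_add al be : root al -> root be -> be (coroot al) < 0 -> al + be <> 0 -> root (al + be).
Proof.
move=> ral rbe neg; have [_ _ [x xw x0]] := ral; have [_ _ [y yw y0]] := rbe.
by apply: (root_bracket ral rbe xw yw) => //; apply: (raise_neq0 rr ral xw x0 yw y0).
Qed.

Lemma finite_root_in l : finite_set [set al | root_in l al].
Proof.
have [s [sH Hs]] := finite_spanning_subset (fdG l) (@HG l).
apply: (@finite_by_values _ _ _ _ s (fun al t => al t)) => [t ts|al be ra rb ab].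
  have Ht := sH t ts.
  have [r rP] := eigenvalues_finite (fdG l) (operator_lie (alG l) (HG Ht)).
  exists r => al [[_ _ [x xw x0]] aG]; apply: rP (aG x xw) x0 _.
  exact/xw/(splitting_H Ht).
apply: (root_ext ra rb) => t Ht.
have sHH := subspace_splitting; have [ral _] := ra; have [rbe _] := rb.
suff [] : [set t | HH t /\ al t = be t] t by [].
apply: (Hs t Ht); split=> [|u us]; last by split; [apply/splitting_H/sH|apply: ab].
have lin0 ga : root ga -> ga 0 = 0.
  move=> rga; have H0 : HH 0 by case: sHH.
  have := root_lin (a := 1) rga H0 H0; rewrite scale1r addr0 mul1r => /(_ H0) /eqP.
  by rewrite -subr_eq0 opprD addNKr oppr_eq0 => /eqP.
split=> [|a u w [Hu u1] [Hw w1]]; first by split; [case: sHH|rewrite !lin0].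
have Huw : HH (a *: u + w) by case: sHH => _; apply.
by split=> //; rewrite !root_lin // u1 w1.
Qed.

Inductive root_lattice j : (g -> C) -> Prop :=
| root_lattice0 : root_lattice j 0
| root_latticeD al la : root_in j al -> root_lattice j la -> root_lattice j (al + la).

Lemma root_lattice_lin j la : root_lattice j la ->
  (forall t, ~ HH t -> la t = 0) /\
  forall a s t, HH s -> HH t -> la (a *: s + t) = a * la s + la t.
Proof.
elim=> [|al mu [ral aG] _ [mu0 mul]].
  by split=> // *; rewrite mulr0 addr0.
have [al0 _ _] := ral.
split=> [t nt|a s t Hs Ht]; first by rewrite addrfctE al0 // mu0 // addr0.
rewrite addrfctE mul // root_lin //; first by ring.
by have [_] := subspace_splitting; apply.
Qed.

(** The last clause says, in the form needed below, that [v] is a combination of coroots of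
    [G_ j]. *)
Lemma root_lattice_rep j l la : (j <= l)%N -> root_lattice j la ->
  exists2 v, rep l la v & forall mu, root_lattice j mu ->
    (forall de, root_in j de -> mu (coroot de) = 0) -> mu v = 0.
Proof.
move=> jl; elim=> [|al la' ja _ [v lv vP]].
  have H0 : H_ l 0 by case: (crG l) => [[[]]].
  exists 0 => [|mu mul _].
    split=> [|t Ht]; last by rewrite killing0l //; apply: HG.
    split=> //; first by case: (subspace_lie_product (G_ l) (G_ l)).
    move=> a u Gu u0; rewrite lie0l => /esym/eqP; rewrite scaler_eq0.
    by move=> /orP[/eqP ->|/eqP//]; apply: real0.
  have [_ mlin] := root_lattice_lin mul; have HH0 := splitting_H H0.
  have := mlin 1 _ _ HH0 HH0; rewrite scale1r addr0 mul1r => /eqP.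
  by rewrite -subr_eq0 opprD addNKr oppr_eq0 => /eqP.
have la_ := root_in_mono rr jl ja; have [c0 _] := kcoefP rr la_.
exists (1 *: ((kcoef l al)^-1 *: coroot al) + v) => [|mu mul mu0].
  have := rep_lin (real1 _) (rep_root la_) lv.
  by congr (rep _ _ _); apply/funext => t; rewrite mul1r addrfctE.
have [_ mlin] := root_lattice_lin mul; have [[Hv _ _] _] := lv.
have Hc := splitting_H (coroot_in rr ja).
rewrite scale1r mlin //; last exact: splitting_H Hv.
by rewrite mu0 // mulr0 add0r; apply: vP.
Qed.

(** At each level [la] is represented by a combination of coroots of [G_ j], on which it vanishes;
    its squared norm is therefore zero. *)
Lemma root_lattice_eq0 j la : root_lattice j la ->
  (forall de, root_in j de -> la (coroot de) = 0) -> la = 0.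
Proof.
move=> lj la0; have [out _] := root_lattice_lin lj; apply/funext => t.
have [Ht|nHt] := pselect (HH t); last exact: out.
have [l jl Hlt] := splitting_from rr j Ht.
have [v lv vP] := root_lattice_rep jl lj.
by have [_ eq0] := rep_ge0 lv; apply: eq0 => //; apply: vP.
Qed.

Lemma root_latticeB j la mu : root_lattice j la -> root_lattice j mu -> root_lattice j (la - mu).
Proof.
move=> + mj; elim=> [|al la' ja _ IH]; last by rewrite -addrA; apply: root_latticeD.
elim: mj => [|al mu' ja _ IH]; first by rewrite subr0; apply: root_lattice0.
rewrite opprD addrCA; apply: root_latticeD; last exact: IH. exact: (root_opp rr ja).
Qed.

End RootCombinatorics.

(** * Modules moved by a given root *)

Section WeightSpans.
Variables (C : numClosedFieldType) (g : lieAlgType C) (G_ H_ : nat -> set g).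
Hypothesis rr : root_reductive G_ H_.
Implicit Types (U V W : set g) (x y z u v t : g) (al be ga de : g -> C) (i j k l m : nat).
Implicit Type Ga : set (g -> C).
Local Notation gweight := (gweight H_).
Local Notation root_in := (root_in G_ H_).
Local Notation root := (root H_).
Local Notation gtriple := (gtriple H_).
Local Notation coroot := (coroot H_).
Let fdG i : finite_dimensional (G_ i) := rr_fd rr i.
Let alG i : subalgebra (G_ i) := rr_alg rr i.
Let rdG i : reductive (G_ i) := rr_red rr i.
Let crG i : findim_cartan (G_ i) (H_ i) := rr_car rr i.
Let sbG i : subspace (G_ i) := rr_sub rr i.
Let HG i : H_ i `<=` G_ i := @rr_HG _ _ _ _ rr i.

Lemma gweight0_in l x : gweight 0 x -> G_ l x -> H_ l x.
Proof. by move=> xw Gx; apply: (weight_zero (crG l) (al := 0)) => //; apply: gweight_at. Qed.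

Lemma gweight_derived l al : root_in l al -> gweight al `<=` lie_product (G_ l) (G_ l).
Proof.
move=> ra x xw; have [ral aG] := ra; have Hc := coroot_in rr ra.
have -> : x = 2^-1 *: [lie coroot al, x].
  by rewrite (xw _ (splitting_H Hc)) (pairing_self rr) // scalerK // pnatr_eq0.
apply: (@subspaceZ _ _ _ (2^-1) _ (subspace_lie_product (G_ l) (G_ l))).
by apply: lie_product_lie; [apply: HG|apply: aG].
Qed.

Definition weight_span Ga := smallest (@subspace C g) [set x | exists2 ga, Ga ga & gweight ga x].

Lemma weight_span_ind Ga W : subspace W -> (forall ga, Ga ga -> gweight ga `<=` W) ->
  weight_span Ga `<=` W.
Proof. by move=> sW GW u /(_ W); apply; split=> // x [ga /GW]; apply. Qed.

Lemma weight_span_mem Ga ga x : Ga ga -> gweight ga x -> weight_span Ga x.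
Proof. by move=> Gg xw A [_]; apply; exists ga. Qed.

Lemma subspace_weight_span Ga : subspace (weight_span Ga).
Proof. exact: subspace_smallest. Qed.
Hint Resolve subspace_weight_span : core.

Lemma subspace_lie_in V W : subspace V -> subspace [set x | forall u, W u -> V [lie x, u]].
Proof.
move=> sV; split=> [u _|a x y xP yP u Wu]; first by rewrite lie0l; case: sV.
by rewrite lie_linearl; case: sV => _; apply; [apply: xP|apply: yP].
Qed.

Lemma subspace_lie_inr V x : subspace V -> subspace [set u | V [lie x, u]].
Proof.
move=> sV; split=> [|a u v uP vP]; first by rewrite /= lie0r; case: sV.
by rewrite /= lie_linearr; case: sV => _; apply.
Qed.

Lemma gweight_bracket_mem al be Ga x y : root al -> root be -> al + be <> 0 ->
  (root (al + be) -> Ga (al + be)) -> gweight al x -> gweight be y ->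
  weight_span Ga [lie x, y].
Proof.
move=> ral rbe ab0 ab xw yw; have [->|xy0] := pselect ([lie x, y] = 0).
  exact: subspace0 (subspace_weight_span Ga).
apply: weight_span_mem (ab _) (gweight_lie xw yw).
exact: root_bracket ral rbe xw yw xy0 ab0.
Qed.

(** Excluding [de + ga = 0] keeps brackets out of the Cartan subalgebra, so that the root spaces
    alone span a [G_ j]-module. *)
Definition closed_under j Ga := forall ga de, Ga ga -> root_in j de ->
  de + ga <> 0 /\ (root (de + ga) -> Ga (de + ga)).

Lemma weight_span_stable j Ga x u : Ga `<=` [set al | root al] -> closed_under j Ga ->
  G_ j x -> weight_span Ga u -> weight_span Ga [lie x, u].
Proof.
move=> rGa cl Gx; move: u; change ([set x | forall u, weight_span Ga u -> weight_span Ga [lie x, u]] x).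
move: x Gx; apply: (rr_span rr); first exact: subspace_lie_in.
- move=> t Ht u; move: u; apply: weight_span_ind; first exact: subspace_lie_inr.
  move=> ga Gg u uw /=; rewrite (uw _ (splitting_H Ht)).
  exact: (@subspaceZ _ _ _ (ga t) _ (subspace_weight_span Ga) (weight_span_mem Gg uw)).
move=> de dj x xw; apply: weight_span_ind; first exact: subspace_lie_inr.
move=> ga Gg u uw /=; have [dg0 dg] := cl ga de Gg dj; have [rde _] := dj.
exact: (gweight_bracket_mem rde (rGa _ Gg)).
Qed.

(** Root spaces that are not opposite are Killing-orthogonal, and so are root spaces and [H_ l]. A
    vector orthogonal to the opposite span is thus orthogonal to all of [G_ l], while lying in the
    derived algebra. *)
Lemma weight_span_nondegenerate l Ga u : Ga `<=` [set al | root_in l al] ->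
  weight_span Ga u -> (forall u', weight_span [set ga | Ga (- ga)] u' -> killing (G_ l) u u' = 0) ->
  u = 0.
Proof.
move=> Gl Vu u0.
have VS : weight_span Ga `<=` lie_product (G_ l) (G_ l).
  apply: weight_span_ind; first exact: subspace_lie_product.
  by move=> ga /Gl; apply: gweight_derived.
have SG := derived_sub (fdG l) (alG l).
have VG : weight_span Ga `<=` G_ l by move=> v /VS/SG.
apply: (killing_nondegenerate (fdG l) (alG l) (@rdG l) (VS _ Vu)) => x Gx.
rewrite (killingC (fdG l) (alG l)) //; last exact: VG.
suff [] : [set y | G_ l y /\ killing (G_ l) y u = 0] x by [].
move: x Gx; apply: (rr_span rr).
- exact: (subspace_killing_orthogonal (fdG l) (alG l)) (VG _ Vu).
- move=> t Ht; split; first exact: HG.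
  suff [] : [set v | G_ l v /\ killing (G_ l) v t = 0] u.
    by move=> _ <-; apply: killingC => //; [apply: HG|apply: VG].
  move: u Vu {u0}; apply: weight_span_ind.
    exact: (subspace_killing_orthogonal (fdG l) (alG l)) (HG Ht).
  move=> ga /Gl gl v vw; have [rga gG] := gl; split; first exact: gG.
  have tw : weight_space (G_ l) (H_ l) 0 t.
    split=> [|s Hs]; first exact: HG.
    by rewrite scale0r; apply: (cartan_abelian (fdG l) (alG l) (@rdG l) (crG l)).
  apply: (killing_weight (fdG l) (alG l) (crG l) (gweight_at vw (gG v vw)) tw (coroot_in rr gl)).
  by rewrite addr0 (pairing_self rr) ?pnatr_eq0.
move=> al la x xw; have [ral aG] := la; split; first exact: aG.
have [aGa|nGa] := pselect (Ga (- al)).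
  rewrite (killingC (fdG l) (alG l)) //; [|exact: aG|exact: VG].
  by apply: u0; apply: weight_span_mem xw.
suff [] : [set v | G_ l v /\ killing (G_ l) v x = 0] u.
  by move=> _ <-; apply: killingC => //; [apply: aG|apply: VG].
move: u Vu {u0}; apply: weight_span_ind.
  by apply: (subspace_killing_orthogonal (fdG l) (alG l)); apply: aG.
move=> ga Gg v vw; have gl := Gl _ Gg; have [rga gG] := gl; split; first exact: gG.
have [t Ht ne] : exists2 t, H_ l t & ga t + al t != 0.
  apply: contrapT => nex; apply: nGa; suff <- : ga = - al by [].
  apply: (root_ext rr gl (root_opp rr la)) => t Ht.
  by apply/eqP; rewrite -subr_eq0 /oppf opprK; apply: contra_notT nex => ?; exists t.
exact: (killing_weight (fdG l) (alG l) (crG l) (gweight_at vw (gG v vw)) (gweight_at xw (aG x xw)) Ht ne).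
Qed.

Lemma opposite_bracket al x y : root al -> gweight al x -> gweight (- al) y ->
  exists c, [lie x, y] = c *: coroot al.
Proof.
move=> ral xw yw; have [k _ kal] := root_in_exists rr 0 ral.
have [x0|x0] := pselect (x = 0); first by exists 0; rewrite x0 lie0l scale0r.
have [f tr] := gtriple_coroot rr ral xw x0; have [_ fw _ [ef _ _] _] := tr.
have f0 : f <> 0.
  by move=> f0; apply: (root_triple_neq0 (gtriple_in rr kal tr)); rewrite -ef f0 lie0r.
have kopp := root_opp rr kal; have [ropp oG] := kopp.
have [f' tr'] := gtriple_coroot rr ropp fw f0.
have [c ->] := root_triple_dim1 (fdG k) (alG k) (@rdG k) (crG k) (gtriple_in rr kopp tr') (gweight_at yw (oG y yw)).
by exists c; rewrite lieZr ef.
Qed.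

Lemma derived_span k W : subspace W ->
  (forall de, root_in k de -> gweight de `<=` W) -> (forall de, root_in k de -> W (coroot de)) ->
  lie_product (G_ k) (G_ k) `<=` W.
Proof.
move=> sW gW cW z; apply; split=> // _ [x Gx [y Gy <-]].
move: y Gy; change (G_ k `<=` [set y | W [lie x, y]]); move: x Gx.
change (G_ k `<=` [set x | forall y, G_ k y -> W [lie x, y]]).
apply: (rr_span rr); first exact: subspace_lie_in.
- move=> s Hs; apply: (rr_span rr); first exact: subspace_lie_inr.
    move=> t Ht /=; rewrite (cartan_abelian (fdG k) (alG k) (@rdG k) (crG k)) //.
    exact: subspace0 sW.
  move=> de dk x xw /=; rewrite (xw _ (splitting_H Hs)).
  exact: (@subspaceZ _ _ _ (de s) _ sW (gW _ dk _ xw)).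
move=> de dk x xw; have [rde dG] := dk; apply: (rr_span rr); first exact: subspace_lie_inr.
  move=> t Ht /=; rewrite lieC (xw _ (splitting_H Ht)) -scaleNr.
  exact: (@subspaceZ _ _ _ (- de t) _ sW (gW _ dk _ xw)).
move=> ga gk y yw /=; have [rga gG] := gk.
have [xy0|xy0] := pselect ([lie x, y] = 0); first by rewrite xy0; apply: (subspace0 sW).
have [dg0|dg0] := pselect (de + ga = 0); last first.
  have rdg := root_bracket rde rga xw yw xy0 dg0.
  apply: (gW (de + ga)); last exact: gweight_lie.
  apply: (root_in_gen rr rdg (gweight_lie xw yw) xy0).
  by apply: (rr_lie rr); [apply: dG|apply: gG].
have gaE : ga = oppf de by apply/eqP; rewrite -addr_eq0 addrC dg0.
rewrite gaE in yw; have [c ->] := opposite_bracket rde xw yw.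
by apply: (@subspaceZ _ _ _ c _ sW); apply: cW.
Qed.

(* The weights of [[G_ k, G_ k]] applied to [weight_span Ga]. *)
Definition near k Ga := [set ga | Ga ga /\ exists ga' de,
  [/\ Ga ga', root_in k de, ga' (coroot de) != 0 & [\/ ga = ga', ga = de + ga' | ga = - de + ga']]].

Lemma near_opp k Ga ga : near k [set ga | Ga (- ga)] ga -> near k Ga (- ga).
Proof.
move=> [Gg [ga' [de [Gg' kde ne gaE]]]]; split=> //.
exists (- ga'), de; split=> //; first by rewrite opprfctE oppr_eq0.
by case: gaE => ->; rewrite ?opprD ?opprK; [constructor 1|constructor 3|constructor 2].
Qed.

Lemma weight_span_near k Ga x u : Ga `<=` [set al | root al] -> closed_under k Ga ->
  lie_product (G_ k) (G_ k) x -> weight_span Ga u -> weight_span (near k Ga) [lie x, u].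
Proof.
move=> rGa cl Sx; move: u.
change ([set x | forall u, weight_span Ga u -> weight_span (near k Ga) [lie x, u]] x).
move: x Sx; apply: derived_span; first exact: subspace_lie_in.
  move=> de dk x xw; apply: weight_span_ind; first exact: subspace_lie_inr.
  move=> ga Gg u uw /=; have [dg0 dg] := cl ga de Gg dk; have [rde _] := dk.
  apply: (gweight_bracket_mem rde (rGa _ Gg) dg0 _ xw uw) => /dg dgG; split=> //.
  (* When [ga] is orthogonal to [de], the root [de + ga] itself pairs to 2 with [de] and serves as
     its own witness. *)
  have [ga0|ga0] := eqVneq (ga (coroot de)) 0.
    exists (de + ga), de; split=> //; last by constructor 1.
    by rewrite addrfctE ga0 addr0 (pairing_self rr) // pnatr_eq0.
  by exists ga, de; split=> //; constructor 2.
move=> de dk; apply: weight_span_ind; first exact: subspace_lie_inr.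
move=> ga Gg u uw /=; rewrite (uw _ (splitting_H (coroot_in rr dk))).
have [->|ga0] := eqVneq (ga (coroot de)) 0.
  by rewrite scale0r; apply: (subspace0 (subspace_weight_span _)).
have nG : near k Ga ga by split=> //; exists ga, de; split=> //; constructor 1.
exact: (@subspaceZ _ _ _ (ga (coroot de)) _ (subspace_weight_span _) (weight_span_mem nG uw)).
Qed.

Lemma weight_span_bracket l m Ga Ga' x y : (m <= l)%N ->
  Ga `<=` [set al | root_in l al] -> Ga' `<=` [set al | root_in l (- al)] ->
  (forall al be, Ga al -> Ga' be -> root (al + be) -> root_in m (al + be)) ->
  weight_span Ga x -> weight_span Ga' y ->
  exists p q, [/\ [lie x, y] = p + q, G_ m p & H_ l q].
Proof.
move=> ml Gl Gl' Gm Vx Vy.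
pose W := [set z | exists p q, [/\ z = p + q, G_ m p & H_ l q]].
have sW : subspace W.
  split=> [|a _ _ [p [q [-> Gp Hq]]] [p' [q' [-> Gp' Hq']]]].
    by exists 0, 0; rewrite addr0; split=> //; [case: (sbG m)|case: (crG l) => [[[]]]].
  exists (a *: p + p'), (a *: q + q'); split; first by rewrite scalerDr addrACA.
    by case: (sbG m) => _; apply.
  by case: (crG l) => [[[_ sH] _]] _ _ _; apply: sH.
change (W [lie x, y]); move: y Vy; change ([set x | forall y, weight_span Ga' y -> W [lie x, y]] x).
move: x Vx; apply: weight_span_ind; first exact: subspace_lie_in.
move=> al Gal x xw; apply: weight_span_ind; first exact: subspace_lie_inr.
move=> be Gbe y yw /=; have al_l := Gl _ Gal; have [ral aG] := al_l.
have be_l : root_in l be by have := root_opp rr (Gl' _ Gbe); rewrite -[X in root_in l X -> _]/(- - be) opprK.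
have [rbe bG] := be_l.
have Gxy : G_ l [lie x, y] by apply: (rr_lie rr); [apply: aG|apply: bG].
have xyw : gweight (al + be) [lie x, y] := gweight_lie xw yw.
have [ab0|ab0] := pselect (al + be = 0).
  exists 0, [lie x, y]; split; [by rewrite add0r|by case: (sbG m)|].
  by apply: gweight0_in Gxy; rewrite -ab0.
have [xy0|xy0] := pselect ([lie x, y] = 0).
  by rewrite xy0; exists 0, 0; rewrite addr0; split=> //; [case: (sbG m)|case: (crG l) => [[[]]]].
have [_ abG] := Gm _ _ Gal Gbe (root_bracket ral rbe xw yw xy0 ab0).
by exists [lie x, y], 0; rewrite addr0; split=> //; [apply: abG|case: (crG l) => [[[]]]].
Qed.

End WeightSpans.

Section Displacement.
Variables (C : numClosedFieldType) (g : lieAlgType C) (G_ H_ : nat -> set g).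
Implicit Types (V : set g) (x y u : g) (be : g -> C) (j k l m : nat).

(* Duality, smallness of the products and the action of [gweight be] are the last
   three clauses; only [m] is to be independent of [j]. *)
Definition displacement be k m j := exists l V V',
  [/\ [/\ (j <= l)%N, (m <= l)%N, subspace V, subspace V' & V `|` V' `<=` G_ l],
      forall x, G_ j x -> (forall u, V u -> V [lie x, u]) /\ (forall u, V' u -> V' [lie x, u]),
      forall u, V u -> (forall u', V' u' -> killing (G_ l) u u' = 0) -> u = 0,
      forall x y u u', lie_product (G_ k) (G_ k) x -> lie_product (G_ k) (G_ k) y ->
        V u -> V' u' -> exists p q, [/\ [lie [lie x, u], [lie y, u']] = p + q, G_ m p & H_ l q]
    & exists x u, [/\ gweight H_ be x, V u & [lie x, u] <> 0]].

Hypothesis rr : root_reductive G_ H_.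
Local Notation root_in := (root_in G_ H_).
Local Notation root := (root H_).

(** The modules are the spans of the root spaces for [Ga] and for its negatives. The negative
    pairing of [ga] with [be] ensures that root vectors of [be] do not kill those of [ga]. *)
Lemma displacement_weight_span be ga k m j l (Ga : set (g -> C)) : root_in k be ->
  ga (coroot H_ be) < 0 -> Ga ga -> (k <= j <= l)%N -> (m <= l)%N ->
  Ga `<=` [set al | root_in l al] -> closed_under G_ H_ j Ga ->
  (forall al al', near G_ H_ k Ga al -> near G_ H_ k Ga al' -> root (al - al') -> root_in m (al - al')) ->
  displacement be k m j.
Proof.
move=> kbe neg Gg /andP[kj jl] ml Gl cl Gm.
have rGa : Ga `<=` [set al | root al] by move=> al /Gl[].
have oppin i al : root_in i al -> root_in i (- al) := @root_opp _ _ _ _ rr i al.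
pose Ga' := [set al | Ga (- al)].
have rGa' : Ga' `<=` [set al | root_in l al] by move=> al /Gl/oppin; rewrite opprK.
have rootGa' : Ga' `<=` [set al | root al] by move=> al /rGa'[].
have cl' : closed_under G_ H_ j Ga'.
  move=> al de Gal dj; have [n0 nr] := cl _ _ Gal (oppin _ _ dj).
  split=> [e|r]; first by apply: n0; rewrite -opprD e oppr0.
  rewrite /Ga' /= opprD; apply: nr; rewrite -opprD.
  by have [i _ ri] := root_in_exists rr 0 r; have [] := oppin i _ ri.
have clk (A : set (g -> C)) : closed_under G_ H_ j A -> closed_under G_ H_ k A.
  by move=> clA al de Aal dk; apply: clA => //; apply: (root_in_mono rr kj).
have sG i : subspace (G_ i) := rr_sub rr i.
exists l, (weight_span H_ Ga), (weight_span H_ Ga'); split.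
- split=> //; try exact: subspace_weight_span.
  by move=> u [] ; apply: weight_span_ind u => // al; [case/Gl|case/rGa'].
- move=> x Gx; split=> u.
    exact: (weight_span_stable rr rGa cl Gx).
  exact: (weight_span_stable rr rootGa' cl' Gx).
- move=> u; exact: (weight_span_nondegenerate rr Gl).
- move=> x y u u' Sx Sy Vu Vu'.
  apply: (weight_span_bracket rr ml (Ga := near G_ H_ k Ga) (Ga' := near G_ H_ k Ga')).
  + by move=> al [/Gl].
  + by move=> al [/Gl].
  + move=> al al' nal /near_opp nal'; have := Gm _ _ nal nal'; by rewrite opprK.
  + exact: (weight_span_near rr rGa (clk _ cl)).
  exact: (weight_span_near rr rootGa' (clk _ cl')).
have [[_ _ [y yw y0]] _] := Gl _ Gg; have [rbe _] := kbe; have [_ _ [x xw x0]] := rbe.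
exists x, y; split=> //; first exact: weight_span_mem yw.
exact: (raise_neq0 rr rbe xw x0 yw y0).
Qed.

End Displacement.

(** * Nonprincipal ultrafilters *)

Section Ultrafilter.
Variables (T : choiceType).

Lemma ultrafilter_exists (N : set T) : infinite_set N -> exists U : set_system T,
  [/\ UltraFilter U, U N & forall A, finite_set A -> U (~` A)].
Proof.
move=> infN; pose F : set_system T := [set A | finite_set (N `\` A)].
have pF : ProperFilter F.
  split; first by rewrite /F /= setD0.
  split=> [|A B|A B AB]; rewrite /F /=; first by rewrite setDT; apply: finite_set0.
    by rewrite setDIr => fA fB; rewrite finite_setU.
  by apply: sub_finite_set => x [Nx nBx]; split=> // /AB.
have [U [uU FU]] := ultraFilterLemma pF; exists U; split=> //.
  by apply: FU; rewrite /F /= setDv; apply: finite_set0.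
by move=> A fA; apply: FU; apply: sub_finite_set fA => x [_] /contrapT.
Qed.

Variable (U : set_system T).
Hypothesis (uU : UltraFilter U).

Lemma filter_finite_forall (I : choiceType) (A : set I) (P : I -> set T) : finite_set A ->
  (forall i, A i -> U (P i)) -> U [set x | forall i, A i -> P i x].
Proof.
move=> /finite_seqP[s ->] {A}; elim: s => [|i s IHs] sP.
  by apply: filterS filterT => x _ i; rewrite /= in_nil.
have Us : U [set x | forall i, i \in s -> P i x].
  by apply: IHs => k ks; apply: sP; rewrite /= inE ks orbT.
have Ui : U (P i) by apply: sP; rewrite /= inE eqxx.
by apply: filterS (filterI Ui Us) => x [Pi Ps] k /=; rewrite inE => /predU1P[->|/Ps].
Qed.

Lemma ultrafilter_value (X : eqType) (r : seq X) (v : T -> X) : U [set x | v x \in r] ->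
  exists2 a, a \in r & U [set x | v x = a].
Proof.
elim: r => [|a r IHr] Ur.
  by case: (filter_not_empty U); apply: filterS Ur => x /=; rewrite in_nil.
have [Ua|Una] := in_ultra_setVsetC [set x | v x = a] uU.
  by exists a => //; rewrite inE eqxx.
have [|b br Ub] := IHr; last by exists b => //; rewrite inE br orbT.
by apply: filterS (filterI Ur Una) => x [/=]; rewrite inE => /predU1P[->|].
Qed.

Lemma ultrafilter_infinite A : (forall B, finite_set B -> U (~` B)) -> U A -> infinite_set A.
Proof.
move=> cof UA fA; case: (filter_not_empty U).
by apply: filterS (filterI UA (cof A fA)) => x [].
Qed.

End Ultrafilter.

Lemma displacement_mono (C : numClosedFieldType) (g : lieAlgType C) (G_ H_ : nat -> set g)
    (be : g -> C) k m i j : root_reductive G_ H_ -> (i <= j)%N ->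
  displacement G_ H_ be k m j -> displacement G_ H_ be k m i.
Proof.
move=> rr ij [l [V [V' [[jl ml sV sV' VG] st nd br act]]]]; exists l, V, V'; split=> //.
  by split=> //; apply: leq_trans jl.
by move=> x Gx; apply: st; apply: (rr_mono rr ij).
Qed.

(** * Infinitely many roots pair negatively with [be]: modules translated by a generic root *)

Section InfiniteCase.
Variables (C : numClosedFieldType) (g : lieAlgType C) (G_ H_ : nat -> set g).
Hypothesis rr : root_reductive G_ H_.
Implicit Types (al be ga de la mu : g -> C) (i j k l m : nat).
Local Notation root_in := (root_in G_ H_).
Local Notation root := (root H_).
Local Notation coroot := (coroot H_).

Lemma root_in_common (A : set (g -> C)) k : finite_set A ->
  exists2 m, (k <= m)%N & forall al, A al -> root al -> root_in m al.
Proof.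
move=> /finite_seqP[s ->] {A}; elim: s => [|al s [m km mP]]; first by exists k.
have [ral|nral] := pselect (root al); last first.
  by exists m => // be /=; rewrite inE => /predU1P[->//|]; apply: mP.
have [n mn nal] := root_in_exists rr m ral; exists n; first exact: leq_trans mn.
move=> be /=; rewrite inE => /predU1P[->//|bs rbe].
by apply: root_in_mono mn _ => //; apply: mP.
Qed.

Variable (U : set_system (g -> C)).
Hypothesis (uU : UltraFilter U) (Uroot : U [set ga | root ga]).
Hypothesis cof : forall A, finite_set A -> U (~` A).

(** The weights of the generic module, measured from the generic root. *)
Definition shifts := [set la | U [set ga | root (ga + la)]].

(* Pick five such shifts [la i] and five roots [ga i] generic for them.  By
   [five_roots] some [ga i + la i] pairs positively with [th := ga j + la j]; then
   the pairings of [ga j + la i] and [ga i + la j] with [th] add up to more than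
   [2], and [pairing_sum] makes one of them equal to [th]. *)
Lemma finite_shifts_limit de (d d' : C) : root de -> d != 0 ->
  finite_set [set la | U [set ga | [/\ root (ga + la), (ga + la) (coroot de) = d
    & de (coroot (ga + la)) = d']]].
Proof.
move=> rde d0; apply: contrapT => /(infinite_injection 5)[la [laP la_inj]].
have US : U [set ga | forall i, (i < 5)%N -> [/\ root (ga + la i), (ga + la i) (coroot de) = d
    & de (coroot (ga + la i)) = d']].
  apply: (filter_finite_forall uU (A := `I_5) (P := fun i ga => [/\ root (ga + la i), _ & _])) => //.
have := ultrafilter_infinite uU cof US => /(infinite_injection 5)[ga [gaP ga_inj]].
pose A := [set al | al = de \/ exists i j, (i < 5)%N /\ (j < 5)%N /\ al = ga i + la j].
have fA : finite_set A.
  apply: (@sub_finite_set _ _ ([set de] `|` (fun p => ga p.1 + la p.2) @` (`I_5 `*` `I_5))).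
    by move=> al [->|[i [j [i5 [j5 ->]]]]]; [left|right; exists (i, j)].
  by rewrite finite_setU; split; [apply: finite_set1|apply/finite_image/finite_setX; apply: finite_II].
have [l _ lP] := root_in_common 0 fA.
have lde : root_in l de by apply: lP => //; left.
have lgl i j : (i < 5)%N -> (j < 5)%N -> root_in l (ga i + la j).
  by move=> i5 j5; apply: lP; [right; exists i, j|have [] := gaP i i5 j j5].
have [i i5|i [j [/andP[ij j5] pos]]] := five_roots rr (th := fun i => ga i + la i) (d := d) (d' := d') lde _ d0.
  by have [_ ? ?] := gaP i i5 i i5; split=> //; apply: lgl.
have i5 := ltn_trans ij j5.
(* The 25 roots [ga i' + la j'] share the pairings [d] and [d'] with [de], hence have the same
   length. *)
have keq i' j' : (i' < 5)%N -> (j' < 5)%N -> kcoef G_ H_ l (ga j + la j) = kcoef G_ H_ l (ga i' + la j').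
  move=> i'5 j'5; have [_ e1 e2] := gaP j j5 j j5; have [_ e3 e4] := gaP i' i'5 j' j'5.
  by apply: (kcoef_eq rr lde); rewrite ?e1 ?e2 ?e3 ?e4 //; apply: lgl.
have [] := pairing_sum rr (lgl j j j5 j5) (lgl j i j5 i5) (lgl i j i5 j5) (keq _ _ j5 i5) (keq _ _ i5 j5).
- have [[rj _] _] := (lgl j j j5 j5, tt).
  (* Exchanging the two shifts does not change the sum of the roots; one summand now pairs
     positively with [ga j + la j], and the other is that root itself, with pairing 2. *)
  rewrite [ltRHS](_ : _ = (ga i + la i) (coroot (ga j + la j)) + (ga j + la j) (coroot (ga j + la j))).
    by rewrite (pairing_self rr) // ltrDr.
  by rewrite !addrfctE; ring.
- by move=> /addrI e; apply: (la_inj i j); rewrite ?ij.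
by move=> /addIr e; apply: (ga_inj i j); rewrite ?ij.
Qed.

(** The generic weights seen by [G_ k], that is, not generically orthogonal to all its roots. *)
Definition active_shifts k := [set la | shifts la /\
  exists2 de, root_in k de & ~ U [set ga | (ga + la) (coroot de) = 0]].

Lemma finite_active_shifts k : finite_set (active_shifts k).
Proof.
have [r rP] := pairing_bounded rr.
pose B de d d' := [set la | U [set ga | [/\ root (ga + la), (ga + la) (coroot de) = d
    & de (coroot (ga + la)) = d']]].
apply: (@sub_finite_set _ _ (\bigcup_(de in [set de | root_in k de])
   \bigcup_(d in [set` r]) \bigcup_(d' in [set` r]) (if d == 0 then set0 else B de d d'))).
  move=> la [Ula [de kde nU]]; have [rde _] := kde.
  have [d dr Ud] : exists2 d, d \in r & U [set ga | (ga + la) (coroot de) = d].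
    apply: (ultrafilter_value uU (v := fun ga => (ga + la) (coroot de))).
    by apply: filterS Ula => ga; apply: rP.
  have [d' d'r Ud'] : exists2 d', d' \in r & U [set ga | de (coroot (ga + la)) = d'].
    apply: (ultrafilter_value uU (v := fun ga => de (coroot (ga + la)))).
    by apply: filterS Ula => ga ?; apply: rP.
  exists de => //; exists d => //; exists d' => //.
  case: eqP => [d0|_]; first by case: nU; rewrite -d0.
  by apply: filterS (filterI Ula (filterI Ud Ud')) => ga [? []].
apply: bigcup_finite; first exact: finite_root_in.
move=> de [rde _]; apply: bigcup_finite => [|d _]; first exact: finite_seq.
apply: bigcup_finite => [|d' _]; first exact: finite_seq.
by case: eqP => [_|/eqP d0]; [apply: finite_set0|apply: finite_shifts_limit].
Qed.

(** On a coroot of [G_ j] a shift takes a difference of two root pairings, one of finitely many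
    numbers, and these values determine a lattice element. *)
Lemma finite_lattice_shifts j : finite_set [set la | shifts la /\ root_lattice G_ H_ j la].
Proof.
have [r rP] := pairing_bounded rr.
have /finite_seqP[s sE] : finite_set (coroot @` [set de | root_in j de]).
  exact/finite_image/finite_root_in.
apply: (@finite_by_values _ _ _ _ s (fun la t => la t)) => [t ts|la mu [_ jla] [_ jmu] lamu].
  have [de [rde _] <-] : (coroot @` [set de | root_in j de]) t by rewrite sE.
  exists [seq a - b | a <- r, b <- r] => la [Ula _].
  have [ga [rga rgl]] := filter_ex (filterI Uroot Ula).
  apply/allpairsP; exists ((ga + la) (coroot de), ga (coroot de)); split; try exact: rP.
  by rewrite addrfctE /= addrAC subrr add0r.
apply/eqP; rewrite -subr_eq0; apply/eqP; apply: (root_lattice_eq0 rr (root_latticeB rr jla jmu)).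
move=> de dj; rewrite addrfctE opprfctE lamu ?subrr //.
by have : [set` s] (coroot de) by rewrite -sE; exists de.
Qed.

Lemma displacement_infinite be k : root_in k be -> U [set ga | ga (coroot be) < 0] ->
  exists2 m, (k <= m)%N & forall j, displacement G_ H_ be k m j.
Proof.
move=> kbe Uneg; pose E := active_shifts k.
(* The shifts of all weights in [near]. Differences of two of them do not involve the generic root,
   so the roots among these differences lie in some [G_ m] fixed before [j]. *)
pose M := E `|` ((fun p => p.1 + p.2) @` ([set de | root_in k de] `*` E)).
have fM : finite_set M.
  rewrite finite_setU; split; first exact: finite_active_shifts.
  by apply/finite_image/finite_setX; [apply: finite_root_in|apply: finite_active_shifts].
have [m km mP] := root_in_common k (finite_image2 (fun a b : g -> C => a - b) fM fM).
exists m => // j; suff : displacement G_ H_ be k m (maxn j k).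
  by apply: (displacement_mono rr); apply: leq_maxl.
move: (maxn j k) (leq_maxr j k) => {}j kj.
pose L := [set la | shifts la /\ root_lattice G_ H_ j la].
have fL : finite_set L := finite_lattice_shifts j.
have U1 : U [set ga | forall la, L la -> root (ga + la)].
  by apply: (filter_finite_forall uU (P := fun la ga => root (ga + la)) fL) => la [].
have fDL i : finite_set ([set de | root_in i de] `*` L).
  by apply: finite_setX => //; apply: finite_root_in.
(* For generic [ga], the translates of [L] are closed under the roots of [G_ j]: a sum outside
   [shifts] is generically not a root, and each sum vanishes for a single [ga] only. *)
have U2 : U [set ga | forall p, ([set de | root_in j de] `*` L) p ->
    p.1 + (ga + p.2) <> 0 /\ (~ shifts (p.1 + p.2) -> ~ root (p.1 + (ga + p.2)))].
  apply: (filter_finite_forall uU (P := fun p ga => _ /\ _) (fDL j)) => -[de la] [jde Lla] /=.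
  have Un0 : U [set ga | de + (ga + la) <> 0].
    apply: filterS (cof (finite_set1 (- (de + la)))) => ga ne e; apply: ne.
    by apply/eqP; rewrite /= -addr_eq0 addrCA e.
  have [sh|nsh] := pselect (shifts (de + la)).
    by apply: filterS Un0 => ga.
  have [Ush|Unsh] := in_ultra_setVsetC [set ga | root (ga + (de + la))] uU; first by case: nsh.
  by apply: filterS (filterI Un0 Unsh) => ga [? nr]; split=> // _; rewrite addrCA.
have U3 : U [set ga | forall p, ([set de | root_in k de] `*` L) p ->
    ~ E p.2 -> (ga + p.2) (coroot p.1) = 0].
  apply: (filter_finite_forall uU (P := fun p ga => _ -> _) (fDL k)) => -[de la] [kde [sla _]] /=.
  have [Ela|nE] := pselect (E la); first by apply: filterS filterT.
  have : U [set ga | (ga + la) (coroot de) = 0].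
    by apply: contrapT => nU; apply: nE; split=> //; exists de.
  by apply: filterS.
(* Since [L] is finite, only finitely many generic conditions are imposed, and an actual root
   satisfies them all. *)
have [ga [ga1 [ga2 [ga3 neg]]]] := filter_ex (filterI U1 (filterI U2 (filterI U3 Uneg))).
pose Ga := (fun la => ga + la) @` L.
have [l lP Gal] := root_in_common (maxn j m) (finite_image (fun la => ga + la) fL).
have Gl : Ga `<=` [set al | root_in l al].
  by move=> al GG; apply: Gal => //; case: GG => la Lla <-; apply: ga1.
have nearM al : near G_ H_ k Ga al -> exists2 mu, M mu & al = ga + mu.
  move=> [_ [_ [de [[la Lla <-] kde ne alE]]]].
  have Ela : E la.
    by apply: contrapT => nE; move/eqP: ne; apply; apply: (ga3 (de, la)).
  case: alE => ->.
  - by exists la => //; left.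
  - by exists (de + la); [right; exists (de, la)|rewrite addrCA].
  exists (- de + la); last by rewrite addrCA.
  by right; exists (- de, la) => //; split=> //; exact: (root_opp rr kde).
apply: (@displacement_weight_span _ _ _ _ rr _ ga _ _ _ l Ga) => //.
- exists 0; last by rewrite addr0.
  split; last exact: root_lattice0.
  by rewrite /shifts /=; under eq_fun do rewrite addr0.
- by rewrite kj (leq_trans (leq_maxl j m)).
- exact: leq_trans (leq_maxr j m) lP.
- move=> _ de [la [sla jla] <-] jde; have [n0 nr] := ga2 (de, la) (conj jde (conj sla jla)).
  split=> // r; exists (de + la); last by rewrite addrCA.
  by split; [apply: contrapT => /nr|apply: root_latticeD].
move=> al al' /nearM[mu Mmu ->] /nearM[mu' Mmu' ->]; rewrite opprD addrACA subrr add0r => r.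
by apply: mP => //; exists mu => //; exists mu'.
Qed.

End InfiniteCase.

(** * Finitely many roots pair negatively with [be]: the ideal of a finite component *)

Section FiniteCase.
Variables (C : numClosedFieldType) (g : lieAlgType C) (G_ H_ : nat -> set g).
Hypothesis rr : root_reductive G_ H_.
Implicit Types (al be ga de : g -> C) (x y u v t : g) (i j k l m : nat).
Local Notation root_in := (root_in G_ H_).
Local Notation root := (root H_).
Local Notation coroot := (coroot H_).
Local Notation gweight := (gweight H_).
Let fdG i : finite_dimensional (G_ i) := rr_fd rr i.
Let alG i : subalgebra (G_ i) := rr_alg rr i.
Let rdG i : reductive (G_ i) := rr_red rr i.
Let crG i : findim_cartan (G_ i) (H_ i) := rr_car rr i.

Lemma root_oppr al : root al -> root (- al).
Proof. by move=> ral; have [i _ ri] := root_in_exists rr 0 ral; have [] := root_opp rr ri. Qed.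

Variable (be : g -> C).
Hypothesis rbe : root be.

Definition adjacent := [set ga | root ga /\ ga (coroot be) <> 0].

(* By [component_path] roots at distance at most two already form a connected
   component. *)
Definition component := [set ga | root ga /\ exists2 de, adjacent de & ga (coroot de) <> 0].

(** The sign of the pairing decides which of [ga + de] and [ga - de] is a root; its pairing with
    [be] is, up to sign, that of [de]. *)
Lemma component_path ga de : root ga -> ga (coroot be) = 0 -> adjacent de -> ga (coroot de) <> 0 ->
  adjacent (ga + de) \/ adjacent (ga - de).
Proof.
move=> rga gb [rde db] gd.
have dg : de (coroot ga) <> 0 by move=> /(adjacentC rr rde rga).
have [n nE] := pairing_int rr rga rde.
have : (n < 0) || (0 < n) by rewrite -neq_lt; apply: contra_notN dg => /eqP n0; rewrite nE n0.
case/orP => n0; [left|right]; split=> //.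
- apply: (root_add rr rga rde); first by rewrite nE ltrz0.
  by move/eqP; rewrite addr_eq0 => /eqP e; apply: db; move: gb; rewrite e opprfctE => /eqP; rewrite oppr_eq0 => /eqP.
- by rewrite addrfctE gb add0r.
- apply: (root_add rr rga (root_oppr rde)); first by rewrite opprfctE nE oppr_lt0 ltr0z.
  by move/eqP; rewrite subr_eq0 => /eqP e; apply: db; rewrite -e.
by rewrite addrfctE gb add0r opprfctE => /eqP; rewrite oppr_eq0 => /eqP.
Qed.

Lemma finite_component : finite_set [set ga | root ga /\ ga (coroot be) < 0] ->
  finite_set component.
Proof.
move=> fN.
have fA : finite_set adjacent.
  apply: (@sub_finite_set _ _ ([set ga | root ga /\ ga (coroot be) < 0] `|`
     -%R @` [set ga | root ga /\ ga (coroot be) < 0])).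
    move=> ga [rga gb]; have [n nE] := pairing_int rr rbe rga.
    have : (n < 0) || (0 < n) by rewrite -neq_lt; apply: contra_notN gb => /eqP n0; rewrite nE n0.
    case/orP => n0; [left|right]; first by split; rewrite ?nE ?ltrz0.
    exists (- ga); last by rewrite opprK.
    by split; [apply: root_oppr|rewrite opprfctE nE oppr_lt0 ltr0z].
  by rewrite finite_setU; split=> //; apply: finite_image.
apply: (@sub_finite_set _ _ (adjacent `|`
    ((fun p => p.1 - p.2) @` (adjacent `*` adjacent) `|` (fun p => p.1 + p.2) @` (adjacent `*` adjacent)))).
  move=> ga [rga [de Ade gd]].
  have [gb|gb] := pselect (ga (coroot be) = 0); last by left.
  right; have [Ag|Ag] := component_path rga gb Ade gd; [left|right].
    by exists (ga + de, de) => //; rewrite /= addrK.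
  by exists (ga - de, de) => //; rewrite /= subrK.
by rewrite !finite_setU; split=> //; split; apply/finite_image/finite_setX.
Qed.

Lemma component_adjacent ga de : component ga -> root de -> de (coroot ga) <> 0 -> component de.
Proof.
move=> [rga [th Ath gt]] rde dg; split=> //; have [rth _] := Ath.
have [gb|gb] := pselect (ga (coroot be) = 0); last by exists ga.
have [dt|dt] := pselect (de (coroot th) = 0); last by exists th.
have td := adjacentC rr rde rth dt.
have gd : ga (coroot de) <> 0 by move=> /(adjacentC rr rga rde).
have [Ag|Ag] := component_path rga gb Ath gt; [exists (ga + th)|exists (ga - th)] => //.
  by have [rgt _] := Ag; move=> /(adjacentC rr rde rgt); rewrite addrfctE td addr0.
by have [rgt _] := Ag; move=> /(adjacentC rr rde rgt); rewrite addrfctE opprfctE td subr0.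
Qed.

(** If [de + ga] is orthogonal to [ga], then [de] is not, so [de] is in the component. Moreover
    [de + ga] is not orthogonal to [de], as otherwise it would be orthogonal to itself. *)
Lemma component_add ga de : component ga -> root de -> root (de + ga) -> component (de + ga).
Proof.
move=> cga rde rdg; have [rga _] := cga.
have [gd|gd] := pselect ((de + ga) (coroot ga) = 0); last exact: component_adjacent rdg gd.
have dg : de (coroot ga) <> 0.
  move=> dg; move: gd; rewrite addrfctE dg add0r (pairing_self rr) // => /eqP.
  by rewrite pnatr_eq0.
have cde := component_adjacent cga rde dg.
apply: (component_adjacent cde rdg) => /(adjacentC rr rdg rde) e.
have := pairing_self rr rdg; rewrite addrfctE e add0r.
by rewrite (adjacentC rr rdg rga gd) => /esym/eqP; rewrite pnatr_eq0.
Qed.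

Lemma component_self : component be.
Proof.
have n0 : be (coroot be) <> 0 by rewrite (pairing_self rr) //; apply/eqP; rewrite pnatr_eq0.
by split=> //; exists be.
Qed.

Definition component_ideal :=
  smallest (@subspace C g) [set x | exists2 ga, component ga & gweight ga x \/ x = coroot ga].

Lemma subspace_component : subspace component_ideal. Proof. exact: subspace_smallest. Qed.
Hint Resolve subspace_component : core.

Lemma component_ind (W : set g) : subspace W -> (forall ga, component ga -> gweight ga `<=` W) ->
  (forall ga, component ga -> W (coroot ga)) -> component_ideal `<=` W.
Proof.
move=> sW gW cW u; apply; split=> // x [ga cga [xw|->]]; first exact: gW xw.
exact: cW.
Qed.

Lemma component_gweight ga x : component ga -> gweight ga x -> component_ideal x.
Proof. by move=> cga xw A [_]; apply; exists ga => //; left. Qed.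

Lemma component_coroot ga : component ga -> component_ideal (coroot ga).
Proof. by move=> cga A [_]; apply; exists ga => //; right. Qed.

Lemma component_stable i x u : G_ i x -> component_ideal u -> component_ideal [lie x, u].
Proof.
move=> Gx; move: u; change ([set x | forall u, component_ideal u -> component_ideal [lie x, u]] x).
move: x Gx; apply: (rr_span rr); first exact: subspace_lie_in.
- move=> t Ht; apply: component_ind; first exact: subspace_lie_inr.
    move=> ga cga u uw /=; rewrite (uw _ (splitting_H Ht)).
    exact: (@subspaceZ _ _ _ (ga t) _ subspace_component (component_gweight cga uw)).
  move=> ga [rga _] /=; have [l il lga] := root_in_exists rr i rga.
  rewrite (cartan_abelian (fdG l) (alG l) (@rdG l) (crG l)); first exact: (subspace0 subspace_component).
    exact: (rr_Hmono rr il Ht).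
  exact: coroot_in lga.
move=> de [rde _] x xw; apply: component_ind; first exact: subspace_lie_inr.
  move=> ga cga u uw /=; have [rga _] := cga.
  have [dg0|dg0] := pselect (de + ga = 0).
    have deE : de = - ga by apply/eqP; rewrite -addr_eq0 dg0.
    rewrite deE in xw; have [c cE] := opposite_bracket rr rga uw xw.
    rewrite lieC cE -scaleNr.
    exact: (@subspaceZ _ _ _ (- c) _ subspace_component (component_coroot cga)).
  have [->|xu0] := pselect ([lie x, u] = 0); first exact: (subspace0 subspace_component).
  have rdg := root_bracket rde rga xw uw xu0 dg0.
  exact: (component_gweight (component_add cga rde rdg) (gweight_lie xw uw)).
move=> ga cga /=; have [rga _] := cga; rewrite lieC (xw _ (coroot_splitting rr rga)) -scaleNr.
have [->|dg] := pselect (de (coroot ga) = 0).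
  by rewrite oppr0 scale0r; apply: (subspace0 subspace_component).
exact: (@subspaceZ _ _ _ (- de (coroot ga)) _ subspace_component (component_gweight (component_adjacent cga rde dg) xw)).
Qed.

Lemma displacement_finite k : root_in k be -> finite_set [set ga | root ga /\ ga (coroot be) < 0] ->
  exists2 m, (k <= m)%N & forall j, displacement G_ H_ be k m j.
Proof.
move=> kbe /finite_component fc.
have [m km mP] := root_in_common rr k fc; exists m => // j.
have cin l ga : (m <= l)%N -> component ga -> root_in l ga.
  by move=> ml cga; apply: (root_in_mono rr ml); apply: mP => //; case: cga.
have IS l : (m <= l)%N -> component_ideal `<=` lie_product (G_ l) (G_ l).
  move=> ml; apply: component_ind; first exact: subspace_lie_product.
    by move=> ga /(cin l _ ml); apply: gweight_derived.
  move=> ga /(cin l _ ml) lga; have [e [f tr]] := coroot_triple rr lga.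
  exact: root_triple_derived tr.
have IG l : (m <= l)%N -> component_ideal `<=` G_ l.
  by move=> /IS IS' u /IS'; apply: derived_sub.
pose l := maxn j m; have ml : (m <= l)%N := leq_maxr j m.
exists l, component_ideal, component_ideal; split.
- by split=> //; [apply: leq_maxl|move=> u []; apply: IG].
- by move=> x Gx; split=> u; apply: component_stable Gx.
- move=> u Iu u0; apply: contrapT => un0.
  pose Y := [set u | component_ideal u /\ forall u', component_ideal u' -> killing (G_ l) u u' = 0].
  have IGl := IG _ ml.
  have idY : ideal (G_ l) Y.
    split.
    + split=> [|a x y [Ix x0] [Iy y0]].
        split; first exact: (subspace0 subspace_component).
        by move=> u' /IGl; apply: killing0l.
      split; first by case: subspace_component => _; apply.
      by move=> u' Iu'; rewrite killingPl ?x0 ?y0 ?mulr0 ?addr0 //; apply: IGl.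
    + by move=> x [/IGl].
    move=> x y Gx [Iy y0]; split; first exact: component_stable Gx Iy.
    move=> u' Iu'; have Gu' := IGl _ Iu'; have Gy := IGl _ Iy.
    rewrite lieC (killingNl (fdG l) (alG l)) ?(killing_lie (fdG l) (alG l)) //.
      by rewrite y0 ?oppr0 //; apply: component_stable Gx Iu'.
    exact: (rr_lie rr).
  (* A nonzero radical [Y] would contain a root vector, hence the corresponding coroot, whose
     Killing square is positive. *)
  have [al lal alY] := root_in_ideal rr (IS _ ml _ Iu) un0.
  have [e [f tr]] := coroot_triple rr lal; have [[Ge _] [Gf _] Hc [ef _ _] _] := tr.
  have Ye : Y e.
    have [ral _] := lal; apply: (alY _ idY _ e); first by split.
    have [e' [f' tr']] := coroot_ex rr ral; have [e'w _ _ _ _] := tr'.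
    have [c ->] := root_triple_dim1 (fdG l) (alG l) (@rdG l) (crG l) (gtriple_in rr lal tr') (let: And5 ew _ _ _ _ := tr in ew).
    exact: (@subspaceZ _ _ _ c _ (subspace_gweight _ _) e'w).
  have [_ _ Yst] := idY; have [Ic c0] : Y (coroot al).
    by rewrite -ef lieC -scaleN1r; apply: (@subspaceZ _ _ _ (-1) _ (let: And3 sY _ _ := idY in sY)); apply: Yst.
  by have [] := kcoefP rr lal; rewrite /kcoef c0 // mul0r ltxx.
- move=> x y u u' Sx Sy Iu Iu'; exists [lie [lie x, u], [lie y, u']], 0; rewrite addr0; split=> //.
    have st z v : lie_product (G_ k) (G_ k) z -> component_ideal v -> component_ideal [lie z, v].
      by move=> /(derived_sub (fdG k) (alG k)); apply: component_stable.
    apply: (IG m (leqnn m)); apply: (component_stable (i := m)); last exact: st.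
    by apply: (IG m (leqnn m)); apply: st.
  by case: (crG l) => [[[]]].
have [_ _ [x xw x0]] := rbe; exists x, (coroot be); split=> //.
  exact: component_coroot component_self.
rewrite lieC (xw _ (coroot_splitting rr rbe)) (pairing_self rr) // -scaleNr => /eqP.
by rewrite scaler_eq0 oppr_eq0 pnatr_eq0 => /eqP.
Qed.

End FiniteCase.

Lemma displacement_exists (C : numClosedFieldType) (g : lieAlgType C) (G_ H_ : nat -> set g)
    (be : g -> C) k : root_reductive G_ H_ -> root_in G_ H_ k be ->
  exists2 m, (k <= m)%N & forall j, displacement G_ H_ be k m j.
Proof.
move=> rr kbe; have [rbe _] := kbe.
have [fN|infN] := pselect (finite_set [set ga | root H_ ga /\ ga (coroot H_ be) < 0]).
  exact: displacement_finite.
have [U [uU UN cof]] := ultrafilter_exists infN.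
apply: (displacement_infinite rr uU _ cof kbe).
  by apply: filterS UN => ga [].
by apply: filterS UN => ga [].
Qed.

(** * Cartan subalgebras of root-reductive algebras *)

(** On [v] the operators [ad s] and [- ad n] agree, and they commute, so the iterates of [ad s] on
    [v] are multiples of those of [ad n] and eventually vanish; [ad s] has no Jordan block at 0. *)
Lemma commuting_difference_kernel (C : numClosedFieldType) (g : lieAlgType C) (G : set g) (s n v : g) :
  finite_dimensional G -> subalgebra G -> G s -> G v -> diag_on G (lie s) -> nil_on G (lie n) ->
  [lie s, n] = 0 -> [lie (s + n), v] = 0 -> [lie s, v] = 0.
Proof.
move=> fG aG Gs Gv sd nn sn; rewrite lieDl => /eqP; rewrite addr_eq0 => /eqP sv.
have sk k : [lie s, iter k (lie n) v] = - iter k.+1 (lie n) v.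
  by elim: k => [//|k IHk]; rewrite iterS lie_commute // IHk lieNr -!iterS.
have iter_sv k : exists c : C, iter k (lie s) v = c *: iter k (lie n) v.
  elim: k => [|k [c IHk]]; first by exists 1; rewrite scale1r.
  by exists (- c); rewrite iterS IHk lieZr sk scalerN scaleNr.
have [k kv] := nn v Gv.
rewrite -(scale0r v); apply: (@diag_on_gen _ _ G (lie s) 0 k) => //.
  exact: (operator_lie aG).
by rewrite iter_shift0; have [c ->] := iter_sv k; rewrite kv scaler0.
Qed.

(** The definition [nilpotent_in] demands one exponent for all vectors; it exists because the
    increasing kernels stabilize. *)
Lemma nil_on_uniform (C : numClosedFieldType) (g : lieAlgType C) (G : set g) (f : g -> g) :
  finite_dimensional G -> operator G f -> nil_on G f -> exists k, forall x, G x -> iter k f x = 0.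
Proof.
move=> fG fO nf; have sG := finite_dimensional_subspace fG.
pose V k := [set x | G x /\ iter k f x = 0].
have sV k : subspace (V k).
  have [fG' fl] := fO.
  have itl a x y : G x -> G y -> iter k f (a *: x + y) = a *: iter k f x + iter k f y.
    move=> Gx Gy; elim: k => //= k ->; by rewrite fl //; apply: iterU.
  split=> [|a x y [Gx x0] [Gy y0]]; last first.
    by split; [case: sG => _; apply|rewrite itl // x0 y0 scaler0 addr0].
  by split; [case: sG|elim: k {itl} => //= k ->; apply: (operator0 fG fO)].
have [||W [k ->] kmax] := max_subspace fG (P := [set W | exists k, W = V k]).
- by exists (V 0%N), 0%N.
- by move=> W [k ->]; split; [exact: sV|move=> x []].
exists k => x Gx; have [j jx] := nf x Gx.
have Vmono i d y : V i y -> V (d + i)%N y.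
  by move=> [Gy y0]; split=> //; elim: d => //= d ->; apply: (operator0 fG fO).
have VE : V (j + k)%N = V k by apply: kmax; [exists (j + k)%N|move=> y; apply: Vmono].
suff [] : V k x by [].
by rewrite -VE addnC; apply: Vmono.
Qed.

(** * Triple products of elements of [h] *)

Section Main.
Variables (C : numClosedFieldType) (g : lieAlgType C) (G_ H_ : nat -> set g) (h : set g).
Hypothesis rr : root_reductive G_ H_.
Hypothesis ch : cartan_subalgebra G_ h.
Implicit Types (x y z u v s n a b c : g) (i j k l m : nat).
Local Notation ss := (semisimple_parts G_ h).
Let fdG i : finite_dimensional (G_ i) := rr_fd rr i.
Let alG i : subalgebra (G_ i) := rr_alg rr i.
Let rdG i : reductive (G_ i) := rr_red rr i.
Let crG i : findim_cartan (G_ i) (H_ i) := rr_car rr i.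
Let sbG i : subspace (G_ i) := rr_sub rr i.
Let HG i : H_ i `<=` G_ i := @rr_HG _ _ _ _ rr i.

Lemma jordan_levels i l x s n : jordan_decomposition_in (G_ i) x s n -> (i <= l)%N ->
  [/\ G_ l s, G_ l n, diag_on (G_ l) (lie s) & nil_on (G_ l) (lie n)].
Proof.
move=> [sss [Sn [k nk]] sn xE] il; have Gs := sss.1.
have Gn := derived_sub (fdG i) (alG i) Sn; have il' := rr_mono rr il.
split; [exact: il'|exact: il'| |].
  apply: (diag_on_extend rr il Gs).
  by apply/(semisimple_inP (fdG i) (operator_lie (alG i) Gs) Gs).
apply: (nil_on_extend (fdG l) (alG l) (alG i) il' Sn) => v Gv.
by exists k; apply: nk.
Qed.

Lemma jordan_in_exists i x : G_ i x -> exists s n,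
  [/\ jordan_decomposition_in (G_ i) x s n, lie_product (G_ i) (G_ i) n & nil_on (G_ i) (lie n)].
Proof.
move=> Gx; have [s [n [Gs Sn xE sn [nn sd _ _]]]] := reductive_jordan (fdG i) (alG i) (@rdG i) Gx.
exists s, n; split=> //; split=> //; last split=> //.
  by apply/(semisimple_inP (fdG i) (operator_lie (alG i) Gs) Gs).
exact: nil_on_uniform (operator_lie (alG i) (derived_sub (fdG i) (alG i) Sn)) nn.
Qed.

Lemma semisimple_level s : ss s -> exists i, forall l, (i <= l)%N -> G_ l s /\ diag_on (G_ l) (lie s).
Proof. by move=> [x _ [n [i jd]]]; exists i => l /(jordan_levels jd)[]. Qed.

Lemma jordan_kernel i x s n v : jordan_decomposition_in (G_ i) x s n -> [lie x, v] = 0 -> [lie s, v] = 0.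
Proof.
move=> jd xv; have [l il Gv] := rr_cover_from rr i v.
have [Gs Gn sd nn] := jordan_levels jd il; have [_ _ sn xE] := jd.
by apply: (commuting_difference_kernel (fdG l) (alG l) Gs Gv sd nn sn); rewrite -xE.
Qed.

Lemma cartan_centralizes s x : ss s -> h x -> [lie s, x] = 0.
Proof.
by have [_ _ hE] := ch => ts; rewrite {1}hE => /(_ s ts) xs; rewrite lieC xs oppr0.
Qed.

Lemma cartan_of_centralizer x : (forall s, ss s -> [lie s, x] = 0) -> h x.
Proof.
by have [_ _ hE] := ch => xP; rewrite hE => s ts; rewrite lieC xP // oppr0.
Qed.

Lemma semisimple_in_cartan s : ss s -> h s.
Proof.
move=> ts; apply: cartan_of_centralizer => s' [x' hx' [n' [i jd]]].
by apply: (jordan_kernel jd); rewrite lieC cartan_centralizes // oppr0.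
Qed.

Lemma ad_nil_space_sub : ad_nil_space h `<=` h.
Proof.
move=> v [k _ kv]; apply: cartan_of_centralizer => s ts.
have [i iP] := semisimple_level ts; have [l il Gv] := rr_cover_from rr i v.
have [Gs sd] := iP l il; rewrite -(scale0r v).
apply: (@diag_on_gen _ _ (G_ l) (lie s) 0 k) => //; first exact: (operator_lie (alG l)).
by rewrite iter_shift0; apply: kv; apply: semisimple_in_cartan.
Qed.

Let ah : subalgebra h. Proof. by case: ch. Qed.
Let sh : subspace h. Proof. by case: ah. Qed.

(** Two finite lists are joined: one whose centralizer in [G_ m] is minimal, and one spanning the
    semisimple parts that lie in [G_ m]. Members of the first may lie far outside [G_ m]. *)
Lemma finite_semisimple_parts m : exists F : seq g,
  [/\ forall s, s \in F -> ss s,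
      forall x, G_ m x -> (forall s, s \in F -> [lie s, x] = 0) -> h x
    & forall x, (forall s, s \in F -> [lie s, x] = 0) ->
        forall s, ss s -> G_ m s -> [lie s, x] = 0].
Proof.
pose Z (F : seq g) := [set x | G_ m x /\ forall s, s \in F -> [lie s, x] = 0].
have sZ F : subspace (Z F).
  split=> [|r x y [Gx x0] [Gy y0]]; first by split=> [|s _]; [case: (sbG m)|rewrite lie0r].
  split=> [|s sF]; first by case: (sbG m) => _; apply.
  by rewrite lie_linearr x0 // y0 // scaler0 addr0.
have [||W [F [Fss ->]] Fmin] := min_subspace (fdG m) (P := [set W | exists F, (forall s, s \in F -> ss s) /\ W = Z F]).
- by exists (Z [::]), [::].
- by move=> W [F [_ ->]]; split; [exact: sZ|move=> x []].
have [F' [F'ss sF']] := finite_spanning_subset (fdG m) (T := ss `&` G_ m) (@subIsetr _ _ _).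
exists (F ++ F'); split.
- by move=> s; rewrite mem_cat => /orP[/Fss|/F'ss[]].
- move=> x Gx xF; apply: cartan_of_centralizer => s ts.
  have ZE : Z (s :: F) = Z F.
    apply: Fmin; last by move=> y [Gy yF]; split=> // s' s'F; apply: yF; rewrite inE s'F orbT.
    by exists (s :: F); split=> // s'; rewrite inE => /predU1P[->|/Fss].
  have : Z (s :: F) x by rewrite ZE; split=> // s' s'F; apply: xF; rewrite mem_cat s'F.
  by move=> [_]; apply; rewrite mem_head.
move=> x xF s ts Gs; apply: (sF' s (conj ts Gs) [set s | [lie s, x] = 0]); split.
  split=> [|r u v u0 v0] /=; first by rewrite lie0l.
  by rewrite lie_linearl u0 v0 scaler0 addr0.
by move=> s' s'F /=; apply: xF; rewrite mem_cat s'F orbT.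
Qed.

(** The algebra [G_ m] is spanned by [H_ m], which commutes with [H_ l], and by full root spaces, on
    which [H_ l] acts by scalars. *)
Lemma normalizes_level l m q x : (m <= l)%N -> H_ l q -> G_ m x -> G_ m [lie q, x].
Proof.
move=> ml Hq; apply: (rr_span rr (W := [set x | G_ m [lie q, x]])); first exact: subspace_lie_inr.
  move=> t Ht /=; rewrite (cartan_abelian (fdG l) (alG l) (@rdG l) (crG l)) //; first by case: (sbG m).
  exact: (rr_Hmono rr ml Ht).
move=> al [_ aG] y yw /=; rewrite (yw _ (splitting_H Hq)).
exact: (@subspaceZ _ _ _ (al q) _ (sbG m) (aG _ yw)).
Qed.

Lemma killing_skew l x y z : G_ l x -> G_ l y -> G_ l z ->
  killing (G_ l) [lie x, y] z = - killing (G_ l) y [lie x, z].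
Proof.
move=> Gx Gy Gz; rewrite lieC (killingNl (fdG l) (alG l)) //; last exact: (rr_lie rr).
by rewrite (killing_lie (fdG l) (alG l)).
Qed.

(** This is [killing_nil_part] for [N] the part of [h] in [G_ m], and [M] the centralizer in [G_ l]
    of the semisimple parts in [G_ m]. The element [r] normalizes [N]: its two summands preserve
    [G_ m], and commuting with [F] it sends [N] into what [F] cuts out of [G_ m], which lies in
    [h]. *)
Lemma killing_cartan_nil m l (F : seq g) b r : (m <= l)%N ->
  (forall s, s \in F -> ss s) ->
  (forall x, G_ m x -> (forall s, s \in F -> [lie s, x] = 0) -> h x) ->
  (forall x, (forall s, s \in F -> [lie s, x] = 0) -> forall s, ss s -> G_ m s -> [lie s, x] = 0) ->
  h b -> G_ m b -> nil_on (G_ l) (lie b) ->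
  (exists p q, [/\ r = p + q, G_ m p & H_ l q]) -> (forall s, s \in F -> [lie s, r] = 0) ->
  killing (G_ l) b r = 0.
Proof.
move=> ml Fss Fh Fspan hb Gb nb [p [q [rE Gp Hq]]] Fr.
have Gml := rr_mono rr ml.
have Gr : G_ l r by rewrite rE; apply: (subspaceD (sbG l)); [apply: Gml|apply: HG].
pose M := [set x | G_ l x /\ forall s, ss s -> G_ m s -> [lie s, x] = 0].
apply: (killing_nil_part (fdG l) (alG l) (N := h `&` G_ m) (M := M)).
- split; first exact: subspaceI.
  by move=> x y [hx Gx] [hy Gy]; split; [apply: ah.2|apply: (rr_lie rr)].
- move=> x [hx Gx]; split=> [|s ts _]; first exact: Gml.
  exact: cartan_centralizes.
- by move=> x [].
- move=> w [hw Gw]; have [s [n [jd _ _]]] := jordan_in_exists Gw.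
  have ts : ss s by exists w => //; exists n, m.
  have [_ _ _ wE] := jd; have [Gs Gn sd nn] := jordan_levels jd ml; exists s, n; split=> //.
  move=> x [_ xM]; apply: xM => //.
  by have [] := jordan_levels jd (leqnn m).
- by split=> // s ts Gs; apply: Fspan.
- move=> y [hy Gy].
  have Gry : G_ m [lie r, y].
    rewrite rE lieDl; apply: (subspaceD (sbG m)); first exact: (rr_lie rr).
    exact: normalizes_level Hq Gy.
  split=> //; apply: Fh => // s sF.
  by rewrite lie_derivation Fr // lie0l add0r (cartan_centralizes (Fss s sF) hy) lie0r.
by split.
Qed.

(* [kappa(a b c u, u') = - kappa(b, [c u, a u'])], and [killing_cartan_nil] applies
   as soon as [[c u, a u']] commutes with [F]. *)
Lemma cartan_triple_kills k m l (V V' : set g) (F : seq g) : (k <= m)%N -> (m <= l)%N ->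
  (forall s, s \in F -> ss s) ->
  (forall x, G_ m x -> (forall s, s \in F -> [lie s, x] = 0) -> h x) ->
  (forall x, (forall s, s \in F -> [lie s, x] = 0) -> forall s, ss s -> G_ m s -> [lie s, x] = 0) ->
  (forall s, s \in F -> G_ l s /\ diag_on (G_ l) (lie s)) ->
  subspace V -> subspace V' -> V `<=` G_ l -> V' `<=` G_ l ->
  (forall x u, x \in F \/ G_ k x -> V u -> V [lie x, u]) ->
  (forall x u, x \in F \/ G_ k x -> V' u -> V' [lie x, u]) ->
  (forall u, V u -> (forall u', V' u' -> killing (G_ l) u u' = 0) -> u = 0) ->
  (forall x y u u', lie_product (G_ k) (G_ k) x -> lie_product (G_ k) (G_ k) y -> V u -> V' u' ->
     exists p q, [/\ [lie [lie x, u], [lie y, u']] = p + q, G_ m p & H_ l q]) ->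
  forall a b c u, h a -> h b -> h c ->
    lie_product (G_ k) (G_ k) a -> lie_product (G_ k) (G_ k) b -> lie_product (G_ k) (G_ k) c ->
    nil_on (G_ k) (lie b) -> V u -> [lie a, [lie b, [lie c, u]]] = 0.
Proof.
move=> km ml Fss Fh Fspan Fd sV sV' VG VG' Vst Vst' nd br a b c u ha hb hc Sa Sb Sc nb Vu.
have kl := leq_trans km ml; have Gkl := rr_mono rr kl.
have SG : lie_product (G_ k) (G_ k) `<=` G_ k := derived_sub (fdG k) (alG k).
have Ga := Gkl _ (SG _ Sa); have Gb := Gkl _ (SG _ Sb); have Gc := Gkl _ (SG _ Sc).
have Vk x v : lie_product (G_ k) (G_ k) x -> V v -> V [lie x, v] by move=> /SG Gx; apply: Vst; right.
have Vk' x v : lie_product (G_ k) (G_ k) x -> V' v -> V' [lie x, v] by move=> /SG Gx; apply: Vst'; right.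
have nbl := nil_on_extend (fdG l) (alG l) (alG k) Gkl Sb nb.
have Fab s s' : s \in F -> s' \in F -> [lie s, s'] = 0.
  by move=> /Fss ts /Fss ts'; apply: cartan_centralizes (semisimple_in_cartan ts').
pose f v := [lie a, [lie b, [lie c, v]]].
have Vf v : V v -> V (f v) by move=> Vv; do 3!apply: (Vk) => //.
apply: nd; first exact: Vf.
suff : V `<=` [set v | V v /\ forall v', V' v' -> killing (G_ l) (f v) v' = 0].
  by move=> /(_ u Vu)[].
apply: (joint_eigen_span (fdG l) (alG l) Fd Fab) => //.
- by move=> s v sF; apply: Vst; left.
- split=> [|r x y [Vx x0] [Vy y0]].
    split; first by case: sV.
    by move=> v' /VG' Gv'; rewrite /f !lie0r; apply: killing0l.
  split; first by case: sV => _; apply.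
  move=> v' Vv'; rewrite /f !lie_linearr killingPl ?x0 ?y0 ?mulr0 ?addr0 //; last exact: VG'.
    exact/VG/Vf.
  exact/VG/Vf.
move=> v Vv vF; split=> //; have Gfv := VG _ (Vf _ Vv).
suff : V' `<=` [set v' | V' v' /\ killing (G_ l) v' (f v) = 0].
  by move=> V'0 v' Vv'; have [_ <-] := V'0 v' Vv'; apply: killingC => //; apply: VG'.
apply: (joint_eigen_span (fdG l) (alG l) Fd Fab) => //.
- by move=> s x sF; apply: Vst'; left.
- split=> [|r x y [Vx x0] [Vy y0]]; first by split; [case: sV'|apply: killing0l].
  split; first by case: sV' => _; apply.
  by rewrite killingPl ?x0 ?y0 ?mulr0 ?addr0 //; apply: VG'.
move=> v' Vv' v'F; split=> //; have Gv' := VG' _ Vv'.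
rewrite (killingC (fdG l) (alG l)) //.
have comm s x w (r : C) : s \in F -> h x -> [lie s, w] = r *: w -> [lie s, [lie x, w]] = r *: [lie x, w].
  move=> sF hx sw; rewrite lie_commute; first by rewrite sw lieZr.
  by apply: cartan_centralizes => //; apply: Fss.
pose r := [lie [lie c, v], [lie a, v']].
have [Fr|nFr] := pselect (forall s, s \in F -> [lie s, r] = 0).
  rewrite /f killing_skew //; last by apply/VG; do 2!apply: (Vk) => //.
  rewrite (killing_lie (fdG l) (alG l)) //; [|by apply/VG/Vk|by apply/VG'/Vk'].
  have Gmb : G_ m b := rr_mono rr km (SG _ Sb).
  by rewrite (killing_cartan_nil ml Fss Fh Fspan hb Gmb nbl (br _ _ _ _ Sc Sa Vv Vv') Fr) oppr0.
(* Now the weights of [v] and [v'] are not opposite for some [s]. As [a], [b], [c] commute with [s],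
   [f v] has the weight of [v], and invariance under [s] gives orthogonality. *)
have [s sF sr] : exists2 s, s \in F & [lie s, r] <> 0.
  by apply: contrapT => nex; apply: nFr => s sF; apply: contrapT => sr; apply: nex; exists s.
have [Gs _] := Fd s sF; have [x xv] := vF s sF; have [y yv'] := v'F s sF.
have xy0 : x + y != 0.
  apply/eqP => xy0; apply: sr; rewrite /r lie_derivation (comm s c v x) // (comm s a v' y) //.
  by rewrite lieZl lieZr -scalerDl xy0 scale0r.
apply: (mulfI xy0); rewrite mulr0 mulrDl.
have <- : killing (G_ l) [lie s, f v] v' = x * killing (G_ l) (f v) v'.
  by rewrite /f (comm s a _ x) //; [apply: killingZl|do 2!apply: (comm) => //].
rewrite killing_skew // yv' [X in - X + _](killingC (fdG l) (alG l)) //; last exact: (@subspaceZ _ _ _ y _ (sbG l) Gv').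
rewrite (killingZl (fdG l) (alG l)) // [X in - (_ * X)](killingC (fdG l) (alG l)) //.
by rewrite addNr.
Qed.

Lemma semisimple_common_level k (F : seq g) : (forall s, s \in F -> ss s) ->
  exists2 j, (k <= j)%N & forall s, s \in F -> forall l, (j <= l)%N -> G_ l s /\ diag_on (G_ l) (lie s).
Proof.
elim: F => [|s F IHF] Fss; first by exists k.
have [|j kj jP] := IHF; first by move=> s' s'F; apply: Fss; rewrite inE s'F orbT.
have [i iP] := semisimple_level (Fss s (mem_head _ _)).
exists (maxn i j) => [|s' ]; first exact: leq_trans kj (leq_maxr i j).
rewrite inE => /predU1P[->|s'F] l; rewrite geq_max => /andP[il jl]; first exact: iP.
exact: jP.
Qed.

Lemma nilpotent_parts_depth2 k a b c : h a -> h b -> h c ->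
  lie_product (G_ k) (G_ k) a -> lie_product (G_ k) (G_ k) b -> lie_product (G_ k) (G_ k) c ->
  nil_on (G_ k) (lie b) -> nil_on (G_ k) (lie c) -> [lie a, [lie b, c]] = 0.
Proof.
move=> ha hb hc Sa Sb Sc nb nc; apply: contrapT => z0.
have SG : lie_product (G_ k) (G_ k) `<=` G_ k := derived_sub (fdG k) (alG k).
have Sz : lie_product (G_ k) (G_ k) [lie a, [lie b, c]].
  by apply: lie_product_lie; [apply: SG|apply: (rr_lie rr); apply: SG].
have [be kbe beI] := root_in_ideal rr Sz z0.
have [m km disp] := displacement_exists rr kbe.
have [F [Fss Fh Fspan]] := finite_semisimple_parts m.
have [j kj Fj] := semisimple_common_level k Fss.
have [l [V [V' [[jl ml sV sV' VG] st nd br [x [u [xw Vu]]]]]]] := disp j.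
have stF y : y \in F \/ G_ k y -> G_ j y.
  by move=> [/Fj/(_ j (leqnn j))[]|/(rr_mono rr kj)].
have kill := cartan_triple_kills km ml Fss Fh Fspan (fun s sF => Fj s sF l jl) sV sV'
  (fun v Vv => VG v (or_introl Vv)) (fun v Vv => VG v (or_intror Vv))
  (fun y v yP => (st y (stF y yP)).1 v) (fun y v yP => (st y (stF y yP)).2 v) nd br.
(* The expansion consists of the products abc, acb, bca and cba; the middle factor, whose nilpotency
   [kill] requires, is always [b] or [c]. *)
have zV v : V v -> [lie [lie a, [lie b, c]], v] = 0.
  move=> Vv; rewrite lie_bracketE !(lie_bracketE b c) lieBr.
  by rewrite !kill // ?subrr.
(* The annihilator of [V] is an ideal of [G_ k] containing the supposedly nonzero bracket, hence
   also the root space of [be], which moves the vector [u] of [V]. *)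
pose K := [set y | G_ k y /\ forall v, V v -> [lie y, v] = 0].
have idK : ideal (G_ k) K.
  split.
  - split=> [|r y w [Gy y0] [Gw w0]].
      by split=> [|v _]; [case: (sbG k)|rewrite lie0l].
    split; first by case: (sbG k) => _; apply.
    by move=> v Vv; rewrite lie_linearl y0 // w0 // scaler0 addr0.
  - by move=> y [].
  move=> y w Gy [Gw w0]; split; first exact: (rr_lie rr).
  move=> v Vv; rewrite lie_bracketE (w0 v Vv) lie0r w0 ?subr0 //.
  by apply: (st y _).1 => //; apply: (rr_mono rr kj).
have [_ xV] := beI K idK (conj (SG _ Sz) zV) x xw.
by apply; apply: xV.
Qed.

Lemma cartan_nilpotent_part k x : h x -> G_ k x -> exists n,
  [/\ h n, lie_product (G_ k) (G_ k) n, nil_on (G_ k) (lie n) & forall y, h y -> [lie x, y] = [lie n, y]].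
Proof.
move=> hx Gx; have [s [n [jd Sn nn]]] := jordan_in_exists Gx.
have ts : ss s by exists x => //; exists n, k.
have [_ _ _ xE] := jd; have hs := semisimple_in_cartan ts; exists n; split=> //.
  by have -> : n = x - s; [rewrite xE addrAC subrr add0r|apply: (subspaceB sh)].
by move=> y hy; rewrite xE lieDl cartan_centralizes // add0r.
Qed.

Lemma cartan_depth2 a b c : h a -> h b -> h c -> [lie [lie a, b], c] = 0.
Proof.
move=> ha hb hc; have [i Ga] := rr_cover rr a; have [j ij Gb] := rr_cover_from rr i b.
have [k jk Gc] := rr_cover_from rr j c; have {}Gb := rr_mono rr jk Gb.
have {}Ga := rr_mono rr (leq_trans ij jk) Ga.
have [a' [ha' Sa na aE]] := cartan_nilpotent_part ha Ga.
have [b' [hb' Sb nb bE]] := cartan_nilpotent_part hb Gb.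
have [c' [hc' Sc nc cE]] := cartan_nilpotent_part hc Gc.
have hab : h [lie a', b'] by apply: ah.2.
have -> : [lie a, b] = [lie a', b'] by rewrite aE // lieC bE // -lieC.
by rewrite lieC cE // (nilpotent_parts_depth2 hc' ha' hb' Sc Sa Sb na nb) oppr0.
Qed.

Lemma cartan_lie_product3 : lie_product (lie_product h h) h = [set 0].
Proof.
apply/seteqP; split=> [x|_ ->]; last exact: subspace0 (subspace_lie_product _ _).
apply; split=> [|_ [y hhy [z hz <-]]]; first by split=> // r _ _ -> ->; rewrite scaler0 addr0.
apply: (hhy [set y | forall z, h z -> [lie y, z] = 0]) => //; split.
  split=> [w _|r u v u0 v0 w hw]; first by rewrite lie0l.
  by rewrite lie_linearl u0 // v0 // scaler0 addr0.
by move=> _ [u hu [v hv <-]] w hw; apply: cartan_depth2.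
Qed.

Lemma cartan_ad_nil_space : h = ad_nil_space h.
Proof.
apply/seteqP; split=> [v hv|]; last exact: ad_nil_space_sub.
exists 2%N => // x hx /=; rewrite lieC; apply/eqP; rewrite oppr_eq0; apply/eqP.
by apply: cartan_depth2.
Qed.

End Main.

Theorem theorem4p12 (R : realType) (g : lieAlgType R[i])
    (G_ H_ : nat -> set g) (h : set g) :
  root_reductive G_ H_ ->
  cartan_subalgebra G_ h ->
  lie_product (lie_product h h) h = [set 0] /\ h = ad_nil_space h.
Proof.
move=> rr ch; split.
  exact: (@cartan_lie_product3 R[i] g G_ H_ h rr ch).
exact: (@cartan_ad_nil_space R[i] g G_ H_ h rr ch).
Qed.
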